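(* Let $p>1$, $\frac1p+\frac1{p'}=1$, let $s_*\in(0,1)$, and let $g,d,h:[0,1]\to\mathbb{R}$ satisfy the standing assumptions on $g$, $d$, $h$ listed in the context. Put $h_M:=\sup_{s_*\le t\le 1}h(t)$, $h_m:=\inf_{0\le t\le s_*}h(t)$ and $$\mu_1:=\sup_{t\in(0,s_* )}\frac{-(d(t))^{\frac1{p-1}}g(t)}{(s_*-t)^{p'-1}}>0,\qquad \mu_2:=\sup_{t\in(s_*,1)}\frac{(d(t))^{\frac1{p-1}}g(t)}{(t-s_* )^{p'-1}}>0$$ (possibly $+\infty$). Suppose that $h$ further satisfies $$\int_{s_*}^{t_*}(h(s_* )-h(t))\,dt\le0\quad\text{for some } t_*\in[0,1]\setminus\{s_*\}.$$ Then there is a number $c^*\in\mathbb{R}$ with $$h_m-(p')^{\frac1{p'}}p^{\frac1p}\mu_1^{\frac1{p'}}<c^*<h_M+(p')^{\frac1{p'}}p^{\frac1p}\mu_2^{\frac1{p'}}$$ such that the problem $$(d(U)|U'|^{p-2}U')'+(c-h(U))U'+g(U)=0 \ \text{ on } \mathbb{R},\qquad \lim_{z\to-\infty}U(z)=1,\quad \lim_{z\to+\infty}U(z)=0 \tag{P}$$ admits a unique profile $U=U(z)$, $z\in\mathbb{R}$, satisfying (i)–(iv) below if and only if $c=c^*$: (i) $U$ is strictly decreasing on the open interval $(z_0,z_1)=\{z\in\mathbb{R}:0<U(z)<1\}$, where $-\infty\le z_0<0<z_1\le+\infty$, $U(0)=\frac12$, $U(z)=1$ for $z\in(-\infty,z_0]$,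 and $U(z)=0$ for $z\in[z_1,+\infty)$. In particular, for every $z\in(z_0,z_1)$ both one-sided derivatives $U'(z-)$ and $U'(z+)$ exist and are nonzero. (ii) $M_U=\{\zeta_1,\zeta_2,\dots,\zeta_r\}$, and $U\in C(\mathbb{R})$ is piecewise $C^1$ in the sense that $U|_{(\zeta_i,\zeta_{i+1})}\in C^1(\zeta_i,\zeta_{i+1})$ for $i=0,1,\dots,r$, with $\zeta_0=z_0$, $\zeta_{r+1}=z_1$, and the one-sided derivatives $U'(\zeta_i\pm)=\lim_{z\to\zeta_i\pm}U'(z)$, $i=1,\dots,r$, exist and are finite. (iii) $\lim_{z\to z_0+}d(U(z))|U'(z)|^{p-2}U'(z)=\lim_{z\to z_1-}d(U(z))|U'(z)|^{p-2}U'(z)=0$, and $$|U'(\zeta_i-)|^{p-2}U'(\zeta_i-)\lim_{z\to\zeta_i-}d(U(z))=|U'(\zeta_i+)|^{p-2}U'(\zeta_i+)\lim_{z\to\zeta_i+}d(U(z)),\quad i=1,\dots,r.$$ (iv) $U$ satisfies (P) in the classical sense on $\mathbb{R}\setminus(\partial M_U\cup K_U\cup\partial N_U)$.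
   Context: Standing assumptions on $g,d,h$: - $g:[0,1]\to\mathbb{R}$ is continuous, $g(0)=g(s_* )=g(1)=0$, $g<0$ in $(0,s_* )$, $g>0$ in $(s_*,1)$. - $d:[0,1]\to\mathbb{R}$ is nonnegative, lower semicontinuous on $[0,1]$ and strictly positive in $(0,1)$. There are points $0=m_0<m_1<\dots<m_r<m_{r+1}=1$ such that $d$ has jump discontinuities at $m_i$ ($i=1,\dots,r$) and $d|_{(m_i,m_{i+1})}\in C(m_i,m_{i+1})$, $i=0,\dots,r$. In addition $d^{\frac1{p-1}}g\in L^1(0,1)$ and $\int_0^1(d(t))^{\frac1{p-1}}g(t)\,dt\ge0$. - $h:[0,1]\to\mathbb{R}$ is bounded and continuous at $s_*$. There are points $0=k_0<k_1<\dots<k_q<k_{q+1}=1$ such that $h$ has jump discontinuities at $k_j$ ($j=1,\dots,q$) and $h|_{(k_j,k_{j+1})}\in C(k_j,k_{j+1})$, $j=0,\dots,q$. Notation. For a monotone continuous $U:\mathbb{R}\to[0,1]$ set $M_U=\{z:U(z)=m_i \text{ for some } i=1,\dots,r\}$, $K_U=\{z:U(z)=k_j\text{ for some }j=1,\dots,q\}$, $N_U=\{z:U(z)=0\text{ or }U(z)=1\}$, $D_U=\partial M_U\cup\partial N_U$, and $H(u)=\int_0^u h(s)\,ds$. Monotone solution (profile). A monotone continuous function $U:\mathbb{R}\to[0,1]$ is a monotone solution of $(d(U)|U'|^{p-2}U')'+(c-h(U))U'+g(U)=0$ if: (a) $U\in C^1(\mathbb{R}\setminus D_U)$ and $U'(z)\ne0$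 for all $z\in\mathbb{R}\setminus D_U$ with $U(z)\in(0,1)$; (b) for any $z\in\partial M_U$ there exist finite nonzero one-sided derivatives $U'(z-),U'(z+)$ and $L(z):=|U'(z-)|^{p-2}U'(z-)\lim_{\xi\to z-}d(U(\xi))=|U'(z+)|^{p-2}U'(z+)\lim_{\xi\to z+}d(U(\xi))$; (c) the function $v:\mathbb{R}\to\mathbb{R}$ given by $v(z)=d(U(z))|U'(z)|^{p-2}U'(z)$ for $z\notin\partial M_U\cup\partial N_U$, $v(z)=0$ for $z\in\partial N_U$, $v(z)=L(z)$ for $z\in\partial M_U$, is continuous, satisfies, for all $z,\hat z\in\mathbb{R}$, $v(\hat z)-v(z)+c(U(\hat z)-U(z))-(H(U(\hat z))-H(U(z)))+\int_z^{\hat z}g(U(\tau))\,d\tau=0$, and $\lim_{z\to\pm\infty}v(z)=0$. A profile of (P) is a monotone solution, in this sense, that satisfies the boundary conditions in (P). *)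

(* Defs.v *)
From HB Require Import structures.
From mathcomp Require Import all_boot all_order all_algebra.
From mathcomp Require Import all_classical all_reals all_analysis.

Set Implicit Arguments.
Unset Strict Implicit.
Unset Printing Implicit Defensive.

Import Order.TTheory GRing.Theory Num.Theory.
Import numFieldNormedType.Exports.

Local Open Scope classical_set_scope.
Local Open Scope ring_scope.

(* Functions given on [0, 1] are represented by total functions [R -> R]; every
   hypothesis below constrains only their values on [0, 1], and solutions [U]
   take their values there. *)

Section Auxiliary.
Context {R : realType}.
Implicit Types (f U : R -> R) (a b l z : R) (A : set R).

Definition boundary A : set R := closure A `\` interior A.

(* [int_a^b f], with the sign convention [int_a^b f = - int_b^a f]. *)
Definition oriented_integral f a b : R :=
  if a <= b then \int[@lebesgue_measure R]_(x in `[a, b]) f x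
  else - \int[@lebesgue_measure R]_(x in `[b, a]) f x.

Definition diff_quot f z : R -> R := fun e => e^-1 * (f (e + z) - f z).

Definition left_derivable f z := cvg (diff_quot f z e @[e --> 0^'-]).
Definition right_derivable f z := cvg (diff_quot f z e @[e --> 0^'+]).

Definition left_derivative f z : R := lim (diff_quot f z e @[e --> 0^'-]).
Definition right_derivative f z : R := lim (diff_quot f z e @[e --> 0^'+]).

(* Meant for open [A]. *)
Definition C1_on A f :=
  forall z, A z -> derivable f z 1 /\ {for z, continuous (derive1 f)}.

Definition jump_discontinuity f z :=
  exists l1 l2 : R,
    [/\ f x @[x --> z^'-] --> l1, f x @[x --> z^'+] --> l2 & l1 != l2].

(* The values [x i] for i > n + 1 are irrelevant. *)
Definition subdivision01 (n : nat) (x : nat -> R) :=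
  [/\ x 0%N = 0, x n.+1 = 1 & forall i, (i <= n)%N -> x i < x i.+1].

Definition piecewise_continuous01 (n : nat) (x : nat -> R) f :=
  [/\ subdivision01 n x,
      forall i, (1 <= i <= n)%N -> jump_discontinuity f (x i) &
      forall i, (i <= n)%N -> {in `]x i, x i.+1[, continuous f}].

(* [z0] may be infinite, and [+oo] is not the left end of a nonempty interval. *)
Definition cvg_left_end f (z0 : \bar R) l : Prop :=
  match z0 with
  | z%:E => f x @[x --> z^'+] --> l
  | -oo%E => f x @[x --> -oo] --> l
  | +oo%E => False
  end.

Definition cvg_right_end f (z1 : \bar R) l : Prop :=
  match z1 with
  | z%:E => f x @[x --> z^'-] --> l
  | +oo%E => f x @[x --> +oo] --> l
  | -oo%E => False
  end.

End Auxiliary.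

Section StandingAssumptions.
Context {R : realType}.

Definition standing_g (s : R) (g : R -> R) :=
  [/\ {within `[0, 1], continuous g},
      [/\ g 0 = 0, g s = 0 & g 1 = 0],
      {in `]0, s[, forall t, g t < 0} &
      {in `]s, 1[, forall t, 0 < g t}].

(* The subspace topology makes the semicontinuity relative to [0, 1]. *)
Definition standing_d (p : R) (g d : R -> R) (r : nat) (m : nat -> R) :=
  [/\ {in `[0, 1], forall t, 0 <= d t} /\ {in `]0, 1[, forall t, 0 < d t},
      lower_semicontinuous (EFin \o d : subspace `[0, 1] -> \bar R),
      piecewise_continuous01 r m d,
      (@lebesgue_measure R).-integrable `]0, 1[
        (EFin \o (fun t => d t `^ (p - 1)^-1 * g t)) &
      0 <= \int[@lebesgue_measure R]_(t in `]0, 1[)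
             (d t `^ (p - 1)^-1 * g t)].

Definition standing_h (s : R) (h : R -> R) (q : nat) (k : nat -> R) :=
  [/\ [bounded h t | t in `[0, 1]],
      {for s, continuous h} &
      piecewise_continuous01 q k h].

End StandingAssumptions.

Section Profiles.
Context {R : realType}.
Variables (p : R) (g d h : R -> R).
(* The discontinuities of [d] are m_1, ..., m_r, those of [h] k_1, ..., k_q. *)
Variables (r q : nat) (m k : nat -> R).
Variables (c : R) (U : R -> R).

(* |x|^{p-2} x; it vanishes at x = 0 also for p < 2. *)
Definition signed_pow (x : R) : R := `|x| `^ (p - 2) * x.

Definition flux (z : R) : R := d (U z) * signed_pow (derive1 U z).

Definition left_flux (z : R) : R :=
  signed_pow (left_derivative U z) * lim (d (U x) @[x --> z^'-]).

Definition right_flux (z : R) : R :=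
  signed_pow (right_derivative U z) * lim (d (U x) @[x --> z^'+]).

Definition M_set : set R := [set z | exists2 i, (1 <= i <= r)%N & U z = m i].
Definition K_set : set R := [set z | exists2 j, (1 <= j <= q)%N & U z = k j].
Definition N_set : set R := [set z | U z = 0 \/ U z = 1].
Definition D_set : set R := boundary M_set `|` boundary N_set.

Definition flux_transmission (z : R) :=
  [/\ cvg (d (U x) @[x --> z^'-]), cvg (d (U x) @[x --> z^'+]) &
      left_flux z = right_flux z].

(* The boundaries of [M_set] and [N_set] are disjoint for continuous [U], so
   the order of the tests does not matter. *)
Definition extended_flux (z : R) : R :=
  if z \in boundary N_set then 0
  else if z \in boundary M_set then left_flux z
  else flux z.

Definition H_prim (u : R) : R := oriented_integral h 0 u.

Definition monotone_solution : Prop :=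
  [/\ [/\ nondecreasing_fun U \/ nonincreasing_fun U, continuous U &
          forall z, 0 <= U z <= 1],
      C1_on (~` D_set) U /\
        (forall z, ~ D_set z -> 0 < U z < 1 -> derive1 U z != 0),
      forall z, boundary M_set z ->
        [/\ left_derivable U z /\ left_derivative U z != 0,
            right_derivable U z /\ right_derivative U z != 0 &
            flux_transmission z] &
      [/\ continuous extended_flux,
          forall z z' : R,
            extended_flux z' - extended_flux z + c * (U z' - U z)
            - (H_prim (U z') - H_prim (U z))
            + oriented_integral (g \o U) z z' = 0,
          extended_flux z @[z --> -oo] --> (0 : R) &
          extended_flux z @[z --> +oo] --> (0 : R)]].

Definition profile : Prop :=
  [/\ monotone_solution,
      U z @[z --> -oo] --> (1 : R) & U z @[z --> +oo] --> (0 : R)].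

Definition satisfies_i (z0 z1 : \bar R) : Prop :=
  [/\ (z0 < 0 < z1)%E /\ [set z | 0 < U z < 1] = [set z | (z0 < z%:E < z1)%E],
      {in [set z | 0 < U z < 1] &, forall x y, x < y -> U y < U x},
      U 0 = 2^-1,
      (forall z, (z%:E <= z0)%E -> U z = 1) /\
        (forall z, (z1 <= z%:E)%E -> U z = 0) &
      forall z, (z0 < z%:E < z1)%E ->
        [/\ left_derivable U z, left_derivative U z != 0,
            right_derivable U z & right_derivative U z != 0]].

Definition nodes (z0 z1 : \bar R) (zeta : nat -> R) (i : nat) : \bar R :=
  if i == 0%N then z0 else if i == r.+1 then z1 else (zeta i)%:E.

Definition satisfies_ii (z0 z1 : \bar R) (zeta : nat -> R) : Prop :=
  [/\ M_set = [set zeta i | i in [set i | (1 <= i <= r)%N]],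
      forall i, (i <= r)%N -> (nodes z0 z1 zeta i < nodes z0 z1 zeta i.+1)%E,
      continuous U,
      forall i, (i <= r)%N ->
        C1_on [set z | (nodes z0 z1 zeta i < z%:E < nodes z0 z1 zeta i.+1)%E] U &
      forall i, (1 <= i <= r)%N ->
        [/\ left_derivable U (zeta i),
            derive1 U z @[z --> (zeta i)^'-] --> left_derivative U (zeta i),
            right_derivable U (zeta i) &
            derive1 U z @[z --> (zeta i)^'+] --> right_derivative U (zeta i)]].

Definition satisfies_iii (z0 z1 : \bar R) (zeta : nat -> R) : Prop :=
  [/\ cvg_left_end flux z0 0, cvg_right_end flux z1 0 &
      forall i, (1 <= i <= r)%N -> flux_transmission (zeta i)].

Definition satisfies_iv : Prop :=
  forall z, ~ (boundary M_set `|` K_set `|` boundary N_set) z ->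
    [/\ derivable U z 1, derivable flux z 1 &
        derive1 flux z + (c - h (U z)) * derive1 U z + g (U z) = 0].

Definition satisfies_i_to_iv : Prop :=
  exists (z0 z1 : \bar R) (zeta : nat -> R),
    [/\ satisfies_i z0 z1, satisfies_ii z0 z1 zeta,
        satisfies_iii z0 z1 zeta & satisfies_iv].

End Profiles.

(* Main.v *)
Require Import Defs.
From HB Require Import structures.
From mathcomp Require Import all_boot all_order all_algebra.
From mathcomp Require Import all_classical all_reals all_analysis.
From mathcomp Require Import measurable_realfun ring lra.
Set Implicit Arguments.
Unset Strict Implicit.
Unset Printing Implicit Defensive.
Import Order.TTheory GRing.Theory Num.Theory.
Import numFieldNormedType.Exports.
Local Open Scope classical_set_scope.
Local Open Scope ring_scope.

(** Along a decreasing profile the height [t = U] can serve as the variable.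
    Let [w t] be minus the flux [d(U) |U'|^(p-2) U'] at height [t], and put
    [alpha = (p - 1)^-1] and [f = d ^ alpha * g].  Then [|U'| = (w / d) ^ alpha],
    and the equation for [U] becomes the first order problem
      [w' = c - h - f * w ^ (- alpha)],  [w > 0] on [(0, 1)],  [w 0 = w 1 = 0].
    Conversely [U] is recovered from [w] by separating variables, as the
    inverse of the primitive of [- (d / w) ^ alpha] vanishing at [1 / 2], which
    is the normalization [U 0 = 1 / 2].  Both directions hold whatever the jumps
    of [d] and [h], since the flux and [w] are continuous: [profile_exists] and
    [profile_reduction].  The theorem thus says that the problem for [w] has a
    unique speed ([wave_exists], [wave_speed_unique]) and, for it, a unique
    solution ([wave_unique]).

    On [(0, s)] the coefficient [- f] of the singular term is positive, so the
    right-hand side decreases in [w]: the problem started at [w 0 = 0] is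
    dissipative.  This gives comparison, uniqueness, and a value at [s] which
    is monotone and Lipschitz in [c] ([half_comparison], [half_value]).
    Existence is the delicate point, as the equation is singular at the
    starting point.  Replacing [w] by [max w eps] in the singular term makes it
    Lipschitz, fixed point iteration solves the truncated problem ([picard]),
    and the solutions increase as [eps] tends to [0], between barriers
    ([half_solution_exists]).  On [(s, 1)] the reflection [t -> 1 - t] leads
    back to the same half problem, with [- h] and [- c] for [h] and [c].

    As [c] grows, the value at [s] of the left branch increases to infinity and
    that of the right branch decreases, so that they agree for some [c].  If
    they agreed at height [0], then [c = h s], because near [s] the term
    [c - h] decides whether a branch leaves [0]; there the assumption on the
    integral of [h s - h] makes one branch positive ([bvp_exists]).  So the
    common value is positive and the branches fit together.  Two speeds
    [c < c'] cannot both work: the solutions would coincide at [s], where their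
    slopes differ by [c' - c] ([bvp_speed_unique]).  Finally, if [c] violated
    one of the bounds, a straight line ending at [(s, 0)] would be an upper
    barrier for one of the branches and force it down to [0] at [s]
    ([half_end_eq0], [barrier_constant]). *)

(** * Monotonicity off a finite set *)

Section OffFinite.
Context {R : realType}.
Implicit Types (f g : R -> R) (E : seq R) (a b l df : R).

Lemma within_itvP f a b : {within `[a, b], continuous f} <->
  (forall x, a <= x <= b -> forall e, 0 < e -> exists2 d, 0 < d &
    forall y, a <= y <= b -> `|x - y| < d -> `|f x - f y| < e).
Proof.
rewrite subspace_continuousP; split.
  move=> fc x xab e e0.
  have /fc/cvgrPdist_lt/(_ e e0) : `[a, b]%classic x by rewrite /= in_itv.
  rewrite near_withinE => /nbhs_ballP[d /= d0 H]; exists d => // y yab xy.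
  by apply: H => //=; rewrite in_itv.
move=> H x; rewrite /= in_itv /= => xab; apply/cvgrPdist_lt => e e0.
rewrite near_withinE; have [d d0 Hd] := H x xab e e0.
apply/nbhs_ballP; exists d => //= y xy yA; apply: Hd => //.
Qed.

Lemma within_itv_sub f a b a' b' : a <= a' -> b' <= b ->
  {within `[a, b], continuous f} -> {within `[a', b'], continuous f}.
Proof.
move=> aa bb; apply: continuous_subspaceW => x /=.
by rewrite !in_itv /= => /andP[? ?]; apply/andP; split; lra.
Qed.

(** The coefficients jump at finitely many points, so that derivatives are
    only available off a finite set [E]. *)
Lemma le_off_finite f E a b : a <= b -> {within `[a, b], continuous f} ->
  (forall t, a < t < b -> t \notin E ->
    exists2 l : R, is_derive t (1 : R) f l & l <= 0) -> f b <= f a.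
Proof.
elim: E a b => [|e E IH] a b ab fc fd.
  apply: (@ler0_derive1_le_cc _ f a b) => //.
  - by move=> x; rewrite in_itv /= => /fd /(_ isT)[l fl _].
  - move=> x; rewrite in_itv /= => /fd /(_ isT)[l fl l0].
    by rewrite derive1E derive_val.
  - by rewrite in_itv /= lexx ab.
  - by rewrite in_itv /= lexx ab.
have [/andP[ae eb]|ne] := boolP (a < e < b); last first.
  apply: IH => // t tab tE; apply: fd => //; rewrite inE negb_or tE andbT.
  by apply: contraNneq ne => <-.
apply: (@le_trans _ _ (f e)); apply: IH; try exact: ltW.
- exact: within_itv_sub (ltW ae) (lexx _) fc.
- move=> t tab tE; apply: fd; first lra.
  by rewrite inE negb_or tE andbT; apply/negP => /eqP; lra.
- exact: within_itv_sub (lexx _) (ltW eb) fc.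
- move=> t tab tE; apply: fd; first lra.
  by rewrite inE negb_or tE andbT; apply/negP => /eqP; lra.
Qed.

Lemma lt_off_finite f E a b : a < b -> {within `[a, b], continuous f} ->
  (forall t, a < t < b -> t \notin E ->
    exists2 l : R, is_derive t (1 : R) f l & l < 0) -> f b < f a.
Proof.
elim: E a b => [|e E IH] a b ab fc fd.
  apply: (@ltr0_derive1_lt_cc _ f a b) => //.
  - by move=> x; rewrite in_itv /= => /fd /(_ isT)[l fl _].
  - move=> x; rewrite in_itv /= => /fd /(_ isT)[l fl l0].
    by rewrite derive1E derive_val.
  - by rewrite in_itv /= lexx ltW.
  - by rewrite in_itv /= lexx ltW.
have [/andP[ae eb]|ne] := boolP (a < e < b); last first.
  apply: IH => // t tab tE; apply: fd => //; rewrite inE negb_or tE andbT.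
  by apply: contraNneq ne => <-.
apply: (@lt_trans _ _ (f e)); apply: IH => //.
- exact: within_itv_sub (ltW ae) (lexx _) fc.
- move=> t tab tE; apply: fd; first lra.
  by rewrite inE negb_or tE andbT; apply/negP => /eqP; lra.
- exact: within_itv_sub (lexx _) (ltW eb) fc.
- move=> t tab tE; apply: fd; first lra.
  by rewrite inE negb_or tE andbT; apply/negP => /eqP; lra.
Qed.

Lemma cst_off_finite f E a b : a <= b -> {within `[a, b], continuous f} ->
  (forall t, a < t < b -> t \notin E -> is_derive t (1 : R) f 0) -> f b = f a.
Proof.
move=> ab fc fd; apply/eqP; rewrite eq_le (@le_off_finite _ E) //=; last first.
  by move=> t tab tE; exists 0 => //; apply: fd.
rewrite -lerN2; apply: (@le_off_finite (fun x => - f x) E) => //.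
  by move=> x; apply: continuousN; apply: fc.
by move=> t tab tE; exists (- 0); [have := fd t tab tE; exact: is_deriveN|rewrite oppr0].
Qed.

Lemma within_D f g a b : {within `[a, b], continuous f} -> {within `[a, b], continuous g} ->
  {within `[a, b], continuous (fun x => f x + g x)}.
Proof. by move=> fc gc x; apply: cvgD; [exact: fc|exact: gc]. Qed.

Lemma within_B f g a b : {within `[a, b], continuous f} -> {within `[a, b], continuous g} ->
  {within `[a, b], continuous (fun x => f x - g x)}.
Proof. by move=> fc gc x; apply: cvgB; [exact: fc|exact: gc]. Qed.

Lemma within_M f g a b : {within `[a, b], continuous f} -> {within `[a, b], continuous g} ->
  {within `[a, b], continuous (fun x => f x * g x)}.
Proof. by move=> fc gc x; apply: cvgM; [exact: fc|exact: gc]. Qed.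

Lemma within_N f a b : {within `[a, b], continuous f} ->
  {within `[a, b], continuous (fun x => - f x)}.
Proof. by move=> fc x; apply: cvgN; exact: fc. Qed.

Lemma within_cst (c : R) a b : {within `[a, b], continuous (fun=> c)}.
Proof. by move=> x; exact: cvg_cst. Qed.

Lemma within_id a b : {within `[a, b], continuous (fun x : R => x)}.
Proof. by apply: continuous_subspaceT => x; exact: cvg_id. Qed.

Lemma within_comp f g a b : {within `[a, b], continuous f} ->
  (forall x, a <= x <= b -> {for f x, continuous g}) ->
  {within `[a, b], continuous (fun x => g (f x))}.
Proof.
rewrite !subspace_continuousP => fc gc x xab.
apply: (cvg_comp _ _ (fc x xab)); apply: gc.
by move: xab; rewrite /= in_itv.
Qed.

Lemma at_rightP f a l : f x @[x --> a^'+] --> l <->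
  (forall e, 0 < e -> exists2 d, 0 < d & forall x, a < x < a + d -> `|f x - l| < e).
Proof.
split.
  move=> /cvgrPdist_lt H e /H; rewrite near_withinE => /nbhs_ballP[d /= d0 Hd].
  exists d => // x /andP[ax xd]; rewrite distrC; apply: Hd => //.
  by rewrite /ball /= distrC ger0_norm; lra.
move=> H; apply/cvgrPdist_lt => e /H[d d0 Hd]; rewrite near_withinE.
apply/nbhs_ballP; exists d => //= x; rewrite /ball /= => xd ax.
rewrite distrC; apply: Hd; move: xd; rewrite distrC ger0_norm; lra.
Qed.

Lemma at_leftP f b l : f x @[x --> b^'-] --> l <->
  (forall e, 0 < e -> exists2 d, 0 < d & forall x, b - d < x < b -> `|f x - l| < e).
Proof.
split.
  move=> /cvgrPdist_lt H e /H; rewrite near_withinE => /nbhs_ballP[d /= d0 Hd].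
  exists d => // x /andP[ax xd]; rewrite distrC; apply: Hd => //.
  by rewrite /ball /= ger0_norm; lra.
move=> H; apply/cvgrPdist_lt => e /H[d d0 Hd]; rewrite near_withinE.
apply/nbhs_ballP; exists d => //= x; rewrite /ball /= => xd ax.
rewrite distrC; apply: Hd; move: xd; rewrite ger0_norm; lra.
Qed.

Lemma for_contP f x : {for x, continuous f} <->
  (forall e, 0 < e -> exists2 d, 0 < d & forall y, `|y - x| < d -> `|f y - f x| < e).
Proof.
split.
  move=> /cvgrPdist_lt H e /H /nbhs_ballP[d /= d0 Hd].
  exists d => // y xy; rewrite distrC; apply: Hd => //.
  by rewrite /ball /= distrC.
move=> H; apply/cvgrPdist_lt => e /H[d d0 Hd].
apply/nbhs_ballP; exists d => //= y; rewrite /ball /= => xd.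
by rewrite distrC; apply: Hd; rewrite distrC.
Qed.

Lemma within_of_for f a b : (forall t, a <= t <= b -> {for t, continuous f}) ->
  {within `[a, b], continuous f}.
Proof.
move=> fc; apply: continuous_in_subspaceT => t; rewrite inE /= in_itv /=; exact: fc.
Qed.

(** Extension by the limits at both ends, which turns continuity on an open
    interval into continuity on the segment. *)
Definition close_ends f a b l l' t := if t <= a then l else if b <= t then l' else f t.

Lemma close_endsE f a b l l' t : a < t < b -> close_ends f a b l l' t = f t.
Proof. by rewrite /close_ends => /andP[at_ tb]; rewrite !leNgt at_ tb. Qed.

Lemma close_ends_l f a b l l' : close_ends f a b l l' a = l.
Proof. by rewrite /close_ends lexx. Qed.

Lemma close_ends_r f a b l l' : a < b -> close_ends f a b l l' b = l'.
Proof. by move=> ab; rewrite /close_ends leNgt ab lexx. Qed.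

Lemma close_ends_near f a b l l' t : a < t < b -> {near t, f =1 close_ends f a b l l'}.
Proof.
move=> tab; have : \forall z \near t, z \in `]a, b[ by apply: near_in_itvoo; rewrite in_itv.
by apply: filterS => z; rewrite in_itv /= => /close_endsE ->.
Qed.

Lemma close_ends_within f a b l l' : a < b ->
  (forall t, a < t < b -> {for t, continuous f}) ->
  f x @[x --> a^'+] --> l -> f x @[x --> b^'-] --> l' ->
  {within `[a, b], continuous (close_ends f a b l l')}.
Proof.
move=> ab fc /at_rightP fa /at_leftP fb; apply/continuous_within_itvP => //; split.
- move=> t; rewrite in_itv /= => tab; rewrite /continuous_at close_endsE //.
  by apply: cvg_trans (fc t tab); apply: near_eq_cvg; exact: close_ends_near.
- rewrite close_ends_l; apply/at_rightP => e /fa[d d0 Hd].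
  exists (Num.min d (b - a)); first by rewrite lt_min d0 subr_gt0.
  move=> x /andP[ax]; rewrite -ltrBlDl lt_min => /andP[xd xb].
  by rewrite -/(close_ends f a b l l' x) close_endsE; [apply: Hd|]; lra.
- rewrite close_ends_r //; apply/at_leftP => e /fb[d d0 Hd].
  exists (Num.min d (b - a)); first by rewrite lt_min d0 subr_gt0.
  move=> x /andP[ax xb]; have : b - x < Num.min d (b - a) by lra.
  rewrite lt_min => /andP[xd xa].
  by rewrite -/(close_ends f a b l l' x) close_endsE; [apply: Hd|]; lra.
Qed.

Lemma close_ends_is_derive f a b l l' t df : a < t < b ->
  is_derive t (1 : R) f df -> is_derive t (1 : R) (close_ends f a b l l') df.
Proof. by move=> tab; apply: near_eq_is_derive; exact: close_ends_near. Qed.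

(** The sign of the derivative matters only where [f] is positive: were
    [f b > 0], then [f] would decrease from its last nonpositive value on. *)
Lemma barrier f E a b : a <= b -> {within `[a, b], continuous f} -> f a <= 0 ->
  (forall t, a < t < b -> t \notin E -> 0 < f t ->
    exists2 l : R, is_derive t (1 : R) f l & l <= 0) -> f b <= 0.
Proof.
move=> ab fc fa fd; rewrite leNgt; apply/negP => fb.
pose A := [set t | a <= t <= b /\ f t <= 0].
have hA : has_sup A.
  split; first by exists a; split; rewrite ?lexx.
  by exists b => t [/andP[]].
set s := sup A.
have as_ : a <= s by apply: ub_le_sup; [exact: hA.2|split; rewrite ?lexx].
have sb : s <= b by apply: ge_sup; [exact: hA.1|move=> t [/andP[]]].
have fs : f s <= 0.
  rewrite leNgt; apply/negP => fs.
  have [|d d0 H] := (within_itvP f a b).1 fc s _ (f s) fs; first by rewrite as_.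
  have [t At st] := sup_adherent d0 hA; have [tab ft] := At.
  have ts : t <= s by apply: ub_le_sup; [exact: hA.2|].
  have := H t tab; rewrite ger0_norm ?subr_ge0 // => /(_ ltac:(rewrite -/s in st; lra)).
  rewrite ger0_norm; lra.
have : f b <= f s.
  apply: (@le_off_finite _ E) => //; first exact: within_itv_sub fc.
  move=> t /andP[st tb] tE; apply: fd => //; first lra.
  rewrite ltNge; apply/negP => ft.
  have : t <= s by apply: ub_le_sup; [exact: hA.2|split=> //; lra].
  lra.
lra.
Qed.

End OffFinite.

(** * Antiderivatives of piecewise continuous functions *)

Section Antiderivative.
Context {R : realType}.
Notation mu := (@lebesgue_measure R).
Implicit Types (f g F phi : R -> R) (E : seq R) (a b M : R).

Lemma measurable_fun_off_finite f E a b :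
  (forall t, a < t < b -> t \notin E -> {for t, continuous f}) ->
  measurable_fun `]a, b[ f.
Proof.
elim: E a b => [|e E IH] a b fc.
  apply: open_continuous_measurable_fun; first exact: interval_open.
  by move=> x; rewrite inE /= in_itv /= => xab; apply: fc.
have [/andP[ae eb]|ne] := boolP (a < e < b); last first.
  apply: IH => t tab tE; apply: fc => //; rewrite inE negb_or tE andbT.
  by apply: contraNneq ne => <-.
have -> : `]a, b[%classic = `]a, e] `|` `]e, b[.
  apply/seteqP; split => x /=; rewrite !in_itv /=.
    by move=> /andP[ax xb]; have [|] := leP x e; [left|right]; apply/andP; split; lra.
  by case=> /andP[? ?]; apply/andP; split; lra.
apply/measurable_funU => //; split.
  apply/measurable_fun_itv_bndo_bndcP; apply: IH => t tab tE; apply: fc; first lra.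
  by rewrite inE negb_or tE andbT; apply/negP => /eqP; lra.
apply: IH => t tab tE; apply: fc; first lra.
by rewrite inE negb_or tE andbT; apply/negP => /eqP; lra.
Qed.

Lemma measurable_fun_oo_cc f a b : measurable_fun `]a, b[ f -> measurable_fun `[a, b] f.
Proof.
move=> mf; apply/measurable_fun_itv_bndo_bndcP.
by apply/measurable_fun_itv_obnd_cbndP.
Qed.

Lemma integrable_oo_cc f a b : a < b ->
  mu.-integrable `]a, b[ (EFin \o f) -> mu.-integrable `[a, b] (EFin \o f).
Proof.
move=> ab /integrableP[mf fi]; apply/integrableP.
have mf' : measurable_fun `[a, b] f by apply: measurable_fun_oo_cc; exact/measurable_EFinP.
split; first exact/measurable_EFinP.
rewrite -integral_itv_bndo_bndc; last first.
  apply/measurable_EFinP/measurableT_comp => //.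
  by apply: measurable_funS mf' => //; apply: subset_itvl; rewrite bnd_simp.
rewrite -integral_itv_obnd_cbnd //.
by apply/measurable_EFinP/measurableT_comp => //; exact/measurable_EFinP.
Qed.

Lemma integrable_bounded_off_finite f E a b M : a < b ->
  (forall t, a < t < b -> t \notin E -> {for t, continuous f}) ->
  (forall t, a < t < b -> `|f t| <= M) ->
  mu.-integrable `[a, b] (EFin \o f).
Proof.
move=> ab fc fM; apply: integrable_oo_cc => //.
apply: measurable_bounded_integrable => //.
- by rewrite /= lebesgue_measure_itv /= lte_fin ab -EFinB ltry.
- exact: measurable_fun_off_finite fc.
- exists M; split; first exact: num_real.
  move=> x Mx t /=; rewrite in_itv /= => tab.
  exact: le_trans (fM _ tab) (ltW Mx).
Qed.

Lemma integrable_dominated_off_finite f phi E a b M : a < b ->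
  (forall t, a < t < b -> t \notin E -> {for t, continuous f}) ->
  (forall t, a < t < b -> `|f t| <= M * phi t) ->
  mu.-integrable `[a, b] (EFin \o phi) ->
  mu.-integrable `[a, b] (EFin \o f).
Proof.
move=> ab fc fM ip; apply: integrable_oo_cc => //.
have ip' : mu.-integrable `]a, b[ (EFin \o phi).
  by apply: integrableS ip => //; exact: subset_itv_oo_cc.
have : mu.-integrable `]a, b[ (fun t => (M%:E * (EFin \o phi) t)%E).
  exact: integrableZl.
apply: le_integrable => //.
- by apply/measurable_EFinP; exact: measurable_fun_off_finite fc.
- move=> x /=; rewrite in_itv /= => xab.
  by rewrite lee_fin (le_trans (fM _ xab)) // ler_norm.
Qed.

Lemma antiderivative f E a b : a < b ->
  mu.-integrable `[a, b] (EFin \o f) ->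
  (forall t, a < t < b -> t \notin E -> {for t, continuous f}) ->
  let F := oriented_integral f a in
  {within `[a, b], continuous F} /\
  forall t, a < t < b -> t \notin E -> is_derive t (1 : R) F (f t).
Proof.
move=> ab fi fc F.
have FE : {in `[a, b], F =1 (fun x => parameterized_integral mu a x f)}.
  by move=> x; rewrite in_itv /= => /andP[ax _]; rewrite /F /oriented_integral ax.
split.
  apply: (@subspace_eq_continuous _ _ _ _ _ _ (parameterized_integral_continuous (ltW ab) fi)).
  by move=> x; rewrite inE /= => xab; exact: (esym (FE _ xab)).
move=> t /[dup] tab /andP[at_ tb] tE.
have [D1 D2] := @continuous_FTC1_closed _ f a t b tb fi at_ (fc t tab tE).
have nF : {near t, (fun x => parameterized_integral mu a x f) =1 F}.
  have : \forall x \near t, x \in `]a, b[ by apply: near_in_itvoo; rewrite in_itv.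
  apply: filterS => x xab; rewrite FE //; move: xab; rewrite !in_itv /=.
  by move=> /andP[? ?]; rewrite !ltW.
apply: (near_eq_is_derive nF).
by rewrite -D2 derive1E; exact: derivableP.
Qed.

Lemma oriented_integralC f x y : oriented_integral f x y = - oriented_integral f y x.
Proof.
rewrite /oriented_integral; case: ltgtP => xy; rewrite ?opprK //.
by rewrite xy set_itv1 Rintegral_set1 oppr0.
Qed.

Lemma eq_oriented_integral f g x y :
  (forall t, Num.min x y <= t <= Num.max x y -> f t = g t) ->
  oriented_integral f x y = oriented_integral g x y.
Proof.
move=> fg; rewrite /oriented_integral; case: leP fg => xy fg.
  by apply: eq_Rintegral => t; rewrite inE /= in_itv /=; exact: fg.
by congr (- _); apply: eq_Rintegral => t; rewrite inE /= in_itv /=; exact: fg.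
Qed.

Lemma oriented_integral_diff f F E a b x y : a <= x <= b -> a <= y <= b ->
  mu.-integrable `[a, b] (EFin \o f) ->
  (forall t, a < t < b -> t \notin E -> {for t, continuous f}) ->
  {within `[a, b], continuous F} ->
  (forall t, a < t < b -> t \notin E -> is_derive t (1 : R) F (f t)) ->
  oriented_integral f x y = F y - F x.
Proof.
wlog xy : x y / x <= y => [W xab yab fi fc Fc Fd|].
  have [xy|yx] := leP x y; first exact: W.
  by rewrite oriented_integralC (W y x) ?opprB // ltW.
move=> xab yab fi fc Fc Fd.
move: xy; rewrite le_eqVlt => /predU1P[<-|xy].
  by rewrite /oriented_integral lexx set_itv1 Rintegral_set1 subrr.
have fi' : mu.-integrable `[x, y] (EFin \o f).
  by apply: integrableS fi => // t /=; rewrite !in_itv /= => ?; apply/andP; split; lra.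
have [|Ic Id] := @antiderivative f E x y xy fi'.
  by move=> t txy tE; apply: fc => //; lra.
set I := oriented_integral f x in Ic Id *.
have Ix : I x = 0 by rewrite /I /oriented_integral lexx set_itv1 Rintegral_set1.
have : I y - F y = I x - F x.
  apply: (@cst_off_finite _ (fun t => I t - F t) E x y (ltW xy)).
    move=> t; apply: continuousB; first exact: Ic.
    have Fc' : {within `[x, y], continuous F} by apply: within_itv_sub Fc; lra.
    exact: Fc'.
  move=> t txy tE; rewrite -(subrr (f t)).
  by apply: is_deriveB; [apply: Id|apply: Fd => //; lra].
rewrite Ix; lra.
Qed.

End Antiderivative.

(** * Fixed point iteration *)

Section Picard.
Context {R : realType}.
Notation mu := (@lebesgue_measure R).
Implicit Types (f u v w phi : R -> R) (E : seq R) (b M : R).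

Lemma within_itv_interior f a b t : {within `[a, b], continuous f} -> a < t < b ->
  {for t, continuous f}.
Proof.
move=> fc /andP[at_ tb]; have ab := lt_trans at_ tb.
have [H _ _] := (continuous_within_itvP f ab).1 fc.
by apply: H; rewrite in_itv /= at_ tb.
Qed.

Lemma within_itv_unif_lim w a b :
  (forall e, 0 < e -> exists2 v, {within `[a, b], continuous v} &
     forall t, a <= t <= b -> `|w t - v t| <= e) ->
  {within `[a, b], continuous w}.
Proof.
move=> H; apply/within_itvP => x xab e e0.
have e3 : 0 < e / 4 by lra.
have [v vc vw] := H _ e3.
have [d d0 Hd] := (within_itvP v a b).1 vc x xab _ e3.
exists d => // y yab xy.
have -> : w x - w y = (w x - v x) + (v x - v y) - (w y - v y) by ring.
have := vw x xab; have := vw y yab; have := Hd y yab xy.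
move: (w x - v x) (v x - v y) (w y - v y) => A B C hB hC hA.
have := ler_normB (A + B) C; have := ler_normD A B; lra.
Qed.

(** The sequences [u n -+ C * 2 / 2 ^+ n] are monotone and enclose the limit. *)
Lemma halving_limit (u : nat -> R) (C : R) :
  (forall n, `|u n.+1 - u n| <= C / 2 ^+ n) ->
  exists l, forall n, `|l - u n| <= C * 2 / 2 ^+ n.
Proof.
move=> H.
have p2 n : 0 < (2 ^+ n : R) by apply: exprn_gt0.
have V n : C * 2 / 2 ^+ n.+1 = C / 2 ^+ n.
  rewrite exprS; field.
  by rewrite gt_eqF.
have V2 n : C * 2 / 2 ^+ n = C / 2 ^+ n * 2 by ring.
have C0 n : 0 <= C / 2 ^+ n by apply: le_trans (normr_ge0 _) (H n).
pose x n := u n - C * 2 / 2 ^+ n; pose y n := u n + C * 2 / 2 ^+ n.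
have xS n : x n <= x n.+1.
  by rewrite /x V V2; have := H n; rewrite ler_norml; lra.
have yS n : y n.+1 <= y n.
  by rewrite /y V V2; have := H n; rewrite ler_norml; lra.
have xm : {homo x : n m / (n <= m)%N >-> n <= m} by apply: homo_leq => //; exact: le_trans.
have ym n m : (n <= m)%N -> y m <= y n.
  elim: m => [|m IH]; first by rewrite leqn0 => /eqP ->.
  rewrite leq_eqVlt => /predU1P[->//|]; rewrite ltnS => /IH; exact: le_trans.
have xy n m : x n <= y m.
  have [nm|mn] := leqP n m.
    apply: le_trans (xm _ _ nm) _; rewrite /x /y V2; have := C0 m; lra.
  apply: le_trans (ym _ _ (ltnW mn)); rewrite /x /y V2; have := C0 n; lra.
exists (sup (range x)) => n.
have hs : has_sup (range x).
  by split; [exists (x 0%N); exists 0%N|exists (y 0%N) => _ [m _ <-]].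
have h1 : x n <= sup (range x) by apply: ub_le_sup; [exact: hs.2|exists n].
have h2 : sup (range x) <= y n by apply: ge_sup; [exact: hs.1|move=> _ [m _ <-]].
by rewrite ler_norml; move: h1 h2; rewrite /x /y; lra.
Qed.

Variables (b M K L : R) (E : seq R) (a phi g : R -> R).
Hypothesis b0 : 0 < b.
Hypothesis L0 : 0 < L.
Hypothesis aM : forall t, 0 < t < b -> `|a t| <= M.
Hypothesis ac : forall t, 0 < t < b -> t \notin E -> {for t, continuous a}.
Hypothesis phi0 : forall t, 0 < t < b -> 0 <= phi t.
Hypothesis phic : forall t, 0 < t < b -> t \notin E -> {for t, continuous phi}.
Hypothesis phii : mu.-integrable `[0, b] (EFin \o phi).
Hypothesis gK : forall x, `|g x| <= K.
Hypothesis gL : forall x y, `|g x - g y| <= L * `|x - y|.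

Lemma lipschitz_continuous_at x : {for x, continuous g}.
Proof.
apply/cvgrPdist_lt => e e0; apply/nbhs_ballP; exists (e / L) => /=.
  by rewrite divr_gt0.
move=> y; rewrite /ball /= => xy; apply: le_lt_trans (gL _ _) _.
by rewrite mulrC -ltr_pdivlMr.
Qed.

Let rhs u t := a t + phi t * g (u t).
Let T u := oriented_integral (rhs u) 0.
Let Phi := oriented_integral phi 0.

Lemma picard_rhs_continuous u t : {within `[0, b], continuous u} -> 0 < t < b -> t \notin E ->
  {for t, continuous (rhs u)}.
Proof.
move=> uc tb tE; apply: continuousD; first exact: ac.
apply: continuousM; first exact: phic.
apply: continuous_comp; first exact: within_itv_interior uc tb.
exact: lipschitz_continuous_at.
Qed.

Lemma picard_rhs_integrable u : {within `[0, b], continuous u} ->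
  mu.-integrable `[0, b] (EFin \o rhs u).
Proof.
move=> uc.
have -> : EFin \o rhs u = (EFin \o a) \+ (EFin \o (fun t => phi t * g (u t))) by [].
apply: integrableD => //.
  exact: (@integrable_bounded_off_finite _ _ E _ _ M).
apply: (@integrable_dominated_off_finite _ _ phi E _ _ K) => // t tb.
  move=> tE; apply: continuousM; first exact: phic.
  apply: continuous_comp; first exact: within_itv_interior uc tb.
  exact: lipschitz_continuous_at.
by rewrite normrM mulrC (ger0_norm (phi0 tb)) ler_wpM2r // phi0.
Qed.

Lemma picard_opP u : {within `[0, b], continuous u} ->
  [/\ {within `[0, b], continuous (T u)}, T u 0 = 0 &
   forall t, 0 < t < b -> t \notin E -> is_derive t (1 : R) (T u) (a t + phi t * g (u t))].
Proof.
move=> uc; have [|Tc Td] := antiderivative (E := E) b0 (picard_rhs_integrable uc).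
  by move=> t tb tE; exact: picard_rhs_continuous.
split => //.
by rewrite /T /oriented_integral lexx set_itv1 Rintegral_set1.
Qed.

(** In the norm weighted by [expR (2 * L * Phi)] one step halves distances on
    the whole interval: the logarithmic derivative [2 * L * phi] of the weight
    is twice the Lipschitz constant of the right-hand side. *)
Lemma picard_contract u v k : {within `[0, b], continuous u} -> {within `[0, b], continuous v} ->
  (forall t, 0 <= t <= b -> `|u t - v t| <= k * expR (2 * L * Phi t)) ->
  forall t, 0 <= t <= b -> `|T u t - T v t| <= k / 2 * expR (2 * L * Phi t).
Proof.
move=> uc vc H.
have k0 : 0 <= k.
  have := H 0; rewrite lexx ltW // => /(_ isT); have := normr_ge0 (u 0 - v 0).
  by have := expR_gt0 (2 * L * Phi 0); nra.
have [Tuc Tu0 Tud] := picard_opP uc; have [Tvc Tv0 Tvd] := picard_opP vc.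
have [Pc Pd] := antiderivative (E := E) b0 phii phic.
have P0 : Phi 0 = 0 by rewrite /Phi /oriented_integral lexx set_itv1 Rintegral_set1.
pose W := fun t => k / 2 * expR (2 * L * Phi t).
have Wc : {within `[0, b], continuous W}.
  apply: within_M; first exact: within_cst.
  apply: within_comp; last by move=> *; exact: continuous_expR.
  by apply: within_M; [exact: within_cst|exact: Pc].
have Wd t : 0 < t < b -> t \notin E ->
    is_derive t (1 : R) W (L * k * expR (2 * L * Phi t) * phi t).
  move=> tb tE; have := Pd t tb tE => Pdt.
  have h2 : is_derive t (1 : R) (fun t => expR (2 * L * Phi t))
      (expR (2 * L * Phi t) * (2 * L * phi t)).
    have h1 : is_derive t (1 : R) (fun t => 2 * L * Phi t) (2 * L * phi t).
      by have := is_deriveZ (2 * L) Pdt.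
    have := @is_derive1_comp _ expR (fun t => 2 * L * Phi t) t _ _ _ h1.
    by apply; exact: is_derive_expR.
  have := is_deriveZ (k / 2) h2; rewrite /GRing.scale /=.
  by move=> h; apply: is_derive_eq h _; field.
have key x y : {within `[0, b], continuous x} -> {within `[0, b], continuous y} ->
  (forall t, 0 <= t <= b -> `|x t - y t| <= k * expR (2 * L * Phi t)) ->
  forall t, 0 <= t <= b -> T x t - T y t <= W t.
  move=> xc yc Hxy t /andP[t0 tb].
  have [Txc Tx0 Txd] := picard_opP xc; have [Tyc Ty0 Tyd] := picard_opP yc.
  have : T x t - T y t - W t <= T x 0 - T y 0 - W 0.
    apply: (@le_off_finite _ (fun t => T x t - T y t - W t) E _ _ t0).
      apply: (@within_itv_sub _ _ 0 b) => //.
      by apply: within_B => //; exact: within_B.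
    move=> s /andP[s0 st] sE; have sb : 0 < s < b by rewrite s0 (lt_le_trans st).
    exists (a s + phi s * g (x s) - (a s + phi s * g (y s)) - L * k * expR (2 * L * Phi s) * phi s).
      have := Txd s sb sE; have := Tyd s sb sE; have := Wd s sb sE => ? ? ?.
      exact: is_deriveB.
    have h1 := gL (x s) (y s).
    have h2 : `|x s - y s| <= k * expR (2 * L * Phi s) by apply: Hxy; case/andP: sb => *; rewrite !ltW.
    have h3 := phi0 sb.
    have h4 : g (x s) - g (y s) <= L * (k * expR (2 * L * Phi s)).
      apply: le_trans (ler_norm _) _; apply: le_trans h1 _.
      by rewrite ler_pM2l.
    nra.
  rewrite Tx0 Ty0 /W P0 mulr0 expR0; lra.
move=> t tb; rewrite ler_norml; apply/andP; split.
  rewrite lerNl opprB; apply: (key v u) => // s sb.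
  by rewrite distrC; exact: H.
exact: (key u v).
Qed.

Lemma picard : exists w, [/\ {within `[0, b], continuous w}, w 0 = 0 &
   forall t, 0 < t < b -> t \notin E -> is_derive t (1 : R) w (a t + phi t * g (w t))].
Proof.
pose u n := iter n T (fun=> 0).
have uc n : {within `[0, b], continuous (u n)}.
  elim: n => [|n IH]; first by exact: within_cst.
  by have [] := picard_opP IH.
have [Pc Pd] := antiderivative (E := E) b0 phii phic.
have P0 : Phi 0 = 0 by rewrite /Phi /oriented_integral lexx set_itv1 Rintegral_set1.
have Pge0 t : 0 <= t <= b -> 0 <= Phi t.
  move=> /andP[t0 tb]; rewrite -oppr_le0 -(oppr0) -P0.
  apply: (@le_off_finite _ (fun t => - Phi t) E _ _ t0).
    by apply: (@within_itv_sub _ _ 0 b) => //; exact: within_N.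
  move=> s /andP[s0 st] sE; have sb : 0 < s < b by rewrite s0 (lt_le_trans st).
  exists (- phi s); last by rewrite oppr_le0 phi0.
  by have := Pd s sb sE => ?; exact: is_deriveN.
(* The weight lies between [1] and some [W], so that the weighted and the
   uniform norm are equivalent. *)
have e1 t : 0 <= t <= b -> 1 <= expR (2 * L * Phi t).
  by move=> tb; rewrite -expR0 ler_expR mulr_ge0 // ?Pge0 // mulr_ge0 // ltW.
have bnd f : {within `[0, b], continuous f} ->
    exists2 k, 0 <= k & forall t, 0 <= t <= b -> f t <= k.
  move=> fc; have [c _ H] := EVT_max (ltW b0) fc.
  exists `|f c| => // t tb; apply: le_trans (ler_norm _).
  by apply: H; rewrite in_itv.
have [k0 k00 Hk0] : exists2 k, 0 <= k & forall t, 0 <= t <= b -> `|u 1%N t| <= k.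
  apply: bnd; apply: (within_comp (g := Num.norm) (uc 1%N)) => x _; exact: norm_continuous.
have [W W0 HW] : exists2 k, 0 <= k & forall t, 0 <= t <= b -> expR (2 * L * Phi t) <= k.
  apply: bnd; apply: within_comp; last by move=> *; exact: continuous_expR.
  by apply: within_M; [exact: within_cst|exact: Pc].
have Hn n t : 0 <= t <= b -> `|u n.+1 t - u n t| <= k0 / 2 ^+ n * expR (2 * L * Phi t).
  elim: n t => [|n IH] t tb.
    rewrite expr0 divr1 /= subr0; apply: le_trans (Hk0 _ tb) _.
    by rewrite ler_peMr // e1.
  have := picard_contract (uc _) (uc _) IH tb.
  by rewrite exprSr invfM mulrA.
pose C := k0 * W.
have Hu t : 0 <= t <= b -> exists l, forall n, `|l - u n t| <= C * 2 / 2 ^+ n.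
  move=> tb; apply: halving_limit => n; apply: le_trans (Hn n t tb) _.
  rewrite /C mulrAC; apply: ler_wpM2r; first by rewrite invr_ge0 exprn_ge0.
  by apply: ler_wpM2l => //; exact: HW.
have /choice[w Hw] : forall t, exists l, 0 <= t <= b -> forall n, `|l - u n t| <= C * 2 / 2 ^+ n.
  move=> t; have [tb|tb] := boolP (0 <= t <= b); last by exists 0.
  by have [l Hl] := Hu t tb; exists l.
have C0 : 0 <= C by rewrite mulr_ge0.
have small e : 0 < e -> exists n, C * 2 / 2 ^+ n <= e.
  move=> e0; have := @cvg_geometric R (C * 2) 2^-1.
  rewrite ger0_norm ?invr_ge0 // => /(_ ltac:(lra)) /cvgrPdist_le/(_ e e0) [N _ HN].
  exists N; have := HN N (leqnn N); rewrite sub0r normrN /geometric /= exprVn.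
  by apply: le_trans (ler_norm _).
have wc : {within `[0, b], continuous w}.
  apply: within_itv_unif_lim => e /small[n Hne]; exists (u n) => // t tb.
  exact: le_trans (Hw t tb n) Hne.
have [Tc T0 Td] := picard_opP wc.
have Tw t : 0 <= t <= b -> T w t = w t.
  move=> tb; apply/eqP; rewrite -subr_eq0 -normr_le0; apply/ler_addgt0Pr => e e0.
  have [n Hne] := small (e / (1 + W)) ltac:(rewrite divr_gt0 //; lra).
  have h1 : `|T w t - u n.+1 t| <= (C * 2 / 2 ^+ n) / 2 * expR (2 * L * Phi t).
    apply: (picard_contract wc (uc n)) => // s sb; apply: le_trans (Hw s sb n) _.
    rewrite ler_peMr // ?e1 // divr_ge0 // ?exprn_ge0 //; lra.
  have h2 := Hw t tb n.+1.
  have h3 : C * 2 / 2 ^+ n.+1 = C * 2 / 2 ^+ n / 2 by rewrite exprSr invfM mulrA.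
  have h4 := HW t tb.
  rewrite ler_pdivlMr in Hne; last lra.
  have h5 : 0 <= C * 2 / 2 ^+ n by rewrite divr_ge0 // ?exprn_ge0 //; lra.
  have -> : T w t - w t = (T w t - u n.+1 t) - (w t - u n.+1 t) by ring.
  rewrite add0r; apply: le_trans (ler_normB _ _) _.
  rewrite h3 in h2.
  move: h1 h2 h4 h5 Hne; move: (C * 2 / 2 ^+ n) (expR _) => X Y; nra.
exists (T w); split => // t tb tE; have -> : T w t = w t by apply: Tw; case/andP: tb => *; rewrite !ltW.
exact: Td.
Qed.

End Picard.

(** * The singular half problem: comparison *)

Section NegPow.
Context {R : realType}.
Variable alpha : R.
Hypothesis alpha0 : 0 < alpha.
Implicit Types x y e : R.

Lemma powN_anti x y : 0 < x -> x <= y -> y `^ (- alpha) <= x `^ (- alpha).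
Proof.
move=> x0 xy; have y0 := lt_le_trans x0 xy.
rewrite !powRN lef_pV2 ?posrE ?powR_gt0 //.
by rewrite ge0_ler_powR // ?nnegrE // ltW.
Qed.

Lemma powR_continuous_at r x : 0 < x -> {for x, continuous (fun y => y `^ r)}.
Proof.
move=> x0; apply: differentiable_continuous; apply/derivable1_diffP.
exact: (@ex_derive _ _ _ _ _ _ _ (is_derive1_powR r x0)).
Qed.

(** Truncating at height [e] makes the singular term bounded and Lipschitz. *)
Definition trunc_powN e x := Num.max x e `^ (- alpha).

Lemma trunc_powN_ge0 e x : 0 <= trunc_powN e x.
Proof. exact: powR_ge0. Qed.

Lemma trunc_powN_le e x : 0 < e -> trunc_powN e x <= e `^ (- alpha).
Proof. by move=> e0; apply: powN_anti => //; rewrite le_max lexx orbT. Qed.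

Lemma trunc_powN_anti e x y : 0 < e -> x <= y -> trunc_powN e y <= trunc_powN e x.
Proof.
move=> e0 xy; apply: powN_anti; first by rewrite lt_max e0 orbT.
by rewrite ge_max !le_max xy lexx /= orbT.
Qed.

Lemma trunc_powN_antie e e' x : 0 < e -> e <= e' -> trunc_powN e' x <= trunc_powN e x.
Proof.
move=> e0 ee; apply: powN_anti; first by rewrite lt_max e0 orbT.
by rewrite ge_max !le_max ee lexx /= orbT.
Qed.

Lemma trunc_powNE e x : e <= x -> trunc_powN e x = x `^ (- alpha).
Proof. by move=> ex; rewrite /trunc_powN max_l. Qed.

Lemma trunc_powN_lip e x y : 0 < e ->
  `|trunc_powN e x - trunc_powN e y| <= alpha * e `^ (- alpha - 1) * `|x - y|.
Proof.
move=> e0; wlog xy : x y / x <= y => [W|].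
  have [xy|yx] := leP x y; first exact: W.
  by rewrite distrC (distrC x); apply: W; exact: ltW.
rewrite ger0_norm ?subr_ge0 ?trunc_powN_anti // distrC ger0_norm ?subr_ge0 //.
pose L := alpha * e `^ (- alpha - 1).
have L0 : 0 <= L by rewrite mulr_ge0 // ?powR_ge0 // ltW.
rewrite -/L.
pose X := Num.max x e; pose Y := Num.max y e.
have XY : X <= Y by rewrite /X /Y ge_max !le_max xy lexx /= orbT.
have eX : e <= X by rewrite le_max lexx orbT.
have h1 : - (Y `^ (- alpha)) - L * Y <= - (X `^ (- alpha)) - L * X.
  apply: (@le_off_finite _ (fun z => - (z `^ (- alpha)) - L * z) [::] _ _ XY).
    apply: within_B; last by apply: within_M; [exact: within_cst|exact: within_id].
    apply: within_N; apply: (within_comp (f := id) (g := fun z => z `^ (- alpha))).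
      exact: within_id.
    move=> z /andP[Xz _]; apply: powR_continuous_at; exact: lt_le_trans (lt_le_trans e0 eX) Xz.
  move=> z /andP[Xz _] _; have z0 : 0 < z by apply: lt_trans Xz; exact: lt_le_trans e0 eX.
  exists (- (- alpha * z `^ (- alpha - 1)) - L * 1).
    have := is_derive1_powR (- alpha) z0 => ?.
    exact: is_deriveB.
  have : z `^ (- alpha - 1) <= e `^ (- alpha - 1).
    have -> : - alpha - 1 = - (alpha + 1) by ring.
    rewrite !powRN lef_pV2 ?posrE ?powR_gt0 //.
    apply: ge0_ler_powR; rewrite ?nnegrE ?(ltW e0) ?(ltW z0) //; first by rewrite addr_ge0 // ltW.
    exact: le_trans eX (ltW Xz).
  rewrite /L => h; have := ler_wpM2l (ltW alpha0) h; lra.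
have h2 : Y - X <= y - x by rewrite /X /Y /Num.max; do 2 case: ifP; lra.
have := ler_wpM2l L0 h2; rewrite /trunc_powN -/X -/Y; lra.
Qed.

End NegPow.

Section HalfProblem.
Context {R : realType}.
Notation mu := (@lebesgue_measure R).
Variables (alpha b : R) (E : seq R) (phi : R -> R).
Implicit Types (a v w : R -> R).
Hypothesis alpha0 : 0 < alpha.
Hypothesis b0 : 0 < b.
Hypothesis phic : forall t : R, 0 < t < b -> t \notin E -> {for t, continuous phi}.
Hypothesis phii : mu.-integrable `[0, b] (EFin \o phi).
Hypothesis philb : forall x y : R, 0 < x -> x <= y -> y < b ->
  exists2 k : R, 0 < k & forall t, x <= t <= y -> k <= phi t.

(** In the application [a] is [c - h], [phi] is [- f] and [b] is the interior
    zero of the reaction. *)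
Definition half_solution a w :=
  [/\ {within `[0, b], continuous w}, w 0 = 0,
      forall t, 0 < t < b -> 0 < w t &
      forall t, 0 < t < b -> t \notin E ->
        is_derive t (1 : R) w (a t + phi t * w t `^ (- alpha))].

Lemma half_phi_gt0 t : 0 < t < b -> 0 < phi t.
Proof.
move=> /andP[t0 tb]; have [k k0 H] := philb t0 (lexx t) tb.
by apply: lt_le_trans k0 (H t _); rewrite lexx.
Qed.

(** The singular term decreases in the unknown, so that [v - w - K t] cannot
    grow where it is positive. *)
Lemma half_comparison a1 a2 K v w : 0 <= K ->
  (forall t, 0 < t < b -> a1 t <= a2 t + K) ->
  half_solution a1 v -> half_solution a2 w ->
  forall t, 0 <= t <= b -> v t <= w t + K * t.
Proof.
move=> K0 aK [vc v0 vp vd] [wc w0 wp wd] t /andP[t0 tb].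
suff : v t - w t - K * t <= 0 by lra.
apply: (@barrier _ (fun x => v x - w x - K * x) E 0 t t0).
- apply: (@within_itv_sub _ _ 0 b) => //; apply: within_B; first exact: within_B.
  by apply: within_M; [exact: within_cst|exact: within_id].
- by rewrite v0 w0; lra.
- move=> x xst xE h; have xb : 0 < x < b by lra.
  exists (a1 x + phi x * v x `^ (- alpha) - (a2 x + phi x * w x `^ (- alpha)) - K * 1).
    have := vd x xb xE; have := wd x xb xE => ? ?.
    by apply: is_deriveB; exact: is_deriveZ.
  have wv : w x <= v x by have : 0 <= K * x by [rewrite mulr_ge0; lra]; lra.
  have := powN_anti alpha0 (wp x xb) wv; have := half_phi_gt0 xb.
  by have := aK x xb; nra.
Qed.

Lemma half_unique a v w : half_solution a v -> half_solution a w ->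
  forall t, 0 <= t <= b -> v t = w t.
Proof.
move=> vs ws t tb; apply/eqP; rewrite eq_le.
by apply/andP; split; rewrite -[X in _ <= X]addr0 -(mul0r t);
  apply: (half_comparison (a1 := a) (a2 := a)) => // x xb; rewrite addr0.
Qed.

End HalfProblem.

(** * The singular half problem: existence *)

Section HalfExistence.
Context {R : realType}.
Notation mu := (@lebesgue_measure R).
Variables (alpha b M : R) (E : seq R) (a phi : R -> R).
Hypothesis alpha0 : 0 < alpha.
Hypothesis b0 : 0 < b.
Hypothesis phic : forall t : R, 0 < t < b -> t \notin E -> {for t, continuous phi}.
Hypothesis phii : mu.-integrable `[0, b] (EFin \o phi).
Hypothesis philb : forall x y : R, 0 < x -> x <= y -> y < b ->
  exists2 k : R, 0 < k & forall t, x <= t <= y -> k <= phi t.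
Hypothesis aM : forall t : R, 0 < t < b -> `|a t| <= M.
Hypothesis ac : forall t : R, 0 < t < b -> t \notin E -> {for t, continuous a}.

Let phi_gt0 t : 0 < t < b -> 0 < phi t.
Proof. exact: half_phi_gt0. Qed.

Let M0 : 0 <= M.
Proof.
by have hb := b0; apply: le_trans (normr_ge0 _) (aM (t := b / 2) _); apply/andP; split; lra.
Qed.

Definition truncated_solution e w :=
  [/\ {within `[0, b], continuous w}, w 0 = 0 &
   forall t, 0 < t < b -> t \notin E ->
     is_derive t (1 : R) w (a t + phi t * trunc_powN alpha e (w t))].

Lemma truncated_exists e : 0 < e -> exists w, truncated_solution e w.
Proof.
move=> e0; apply: (@picard _ b M (e `^ (- alpha)) (alpha * e `^ (- alpha - 1)) E a phi) => //.
- by rewrite mulr_gt0 // powR_gt0.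
- by move=> t /phi_gt0/ltW.
- by move=> x; rewrite ger0_norm ?trunc_powN_ge0 // trunc_powN_le.
- by move=> x y; exact: trunc_powN_lip.
Qed.

Lemma truncated_mono e e' v w : 0 < e' -> e' <= e ->
  truncated_solution e v -> truncated_solution e' w ->
  forall t, 0 <= t <= b -> v t <= w t.
Proof.
move=> e0 ee [vc v0 vd] [wc w0 wd] t /andP[t0 tb].
suff : v t - w t <= 0 by lra.
apply: (@barrier _ (fun x => v x - w x) E 0 t t0); rewrite ?v0 ?w0 ?subrr //.
  by apply: within_B; exact: within_itv_sub (lexx _) tb _.
move=> x xt xE h; have xb : 0 < x < b by lra.
exists (a x + phi x * trunc_powN alpha e (v x) - (a x + phi x * trunc_powN alpha e' (w x))).
  by have := vd x xb xE; have := wd x xb xE => ? ?; exact: is_deriveB.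
have h1 : trunc_powN alpha e (v x) <= trunc_powN alpha e' (w x).
  apply: le_trans (trunc_powN_antie _ _ e0 ee) _ => //.
  by apply: trunc_powN_anti => //; lra.
by have := phi_gt0 xb; nra.
Qed.

(** Any positive height [k] gives an upper barrier: above it the singular
    term is at most [k `^ (- alpha) * phi]. *)
Lemma truncated_upper e w k : 0 < e -> 0 < k -> truncated_solution e w ->
  forall t, 0 <= t <= b ->
    w t <= M * t + k + k `^ (- alpha) * oriented_integral phi 0 t.
Proof.
have hb := b0; have hM := M0.
move=> e0 k0 [wc w0 wd] t /andP[t0 tb].
have [Pc Pd] := antiderivative b0 phii phic.
have P0 : oriented_integral phi 0 0 = 0.
  by rewrite /oriented_integral lexx set_itv1 Rintegral_set1.
suff : w t - (M * t + k + k `^ (- alpha) * oriented_integral phi 0 t) <= 0 by lra.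
apply: (@barrier _ (fun t => w t - (M * t + k + k `^ (- alpha) * oriented_integral phi 0 t)) E 0 t t0).
- apply: (@within_itv_sub _ _ 0 b) => //; apply: within_B => //; apply: within_D.
    apply: within_D; last exact: within_cst.
    by apply: within_M; [exact: within_cst|exact: within_id].
  by apply: within_M; [exact: within_cst|exact: Pc].
- by rewrite w0 P0; lra.
move=> x xt xE h; have xb : 0 < x < b by lra.
exists (a x + phi x * trunc_powN alpha e (w x) - (M * 1 + 0 + k `^ (- alpha) * phi x)).
  have := wd x xb xE; have := Pd x xb xE => ? ?.
  apply: is_deriveB; apply: is_deriveD; exact: is_deriveZ.
have Px : 0 <= oriented_integral phi 0 x.
  suff : - oriented_integral phi 0 x <= - oriented_integral phi 0 0 by rewrite P0; lra.
  apply: (@le_off_finite _ (fun t => - oriented_integral phi 0 t) E); first lra.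
    by apply: within_N; apply: within_itv_sub Pc; lra.
  move=> y yx yE; have yb : 0 < y < b by lra.
  exists (- phi y); last by have := phi_gt0 yb; lra.
  by have := Pd y yb yE => ?; exact: is_deriveN.
have kx : k <= w x.
  have : 0 <= M * x by apply: mulr_ge0 => //; lra.
  have : 0 <= k `^ (- alpha) * oriented_integral phi 0 x by rewrite mulr_ge0 // powR_ge0.
  by lra.
have h1 : trunc_powN alpha e (w x) <= k `^ (- alpha).
  by apply: powN_anti => //; rewrite le_max kx.
have := phi_gt0 xb; have := aM xb; rewrite ler_norml; nra.
Qed.

(** Below a small height [k] the singular term beats [- M], so the truncated
    solutions climb to [k] between [x / 2] and [x] and stay above it. *)
Lemma truncated_lower x y : 0 < x -> x <= y -> y < b ->
  exists2 k, 0 < k & forall e w, 0 < e -> e <= k -> truncated_solution e w ->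
    forall t, x <= t <= y -> k <= w t.
Proof.
have hb := b0; have hM := M0.
move=> x0 xy yb.
have [f f0 Hf] := philb (x := x / 2) (y := y) ltac:(lra) ltac:(lra) yb.
pose D := (f / (2 * M + 1)) `^ alpha^-1.
have D0 : 0 < D by apply: powR_gt0; apply: divr_gt0 => //; lra.
pose k := Num.min D (x / 2).
have k0 : 0 < k by rewrite lt_min D0 /=; lra.
have kx : k <= x / 2 by rewrite ge_min lexx orbT.
have fk : 2 * M + 1 <= f * k `^ (- alpha).
  have : D `^ (- alpha) <= k `^ (- alpha) by apply: powN_anti => //; rewrite ge_min lexx.
  rewrite /D -powRrM mulrN mulVf ?gt_eqF // powR_inv1; last by apply: ltW; apply: divr_gt0 => //; lra.
  by rewrite invf_div ler_pdivrMr // (mulrC f).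
exists k => // e w e0 ek [wc w0 wd].
(* Since [w' >= - M], the solution has not dropped much before [x / 2]. *)
have wx2 : - M * (x / 2) - w (x / 2) <= - M * 0 - w 0.
  apply: (@le_off_finite _ (fun t => - M * t - w t) E); first lra.
    apply: within_B; first by apply: within_M; [exact: within_cst|exact: within_id].
    by apply: within_itv_sub wc; lra.
  move=> t tx tE; have tb : 0 < t < b by lra.
  exists (- M * 1 - (a t + phi t * trunc_powN alpha e (w t))).
    by have := wd t tb tE => ?; apply: is_deriveB; exact: is_deriveZ.
  have := phi_gt0 tb; have := aM tb; rewrite ler_norml.
  by have := trunc_powN_ge0 alpha e (w t); nra.
have low t : x / 2 <= t <= y -> w t <= k -> 2 * M + 1 <= phi t * trunc_powN alpha e (w t).
  move=> txy wk; apply: le_trans fk _.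
  apply: ler_pM => //; [exact: ltW|exact: powR_ge0|exact: Hf|].
  by apply: powN_anti => //; rewrite ?lt_max ?e0 ?orbT // ge_max wk.
(* The line through [(x / 2, - M x / 2)] and [(x, k)] has slope [s]; it is a
   lower barrier up to [x], and the constant [k] is one from there on. *)
pose s := M + 2 * k / x.
have sx : s * (x / 2) = M * x / 2 + k by rewrite /s; field; rewrite gt_eqF.
have s1 : s <= M + 1.
  rewrite /s lerD2l ler_pdivrMr // mul1r; lra.
have s0 : 0 <= s by rewrite /s addr_ge0 // divr_ge0 //; lra.
have wx : k <= w x.
  suff : - M * (x / 2) + s * (x - x / 2) - w x <= 0.
    have -> : x - x / 2 = x / 2 by field.
    by rewrite sx; lra.
  apply: (@barrier _ (fun t => - M * (x / 2) + s * (t - x / 2) - w t) E (x / 2) x); first lra.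
  - apply: within_B; last by apply: within_itv_sub wc; lra.
    apply: within_D; first exact: within_cst.
    apply: within_M; first exact: within_cst.
    by apply: within_B; [exact: within_id|exact: within_cst].
  - rewrite subrr; move: wx2; rewrite w0; lra.
  - move=> t tx tE h; have tb : 0 < t < b by lra.
    exists (0 + s * (1 - 0) - (a t + phi t * trunc_powN alpha e (w t))).
      have := wd t tb tE => ?; apply: is_deriveB; apply: is_deriveD; exact: is_deriveZ.
    have : s * (t - x / 2) <= s * (x / 2) by apply: ler_wpM2l => //; lra.
    rewrite sx => h2.
    have := low t ltac:(lra) ltac:(lra); have := aM tb; rewrite ler_norml; lra.
move=> t /andP[xt ty]; suff : k - w t <= 0 by lra.
apply: (@barrier _ (fun t => k - w t) E x t xt).
- by apply: within_B; [exact: within_cst|apply: within_itv_sub wc; lra].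
- by lra.
- move=> z zt zE h; have zb : 0 < z < b by lra.
  exists (0 - (a z + phi z * trunc_powN alpha e (w z))).
    by have := wd z zb zE => ?; exact: is_deriveB.
  have := low z ltac:(lra) ltac:(lra); have := aM zb; rewrite ler_norml; lra.
Qed.


(** On [[x, y]] the truncations [w_ n] eventually solve the equation itself;
    their differences are then nonincreasing in time, so that convergence at
    [x] alone is convergence on [[x, y]]. *)
Lemma half_solution_local (w_ : nat -> R -> R) (eps : nat -> R) w x y :
  (forall n, 0 < eps n) -> (forall n m, (n <= m)%N -> eps m <= eps n) ->
  (forall k, 0 < k -> exists n, eps n <= k) ->
  (forall n, truncated_solution (eps n) (w_ n)) ->
  (forall t, 0 <= t <= b -> has_sup (range (w_ ^~ t)) /\ w t = sup (range (w_ ^~ t))) ->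
  0 < x -> x < y -> y < b ->
  [/\ forall t, x <= t <= y -> 0 < w t,
    {within `[x, y], continuous w} &
    forall t, x < t < y -> t \notin E ->
      is_derive t (1 : R) w (a t + phi t * w t `^ (- alpha))].
Proof.
move=> eps0 epsm epsl w_P wE x0 xy yb.
have hb := b0; have hM := M0.
have w_m n m t : (n <= m)%N -> 0 <= t <= b -> w_ n t <= w_ m t.
  by move=> nm; apply: truncated_mono (w_P n) (w_P m) t => //; exact: epsm.
have w_w n t : 0 <= t <= b -> w_ n t <= w t.
  by move=> tb; have [hs ->] := wE t tb; apply: ub_le_sup; [exact: hs.2|exists n].
have [k k0 Hk] := truncated_lower x0 (ltW xy) yb.
have [N HN] := epsl k k0.
have epsk n : (N <= n)%N -> eps n <= k by move=> Nn; apply: le_trans (epsm _ _ Nn) HN.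
have w_k n t : (N <= n)%N -> x <= t <= y -> k <= w_ n t.
  by move=> Nn; apply: Hk (w_P n) t; [exact: eps0|exact: epsk].
have wk t : x <= t <= y -> k <= w t.
  by move=> txy; apply: le_trans (w_k N t (leqnn N) txy) _; apply: w_w; lra.
have w_d n t : (N <= n)%N -> x < t < y -> t \notin E ->
    is_derive t (1 : R) (w_ n) (a t + phi t * w_ n t `^ (- alpha)).
  move=> Nn txy tE; have [_ _ H] := w_P n.
  rewrite -(@trunc_powNE _ alpha (eps n)); first by apply: H => //; lra.
  by apply: le_trans (epsk _ Nn) _; apply: w_k => //; lra.
have w_c n : {within `[x, y], continuous (w_ n)}.
  by have [H _ _] := w_P n; apply: within_itv_sub H; lra.
pose eta n := w x - w_ n x.
have eta0 n : 0 <= eta n by rewrite /eta subr_ge0; apply: w_w; lra.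
have etaP n t : (N <= n)%N -> x <= t <= y -> w t - w_ n t <= eta n.
  move=> Nn /andP[xt ty].
  have [hs ->] := wE t ltac:(lra).
  suff : sup (range (w_ ^~ t)) <= w_ n t + eta n by lra.
  apply: ge_sup; first exact: hs.1.
  move=> _ [m _ <-].
  have [mn|nm] := leqP m n.
    by have := w_m m n t mn ltac:(lra); have := eta0 n; lra.
  have : w_ m t - w_ n t <= w_ m x - w_ n x.
    apply: (@le_off_finite _ (fun t => w_ m t - w_ n t) E) => //.
      by apply: within_B; apply: within_itv_sub (w_c _).
    move=> z zt zE; have zxy : x < z < y by lra.
    exists (a z + phi z * w_ m z `^ (- alpha) - (a z + phi z * w_ n z `^ (- alpha))).
      have := w_d n z Nn zxy zE; have := w_d m z (leq_trans Nn (ltnW nm)) zxy zE => ? ?.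
      exact: is_deriveB.
    have h1 : w_ m z `^ (- alpha) <= w_ n z `^ (- alpha).
      apply: powN_anti => //; last by apply: w_m; [exact: ltnW|lra].
      by apply: lt_le_trans k0 (w_k _ _ Nn _); lra.
    have := @phi_gt0 z ltac:(lra); nra.
  have := w_w m x ltac:(lra); rewrite /eta; lra.
have etal e : 0 < e -> exists2 n, (N <= n)%N & eta n <= e.
  move=> e0; have [hs wx] := wE x ltac:(lra).
  have [_ [m _ <-] Hm] := sup_adherent e0 hs; exists (maxn N m); first exact: leq_maxl.
  have := w_m m (maxn N m) x (leq_maxr _ _) ltac:(lra).
  by rewrite /eta wx; lra.
have wc : {within `[x, y], continuous w}.
  apply: within_itv_unif_lim => e /etal[n Nn ne]; exists (w_ n) => // t txy.
  rewrite ger0_norm; first exact: le_trans (etaP n t Nn txy) ne.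
  by rewrite subr_ge0; apply: w_w; lra.
split => //; first by move=> t txy; exact: lt_le_trans k0 (wk _ txy).
pose rhs t := a t + phi t * w t `^ (- alpha).
have rhsc t : x < t < y -> t \notin E -> {for t, continuous (fun t => phi t * w t `^ (- alpha))}.
  move=> txy tE; apply: continuousM; first by apply: phic => //; lra.
  apply: (@continuous_comp _ _ _ w (fun z => z `^ (- alpha))).
    exact: within_itv_interior wc txy.
  by apply: powR_continuous_at; apply: lt_le_trans k0 (wk _ _); lra.
have phii' : mu.-integrable `[x, y] (EFin \o phi).
  by apply: integrableS phii => // t /=; rewrite !in_itv /= => /andP[? ?]; apply/andP; split; lra.
have rhsi : mu.-integrable `[x, y] (EFin \o rhs).
  have -> : EFin \o rhs = (EFin \o a) \+ (EFin \o (fun t => phi t * w t `^ (- alpha))) by [].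
  apply: integrableD => //.
    apply: (@integrable_bounded_off_finite _ _ E _ _ M) => // t txy; last by apply: aM; lra.
    by move=> tE; apply: ac => //; lra.
  apply: (@integrable_dominated_off_finite _ _ phi E _ _ (k `^ (- alpha))) => // t txy.
  have p0 := @phi_gt0 t ltac:(lra).
  rewrite ger0_norm; last by rewrite mulr_ge0 ?powR_ge0 // ltW.
  rewrite mulrC ler_pM2r //; apply: powN_anti => //; apply: wk; lra.
have [|Ic Id] := antiderivative (E := E) xy rhsi.
  move=> t txy tE; apply: continuousD; last exact: rhsc.
  by apply: ac => //; lra.
set I := oriented_integral rhs x in Ic Id.
have Ix : I x = 0 by rewrite /I /oriented_integral lexx set_itv1 Rintegral_set1.
have [Pc Pd] := antiderivative xy phii' (fun t txy tE => phic (t := t) ltac:(lra) tE).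
set P := oriented_integral phi x in Pc Pd.
have Px : P x = 0 by rewrite /P /oriented_integral lexx set_itv1 Rintegral_set1.
pose L := alpha * k `^ (- alpha - 1).
have L0 : 0 < L by rewrite mulr_gt0 // powR_gt0.
(* The primitive [I] of the limit equation is compared with [w_ n]: the
   derivatives differ by [phi] times a difference of negative powers. *)
have D1 n t : (N <= n)%N -> x <= t <= y ->
    0 <= w_ n t - w_ n x - I t <= L * eta n * P t.
  move=> Nn /andP[xt ty].
  have db z : x < z < y -> 0 <= w_ n z `^ (- alpha) - w z `^ (- alpha) <= L * eta n.
    move=> zxy; have zxy' : x <= z <= y by lra.
    have ww := w_w n z ltac:(lra).
    have kn := w_k n z Nn zxy'.
    rewrite subr_ge0 powN_anti //=; last exact: lt_le_trans k0 kn.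
    rewrite -(trunc_powNE alpha kn) -(trunc_powNE alpha (wk z zxy')).
    apply: le_trans (ler_norm _) _; apply: le_trans (trunc_powN_lip alpha0 _ _ k0) _.
    rewrite -/L ler_pM2l // distrC ger0_norm ?subr_ge0 //; exact: etaP.
  have h1 : I t - w_ n t <= I x - w_ n x.
    apply: (@le_off_finite _ (fun t => I t - w_ n t) E) => //.
      by apply: within_B; [apply: within_itv_sub Ic|apply: within_itv_sub (w_c n)].
    move=> z zt zE; have zxy : x < z < y by lra.
    exists (rhs z - (a z + phi z * w_ n z `^ (- alpha))).
      by have := Id z zxy zE; have := w_d n z Nn zxy zE => ? ?; exact: is_deriveB.
    have := db z zxy; have := @phi_gt0 z ltac:(lra); rewrite /rhs; nra.
  have h2 : w_ n t - I t - L * eta n * P t <= w_ n x - I x - L * eta n * P x.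
    apply: (@le_off_finite _ (fun t => w_ n t - I t - L * eta n * P t) E) => //.
      apply: within_B; first by apply: within_B; [apply: within_itv_sub (w_c n)|apply: within_itv_sub Ic].
      apply: within_M; first exact: within_cst.
      by apply: within_itv_sub Pc.
    move=> z zt zE; have zxy : x < z < y by lra.
    exists (a z + phi z * w_ n z `^ (- alpha) - rhs z - L * eta n * phi z).
      have := Id z zxy zE; have := w_d n z Nn zxy zE; have := Pd z zxy zE => ? ? ?.
      by apply: is_deriveB; exact: is_deriveZ.
    have := db z zxy; have := @phi_gt0 z ltac:(lra); rewrite /rhs; nra.
  by rewrite Ix Px in h1 h2; lra.
have wI t : x <= t <= y -> w t = w x + I t.
  move=> txy; apply/eqP; rewrite -subr_eq0 -normr_le0; apply/ler_addgt0Pr => e e0.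
  have q0 : 0 < 2 + L * `|P t| by have := mulr_ge0 (ltW L0) (normr_ge0 (P t)); lra.
  have [n Nn ne] := etal (e / (2 + L * `|P t|)) ltac:(exact: divr_gt0).
  rewrite ler_pdivlMr // in ne.
  have := D1 n t Nn txy; have := etaP n t Nn txy; have := w_w n t ltac:(lra).
  have hP : L * eta n * P t <= L * eta n * `|P t|.
    by rewrite ler_wpM2l ?ler_norm // mulr_ge0 // ltW.
  have -> : w t - (w x + I t) = (w_ n t - w_ n x - I t) + (w t - w_ n t) - eta n by rewrite /eta; ring.
  move: hP; rewrite add0r ler_norml.
  by have := eta0 n; move=> ? ? ? ? ?; apply/andP; split; nra.
move=> t /[dup] txy /andP[xt ty] tE.
have nF : {near t, (fun z => w x + I z) =1 w}.
  have : \forall z \near t, z \in `]x, y[ by apply: near_in_itvoo; rewrite in_itv.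
  by apply: filterS => z; rewrite in_itv /= => zxy; rewrite [RHS]wI //; lra.
apply: (near_eq_is_derive nF); have := Id t txy tE => ?.
rewrite -[X in is_derive _ _ _ X]add0r; exact: is_deriveD.
Qed.

(** The truncated solutions increase as the truncation height decreases, and
    their supremum solves the equation. *)
Theorem half_solution_exists : exists w, half_solution alpha b E phi a w.
Proof.
have hb := b0; have hM := M0.
pose eps n : R := n.+1%:R^-1.
have eps0 n : 0 < eps n by rewrite invr_gt0.
have epsm n m : (n <= m)%N -> eps m <= eps n.
  by move=> nm; rewrite lef_pV2 ?posrE // ler_nat.
have epsl k : 0 < k -> exists n, eps n <= k.
  move=> k0; have [N _ HN] := near_infty_natSinv_lt (PosNum k0).
  by exists N; apply/ltW/HN/leqnn.
have /choice[w_ w_P] n : exists v, truncated_solution (eps n) v by exact: truncated_exists.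
pose w t := sup (range (w_ ^~ t)).
pose P := oriented_integral phi 0.
have ub t k n : 0 < k -> 0 <= t <= b -> w_ n t <= M * t + k + k `^ (- alpha) * P t.
  by move=> k0; apply: truncated_upper (w_P n) t.
have wE t : 0 <= t <= b -> has_sup (range (w_ ^~ t)) /\ w t = sup (range (w_ ^~ t)).
  move=> tb; split=> //; split; first by exists (w_ 0%N t); exists 0%N.
  by exists (M * t + 1 + 1 `^ (- alpha) * P t) => _ [n _ <-]; exact: ub.
have loc t : 0 < t < b -> exists x y, [/\ 0 < x, x < t, t < y, y < b &
   [/\ forall t, x <= t <= y -> 0 < w t,
    {within `[x, y], continuous w} &
    forall t, x < t < y -> t \notin E ->
      is_derive t (1 : R) w (a t + phi t * w t `^ (- alpha))]].
  move=> tb; exists (t / 2), ((t + b) / 2).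
  have h1 : 0 < t / 2 by lra.
  have h2 : t / 2 < t by lra.
  have h3 : t < (t + b) / 2 by lra.
  have h4 : (t + b) / 2 < b by lra.
  split=> //; apply: (half_solution_local eps0 epsm epsl w_P wE) => //; exact: lt_trans h3.
have w0 : w 0 = 0.
  have -> : w 0 = sup [set (0 : R)]; last exact: sup1.
  congr sup; apply/seteqP; split=> [_ [n _ <-]|_ ->].
    by have [_ -> _] := w_P n.
  by exists 0%N => //; have [_ -> _] := w_P 0%N.
have wpos t : 0 < t < b -> 0 < w t.
  by move=> /loc[x [y [x0 xt ty yb [H _ _]]]]; apply: H; lra.
have wc t : 0 < t < b -> {for t, continuous w}.
  by move=> /loc[x [y [x0 xt ty yb [_ H _]]]]; apply: within_itv_interior H _; lra.
have wd t : 0 < t < b -> t \notin E -> is_derive t (1 : R) w (a t + phi t * w t `^ (- alpha)).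
  by move=> /loc[x [y [x0 xt ty yb [_ _ H]]]]; apply: H; lra.
have [Pc _] := antiderivative b0 phii phic.
have P0 : P 0 = 0 by rewrite /P /oriented_integral lexx set_itv1 Rintegral_set1.
have Qc k : {within `[0, b], continuous (fun t => M * t + k `^ (- alpha) * P t)}.
  by apply: within_D; apply: within_M; try exact: within_cst; [exact: within_id|exact: Pc].
(* Small heights [k] in this bound show that [w] tends to [0] at [0]. *)
have wub k t : 0 < k -> 0 <= t <= b -> w t <= M * t + k + k `^ (- alpha) * P t.
  move=> k0 tb; have [hs ->] := wE t tb.
  by apply: ge_sup; [exact: hs.1|move=> _ [n _ <-]; exact: ub].
have wl0 : w t @[t --> 0^'+] --> (0 : R).
  apply/at_rightP => e e0.
  pose k := e / 3; have k0 : 0 < k by rewrite /k; lra.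
  have [d d0 Hd] := (within_itvP _ 0 b).1 (Qc k) 0 ltac:(lra) k k0.
  exists (Num.min d b); first by rewrite lt_min d0.
  move=> t; rewrite add0r lt_min => /and3P[t0 td tb].
  have := Hd t ltac:(lra); rewrite sub0r normrN ger0_norm ?(ltW t0) // => /(_ td).
  rewrite mulr0 P0 mulr0 !addr0 sub0r normrN ltr_norml => hQ.
  have wt0 : 0 < w t by apply: wpos; lra.
  rewrite subr0 ger0_norm; last exact: ltW.
  by have := wub k t k0 ltac:(lra); move: hQ; rewrite /k; lra.
(* [w + M t] is nondecreasing and bounded, hence converges at [b]. *)
have [l wl] : exists l : R, w t @[t --> b^'-] --> l.
  have [c _ Hc] := EVT_max (ltW b0) (Qc 1).
  pose v t := w t + M * t.
  have vm : {in `]0, b[ &, {homo v : x y / x <= y}}.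
    move=> x y; rewrite !in_itv /= => xb yb xy.
    suff : - w y - M * y <= - w x - M * x by rewrite /v; lra.
    apply: (@le_off_finite _ (fun t => - w t - M * t) E) => //.
      apply: within_B; last by apply: within_M; [exact: within_cst|exact: within_id].
      by apply: within_N; apply: within_of_for => t txy; apply: wc; lra.
    move=> t txy tE; have tb : 0 < t < b by lra.
    exists (- (a t + phi t * w t `^ (- alpha)) - M * 1).
      by have := wd t tb tE => ?; apply: is_deriveB; exact: is_deriveZ.
    have := aM tb; rewrite ler_norml.
    by have := phi_gt0 tb; have := powR_ge0 (w t) (- alpha); nra.
  have [l vl] : exists l : R, v t @[t --> b^'-] --> l.
    apply/cvg_ex; apply: nondecreasing_at_left_is_cvgr.
      near=> z; move=> x y; rewrite !in_itv /= => xb yb; apply: vm; rewrite in_itv /=.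
        by apply/andP; split; [apply: lt_trans (_ : 0 < z) _; [near: z; exact: nbhs_left_gt|]|]; lra.
      by apply/andP; split; [apply: lt_trans (_ : 0 < z) _; [near: z; exact: nbhs_left_gt|]|]; lra.
    near=> z; exists (M * c + 1 `^ (- alpha) * P c + 1 + M * b) => _ [t /= + <-].
    rewrite in_itv /= => tz; have t0 : 0 < t.
      by apply: lt_trans (_ : 0 < z) _; [near: z; exact: nbhs_left_gt|lra].
    have tb : 0 <= t <= b by lra.
    have := wub 1 t ltr01 tb; have := Hc t; rewrite in_itv /= => /(_ tb).
    have : M * t <= M * b by apply: ler_wpM2l => //; lra.
    by rewrite /v; lra.
  exists (l - M * b); apply: (@cvg_trans _ ((v t - M * t) @[t --> b^'-])).
    by apply: near_eq_cvg; near=> t; rewrite /v addrK.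
  apply: cvgB => //; apply: cvgM; first exact: cvg_cst.
  by apply: cvg_within_filter; exact: cvg_id.
exists (close_ends w 0 b 0 l); split.
- exact: close_ends_within.
- by rewrite /close_ends lexx.
- by move=> t tb; rewrite close_endsE //; exact: wpos.
- by move=> t tb tE; rewrite close_endsE //; apply: close_ends_is_derive => //; exact: wd.
Unshelve. all: by end_near. Qed.

End HalfExistence.

(** * The singular half problem: dependence on the speed *)

Section HalfFamily.
Context {R : realType}.
Notation mu := (@lebesgue_measure R).
Variables (alpha b H : R) (E : seq R) (phi h : R -> R).
Hypothesis alpha0 : 0 < alpha.
Hypothesis b0 : 0 < b.
Hypothesis phic : forall t : R, 0 < t < b -> t \notin E -> {for t, continuous phi}.
Hypothesis phii : mu.-integrable `[0, b] (EFin \o phi).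
Hypothesis philb : forall x y : R, 0 < x -> x <= y -> y < b ->
  exists2 k : R, 0 < k & forall t, x <= t <= y -> k <= phi t.
Hypothesis hH : forall t : R, 0 < t < b -> `|h t| <= H.
Hypothesis hc : forall t : R, 0 < t < b -> t \notin E -> {for t, continuous h}.

Let sol c w := half_solution alpha b E phi (fun t => c - h t) w.

Lemma half_family_exists c : exists w, sol c w.
Proof.
apply: (@half_solution_exists _ alpha b (`|c| + H)) => //.
  by move=> t tb; apply: le_trans (ler_normB _ _) _; rewrite lerD2l hH.
by move=> t tb tE; apply: continuousB; [exact: cst_continuous|exact: hc].
Qed.

Lemma half_end_ge0 a w : half_solution alpha b E phi a w -> 0 <= w b.
Proof.
move=> [wc _ wp _]; have hb := b0; rewrite leNgt; apply/negP => wb.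
have [d d0 Hd] := (within_itvP w 0 b).1 wc b ltac:(lra) (- w b) ltac:(lra).
pose t := Num.max (b / 2) (b - d / 2).
have [t0 tb td] : [/\ 0 < t, t < b & b - t < d].
  by rewrite /t /Num.max; case: ifP => ?; split; lra.
have := Hd t ltac:(lra); rewrite ger0_norm ?subr_ge0 ?(ltW tb) // => /(_ td).
by rewrite ltr_norml; have := wp t ltac:(lra); lra.
Qed.

Lemma half_value : exists W : R -> R,
  [/\ forall c w, sol c w -> w b = W c, forall c, 0 <= W c,
      forall c c', c <= c' -> W c <= W c' <= W c + (c' - c) * b &
      forall c, (c - H) * b <= W c].
Proof.
have hb := b0.
have /choice[w wP] := half_family_exists.
exists (fun c => w c b); split.
- move=> c v vs; apply: (half_unique alpha0 philb vs (wP c)); lra.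
- by move=> c; exact: half_end_ge0 (wP c).
- move=> c c' cc; apply/andP; split.
    rewrite -[X in _ <= X]addr0 -(mul0r b).
    apply: (half_comparison alpha0 philb _ _ (wP c) (wP c')) => //; last lra.
    by move=> t _; lra.
  apply: (half_comparison alpha0 philb _ _ (wP c') (wP c)); [lra| |lra].
  by move=> t _; lra.
- move=> c; have [wc w0 wp wd] := wP c.
  suff : (c - H) * b - w c b <= (c - H) * 0 - w c 0 by rewrite w0; lra.
  apply: (@le_off_finite _ (fun t => (c - H) * t - w c t) E) => //; first exact: ltW.
    by apply: within_B => //; apply: within_M; [exact: within_cst|exact: within_id].
  move=> t tb tE; exists ((c - H) * 1 - (c - h t + phi t * w c t `^ (- alpha))).
    by have := wd t tb tE => ?; apply: is_deriveB; exact: is_deriveZ.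
  have := hH tb; rewrite ler_norml; have := half_phi_gt0 philb tb.
  by have := powR_ge0 (w c t) (- alpha); nra.
Qed.

(** Along a solution, [w - A] is strictly increasing when [A' = c - h]. *)
Lemma half_end_gt0 c w A x : sol c w -> 0 <= x < b -> {within `[x, b], continuous A} ->
  (forall t, x < t < b -> t \notin E -> is_derive t (1 : R) A (c - h t)) ->
  A x <= A b -> 0 < w b.
Proof.
move=> [wc w0 wp wd] /andP[x0 xb] Ac Ad AA.
have wx : 0 <= w x.
  by move: x0; rewrite le_eqVlt => /predU1P[<-|x0]; [rewrite w0|apply/ltW/wp; lra].
suff : A b - w b < A x - w x by lra.
apply: (@lt_off_finite _ (fun t => A t - w t) E) => //.
  by apply: within_B => //; exact: within_itv_sub wc.
move=> t txb tE; have tb : 0 < t < b by lra.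
exists (c - h t - (c - h t + phi t * w t `^ (- alpha))).
  by have := wd t tb tE; have := Ad t txb tE => ? ?; exact: is_deriveB.
have : 0 < phi t * w t `^ (- alpha) by rewrite mulr_gt0 ?powR_gt0 ?wp // (half_phi_gt0 philb).
lra.
Qed.

Lemma half_end_gt0_of_gt c w hb : sol c w -> h t @[t --> b^'-] --> hb -> hb < c -> 0 < w b.
Proof.
move=> ws /at_leftP hl hbc; have hb0 := b0.
have [d d0 Hd] := hl (c - hb) ltac:(lra).
pose x := Num.max (b / 2) (b - d / 2).
have [x0 xb xd] : [/\ 0 < x, x < b & b - d < x].
  by rewrite /x /Num.max; case: ifP => ?; split; lra.
have ai : mu.-integrable `[x, b] (EFin \o (fun t => c - h t)).
  apply: (@integrable_bounded_off_finite _ _ E _ _ (`|c| + H)) => // t txb.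
    by move=> tE; apply: continuousB; [exact: cst_continuous|apply: hc => //; lra].
  by apply: le_trans (ler_normB _ _) _; rewrite lerD2l hH //; lra.
have [|Ac Ad] := antiderivative (E := E) xb ai.
  by move=> t txb tE; apply: continuousB; [exact: cst_continuous|apply: hc => //; lra].
apply: (half_end_gt0 ws _ Ac Ad); first lra.
set A := oriented_integral _ _.
suff : - A b <= - A x by lra.
apply: (@le_off_finite _ (fun t => - A t) E) => //; [exact: ltW|exact: within_N|].
move=> t txb tE; exists (- (c - h t)).
  by have := Ad t txb tE => ?; exact: is_deriveN.
by have := Hd t ltac:(lra); rewrite ltr_norml; lra.
Qed.

(** A straight line of slope [- k] ending at [(b, 0)] is an upper barrier. *)
Lemma half_end_eq0 c w m k hm : sol c w -> 0 < k ->
  (forall t, 0 < t < b -> hm <= h t) ->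
  (forall t, 0 < t < b -> phi t <= m * (b - t) `^ alpha) ->
  k + m * k `^ (- alpha) <= hm - c -> w b <= 0.
Proof.
move=> [wc w0 wp wd] k0 hhm phim kc; have hb := b0.
suff : w b - k * (b - b) <= 0 by lra.
apply: (@barrier _ (fun t => w t - k * (b - t)) E 0 b) => //; first exact: ltW.
- apply: within_B => //; apply: within_M; first exact: within_cst.
  by apply: within_B; [exact: within_cst|exact: within_id].
- by rewrite w0; nra.
- move=> t tb tE wt; exists (c - h t + phi t * w t `^ (- alpha) - k * (0 - 1)).
    by have := wd t tb tE => ?; apply: is_deriveB; exact: is_deriveZ.
  have bt : 0 < b - t by lra.
  have h1 : w t `^ (- alpha) <= k `^ (- alpha) * (b - t) `^ (- alpha).
    rewrite -powRM; [|lra|lra]; apply: powN_anti => //; [by rewrite mulr_gt0|lra].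
  have h2 : phi t * w t `^ (- alpha) <= m * k `^ (- alpha).
    apply: (@le_trans _ _ (m * (b - t) `^ alpha * (k `^ (- alpha) * (b - t) `^ (- alpha)))).
      apply: ler_pM => //; [exact/ltW/(half_phi_gt0 philb)|exact: powR_ge0|exact: phim].
    have -> : m * (b - t) `^ alpha * (k `^ (- alpha) * (b - t) `^ (- alpha)) =
      m * k `^ (- alpha) * ((b - t) `^ alpha * (b - t) `^ (- alpha)) by ring.
    by rewrite [(b - t) `^ (- alpha)]powRN mulfV ?mulr1 // gt_eqF // powR_gt0.
  by have := hhm t tb; lra.
Qed.

End HalfFamily.

(** * The two-sided boundary value problem *)

Section Reflection.
Context {R : realType}.
Notation mu := (@lebesgue_measure R).
Implicit Types (f : R -> R) (b : R).

Let refl (x : R) : measurableTypeR R := 1 - x.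

Let refl_measurable : measurable_fun [set: measurableTypeR R] refl.
Proof. exact: (@measurable_funB _ _ R setT (cst 1) id). Qed.

Let lebesgue_measure_refl (A : set R) : measurable A ->
  pushforward mu refl A = mu A.
Proof.
move=> mA; apply/esym.
apply: (@lebesgue_measure_unique _ (pushforward mu refl)) => //= _ [[a b]] _ <-.
rewrite /pushforward.
have -> : refl @^-1` [set` `]a, b]] = `[1 - b, 1 - a[%classic.
  apply/seteqP; split => x /=; rewrite /refl !in_itv /= => /andP[? ?]; apply/andP; split; lra.
rewrite !lebesgue_measure_itv /= !lte_fin.
have -> : (1 - b < 1 - a) = (a < b) by rewrite ltrD2l ltrN2.
case: ifP => // _; rewrite -!EFinD; congr EFin; ring.
Qed.

Lemma integrable_reflection f b : measurable_fun `[0, b] (fun x => f (1 - x)) ->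
  mu.-integrable `[1 - b, 1] (EFin \o f) ->
  mu.-integrable `[0, b] (EFin \o (fun x => f (1 - x))).
Proof.
move=> mf' /integrableP[mf fi]; apply/integrableP; split; first exact/measurable_EFinP.
have E : refl @^-1` `[1 - b, 1] = `[0, b]%classic.
  apply/seteqP; split => x /=; rewrite /refl !in_itv /= => /andP[? ?]; apply/andP; split; lra.
rewrite -E.
rewrite -(@ge0_integral_pushforward _ _ (measurableTypeR R) (measurableTypeR R) R refl refl_measurable mu `[1 - b, 1]
  (fun x => `|(f x)%:E|)%E) //; last exact: measurableT_comp.
apply: le_lt_trans fi; rewrite le_eqVlt; apply/orP; left; apply/eqP.
by apply: eq_measure_integral => //= A mA _; exact: lebesgue_measure_refl.
Qed.

End Reflection.

Section BoundaryValueProblem.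
Context {R : realType}.
Notation mu := (@lebesgue_measure R).

Lemma itv_cc_split (a b c : R) : a <= b -> b <= c ->
  `[a, c]%classic = `[a, b] `|` `[b, c].
Proof.
move=> ab bc; apply/seteqP; split => t /=; rewrite !in_itv /=.
  by move=> /andP[? ?]; have [|] := leP t b; [left|right]; apply/andP; split; lra.
by case=> /andP[? ?]; apply/andP; split; lra.
Qed.

Lemma is_derive_reflection (f : R -> R) (t l : R) : is_derive (1 - t) (1 : R) f l ->
  is_derive t (1 : R) (fun x : R => f (1 - x)) (- l).
Proof.
move=> fd; have h : is_derive t (1 : R) (fun x : R => 1 - x) (- 1).
  by rewrite -[X in is_derive _ _ _ X]sub0r; exact: is_deriveB.
by have := @is_derive1_comp _ f (fun x : R => 1 - x) t _ _ fd h; rewrite mulrN1.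
Qed.

Lemma continuous_reflection (f : R -> R) (t : R) : {for 1 - t, continuous f} ->
  {for t, continuous (fun x : R => f (1 - x))}.
Proof.
move=> fc; apply: (@continuous_comp _ _ _ (fun x : R => 1 - x) f) => //.
by apply: continuousB; [exact: cst_continuous|exact: cvg_id].
Qed.

Lemma within_reflection (f : R -> R) (a b : R) : {within `[1 - b, 1 - a], continuous f} ->
  {within `[a, b], continuous (fun x : R => f (1 - x))}.
Proof.
move=> /within_itvP H; apply/within_itvP => x xab e e0.
have [d d0 Hd] := H (1 - x) ltac:(lra) e e0.
exists d => // y yab xy; apply: Hd; first lra.
by rewrite (_ : 1 - x - (1 - y) = - (x - y)) ?normrN //; ring.
Qed.

Lemma powN_gap (al D F x y S : R) : 0 < al -> 0 < S ->
  `|x - S| < S / 2 -> `|y - S| < S / 2 -> `|F| * (S / 2) `^ (- al) < D ->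
  F * (y `^ (- al) - x `^ (- al)) < D.
Proof.
move=> al0 S0; rewrite !ltr_norml => hx hy hF; have S2 : 0 < S / 2 by lra.
have px : x `^ (- al) <= (S / 2) `^ (- al) by apply: powN_anti => //; lra.
have py : y `^ (- al) <= (S / 2) `^ (- al) by apply: powN_anti => //; lra.
apply: le_lt_trans hF; apply: le_trans (ler_norm _) _; rewrite normrM ler_wpM2l //.
have := powR_ge0 x (- al); have := powR_ge0 y (- al); rewrite ler_norml; lra.
Qed.

Variables (alpha s H : R) (E : seq R) (f h : R -> R).
Hypothesis alpha0 : 0 < alpha.
Hypothesis s0 : 0 < s.
Hypothesis s1 : s < 1.
Hypothesis sE : s \in E.
Hypothesis fc : forall t : R, 0 < t < 1 -> t \notin E -> {for t, continuous f}.
Hypothesis fi : mu.-integrable `[0, 1] (EFin \o f).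
Hypothesis f_neg : forall x y : R, 0 < x -> x <= y -> y < s ->
  exists2 k : R, 0 < k & forall t, x <= t <= y -> k <= - f t.
Hypothesis f_pos : forall x y : R, s < x -> x <= y -> y < 1 ->
  exists2 k : R, 0 < k & forall t, x <= t <= y -> k <= f t.
Hypothesis fs : f t @[t --> s^'-] --> (0 : R).
Hypothesis hH : forall t : R, 0 < t < 1 -> `|h t| <= H.
Hypothesis hc : forall t : R, 0 < t < 1 -> t \notin E -> {for t, continuous h}.
Hypothesis hs : {for s, continuous h}.

(** The problem satisfied by minus the flux as a function of the height. *)
Definition bvp_solution (c : R) (w : R -> R) :=
  [/\ {within `[0, 1], continuous w}, w 0 = 0, w 1 = 0,
      forall t, 0 < t < 1 -> 0 < w t &
      forall t, 0 < t < 1 -> t \notin E ->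
        is_derive t (1 : R) w (c - h t - f t * w t `^ (- alpha))].

Let fL (t : R) := - f t.
Let fR (t : R) := f (1 - t).
Let hR (t : R) := - h (1 - t).
Let ER := [seq 1 - x | x <- E].

Let notin_ER t : t \notin ER -> 1 - t \notin E.
Proof.
by apply: contra => tE; apply/mapP; exists (1 - t) => //; ring.
Qed.

Let fLc t : 0 < t < s -> t \notin E -> {for t, continuous fL}.
Proof.
by move=> ts tE; apply: continuousN; apply: fc => //; have := s1; lra.
Qed.

Let fRc t : 0 < t < 1 - s -> t \notin ER -> {for t, continuous fR}.
Proof.
move=> ts tE; apply: continuous_reflection; apply: fc; last exact: notin_ER.
by have := s0; lra.
Qed.

Let fLi : mu.-integrable `[0, s] (EFin \o fL).
Proof.
have fi' : mu.-integrable `[0, s] (EFin \o f).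
  by apply: integrableS fi => //; apply: subset_itvl; rewrite bnd_simp ltW.
have -> : EFin \o fL = (-%E \o (EFin \o f))%E by [].
exact: integrableN.
Qed.

Let fRi : mu.-integrable `[0, 1 - s] (EFin \o fR).
Proof.
apply: integrable_reflection.
  by apply: measurable_fun_oo_cc; exact: measurable_fun_off_finite fRc.
by apply: integrableS fi => //; apply: subset_itvr; rewrite bnd_simp; have := s0; lra.
Qed.

Let fLlb (x y : R) : 0 < x -> x <= y -> y < s ->
  exists2 k : R, 0 < k & forall t, x <= t <= y -> k <= fL t.
Proof. exact: f_neg. Qed.

Let fRlb (x y : R) : 0 < x -> x <= y -> y < 1 - s ->
  exists2 k : R, 0 < k & forall t, x <= t <= y -> k <= fR t.
Proof.
move=> x0 xy ys; have [|||k k0 Hk] := @f_pos (1 - y) (1 - x); try lra.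
by exists k => // t txy; apply: Hk; lra.
Qed.

Let hLH t : 0 < t < s -> `|h t| <= H.
Proof. by move=> ts; apply: hH; have := s1; lra. Qed.

Let hRH t : 0 < t < 1 - s -> `|hR t| <= H.
Proof. by move=> ts; rewrite normrN; apply: hH; have := s0; lra. Qed.

Let hLc t : 0 < t < s -> t \notin E -> {for t, continuous h}.
Proof. by move=> ts tE; apply: hc => //; have := s1; lra. Qed.

Let hRc t : 0 < t < 1 - s -> t \notin ER -> {for t, continuous hR}.
Proof.
move=> ts tE; apply: continuousN; apply: continuous_reflection.
by apply: hc; [have := s0; lra|exact: notin_ER].
Qed.

Let solL c := half_solution alpha s E fL (fun t => c - h t).
Let solR c := half_solution alpha (1 - s) ER fR (fun t => c - hR t).

Lemma bvp_left c w : bvp_solution c w -> solL c w.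
Proof.
move=> [wc w0 _ wp wd]; have h1 := s1; split=> //.
- by apply: within_itv_sub wc => //; exact: ltW.
- by move=> t ts; apply: wp; lra.
- by move=> t ts tE; rewrite mulNr; apply: wd => //; lra.
Qed.

Lemma bvp_right c w : bvp_solution c w -> solR (- c) (fun t => w (1 - t)).
Proof.
move=> [wc _ w1 wp wd]; have h0 := s0; split=> //.
- by apply: within_reflection; apply: within_itv_sub wc; lra.
- by rewrite subr0.
- by move=> t ts; apply: wp; lra.
- move=> t ts tE.
  have /is_derive_reflection := wd (1 - t) ltac:(lra) (notin_ER tE).
  by move=> D; apply: (is_derive_eq D); rewrite /hR /fR; ring.
Qed.

Lemma bvp_unique c v w : bvp_solution c v -> bvp_solution c w ->
  forall t, 0 <= t <= 1 -> v t = w t.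
Proof.
move=> vs ws t t01; have [ts|st] := leP t s.
  by apply: (half_unique alpha0 fLlb (bvp_left vs) (bvp_left ws)); lra.
have := half_unique alpha0 fRlb (bvp_right vs) (bvp_right ws) (t := 1 - t).
by rewrite subKr; apply; lra.
Qed.

(** Speeding up the wave raises the left branch and lowers the right one;
    matching at [s] for two speeds would force equal values there, while the
    difference of the two solutions has slope [c' - c] at [s]. *)
Lemma bvp_speed_unique c c' v w : bvp_solution c v -> bvp_solution c' w -> c = c'.
Proof.
wlog cc : c c' v w / c <= c' => [W vs ws|vs ws].
  have [cc|cc] := leP c c'; first exact: W vs ws.
  by apply/esym; apply: W ws vs; exact: ltW.
move: cc; rewrite le_eqVlt => /predU1P[//|cc]; exfalso.
have hs0 := s0; have hs1 := s1.
have vw t : 0 <= t <= s -> v t <= w t.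
  move=> ts; rewrite -[X in _ <= X]addr0 -(mul0r t).
  apply: (half_comparison alpha0 fLlb _ _ (bvp_left vs) (bvp_left ws)) => //.
  by move=> x _; lra.
have wv : w s <= v s.
  have := half_comparison alpha0 fRlb (lexx 0) _ (bvp_right ws) (bvp_right vs) (t := 1 - s).
  rewrite mul0r addr0 subKr; apply; last lra.
  by move=> x _; lra.
have [vc _ _ vp vd] := vs; have [wc _ _ wp wd] := ws.
have W0 : 0 < v s by apply: vp; lra.
have sv : w s = v s by apply/eqP; rewrite eq_le wv vw //; lra.
pose B := (v s / 2) `^ (- alpha).
have B0 : 0 < B by apply: powR_gt0; lra.
have s01 : 0 < s < 1 by lra.
have B2 : 0 < v s / 2 by lra.
have [d1 d10 Hd1] := (for_contP v s).1 (within_itv_interior vc s01) _ B2.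
have [d2 d20 Hd2] := (for_contP w s).1 (within_itv_interior wc s01) _ B2.
have [d3 d30 Hd3] := (at_leftP f s 0).1 fs ((c' - c) / B) ltac:(apply: divr_gt0 => //; lra).
pose d := Num.min s (Num.min d1 (Num.min d2 d3)).
have [ds dd1 dd2 dd3] : [/\ d <= s, d <= d1, d <= d2 & d <= d3].
  by rewrite /d !ge_min !lexx /= !orbT.
have d0 : 0 < d by rewrite /d !lt_min s0 d10 d20 d30.
have [x [x0 xs sx]] : exists x, [/\ 0 <= x, x < s & s - d <= x].
  by exists (s - d); rewrite subr_ge0 ds gtrDl oppr_lt0.
have x1 : s <= 1 := ltW s1.
suff : v s - w s < v x - w x by rewrite sv subrr subr_gt0 ltNge vw // x0 ltW.
apply: (@lt_off_finite _ (fun t => v t - w t) E) => //.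
  by apply: within_B; [exact: within_itv_sub x0 x1 vc|exact: within_itv_sub x0 x1 wc].
move=> t /andP[xt ts] tE.
have t01 : 0 < t < 1 by rewrite (le_lt_trans x0 xt) (lt_trans ts s1).
exists (c - h t - f t * v t `^ (- alpha) - (c' - h t - f t * w t `^ (- alpha))).
  by have := vd t t01 tE; have := wd t t01 tE => ? ?; exact: is_deriveB.
have std : s - d < t := le_lt_trans sx xt.
have tsd : `|t - s| < d by rewrite distrC ger0_norm ?subr_ge0 ?(ltW ts) // ltrBlDl -ltrBlDr.
have := Hd1 t (lt_le_trans tsd dd1); have := Hd2 t (lt_le_trans tsd dd2).
have := Hd3 t; rewrite ts (le_lt_trans _ std) ?lerB // => /(_ isT).
rewrite subr0 ltr_pdivlMr // sv => hF hw hv.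
have gap := powN_gap alpha0 W0 hv hw hF.
rewrite (_ : _ - _ = f t * (w t `^ (- alpha) - v t `^ (- alpha)) - (c' - c)) ?subr_lt0 //.
ring.
Qed.

(** Shooting from both ends: [F c] is the left value at [s] minus the right
    one, and [c] is chosen with [F c = 0]. *)
Lemma bvp_exists :
  (exists (x : R) (A : R -> R), [/\ 0 <= x <= 1, x != s, {within `[0, 1], continuous A},
     forall t, 0 < t < 1 -> t \notin E -> is_derive t (1 : R) A (h s - h t) &
     A x <= A s]) ->
  exists c w, bvp_solution c w.
Proof.
move=> [x [A [x01 xs Ac Ad AA]]]; have hs0 := s0; have hs1 := s1.
have s1' : 0 < 1 - s by lra.
have [WL [WLP WL0 WLm WLb]] := half_value alpha0 s0 fLc fLi fLlb hLH hLc.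
have [WR [WRP WR0 WRm WRb]] := half_value alpha0 s1' fRc fRi fRlb hRH hRc.
pose F c := WL c - WR (- c).
have FL c c' : c <= c' -> F c <= F c' <= F c + (c' - c).
  by move=> cc; have := WLm c c' cc; have := WRm (- c') (- c) ltac:(lra); rewrite /F; nra.
have Fc : continuous F.
  move=> c; apply/for_contP => e e0; exists e => // y.
  rewrite !ltr_norml => ye; have [yc|cy] := leP y c.
    by have := FL _ _ yc; lra.
  by have := FL _ _ (ltW cy); lra.
pose K1 := Num.max 0 (H + WR 0 / s); pose K2 := Num.max 0 (H + WL 0 / (1 - s)).
have FK1 : 0 <= F K1.
  have K10 : 0 <= K1 by rewrite le_max lexx.
  have : H + WR 0 / s <= K1 by rewrite le_max lexx orbT.
  rewrite -lerBrDl ler_pdivrMr // => h1.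
  by have := WLb K1; have := WRm (- K1) 0 ltac:(lra); rewrite /F; lra.
have FK2 : F (- K2) <= 0.
  have K20 : 0 <= K2 by rewrite le_max lexx.
  have : H + WL 0 / (1 - s) <= K2 by rewrite le_max lexx orbT.
  rewrite -lerBrDl ler_pdivrMr // => h1.
  by have := WRb K2; have := WLm (- K2) 0 ltac:(lra); rewrite /F opprK; lra.
have K12 : - K2 <= K1.
  have : 0 <= K1 by rewrite le_max lexx.
  have : 0 <= K2 by rewrite le_max lexx.
  lra.
have [c _ Fc0] : exists2 c, c \in `[- K2, K1] & F c = 0.
  apply: IVT => //; first exact: continuous_subspaceT.
  by rewrite ge_min le_max FK2 FK1 /= orbT.
have [wl wlP] := half_family_exists alpha0 s0 fLc fLi fLlb hLH hLc c.
have [wr wrP] := half_family_exists alpha0 s1' fRc fRi fRlb hRH hRc (- c).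
have EW : wl s = wr (1 - s) by rewrite (WLP _ _ wlP) (WRP _ _ wrP); move: Fc0; rewrite /F; lra.
(* Off the value [h s] the speed decides which branch is positive at [s];
   for [c = h s] this is what [A] is for. *)
have Wpos : 0 < wl s.
  have [cs|sc|cs] := ltgtP c (h s).
  - rewrite EW; apply: (half_end_gt0_of_gt (hb := - h s) s1' fRlb hRH hRc wrP); last lra.
    apply: cvg_within_filter; rewrite -[X in h X](subKr 1 s).
    by apply: continuousN; apply: continuous_reflection; rewrite subKr.
  - apply: (half_end_gt0_of_gt (hb := h s) s0 fLlb hLH hLc wlP) => //.
    exact: cvg_within_filter.
  - have [xls|sx] : x < s \/ s < x by apply/orP; rewrite -neq_lt.
      apply: (half_end_gt0 fLlb wlP (A := A) (x := x)) => //; first lra.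
        by apply: within_itv_sub Ac; lra.
      by move=> t ts tE; rewrite cs; apply: Ad => //; lra.
    rewrite EW; apply: (half_end_gt0 fRlb wrP (A := fun t => A (1 - t)) (x := 1 - x)).
    + lra.
    + by apply: within_reflection; apply: within_itv_sub Ac; lra.
    + move=> t ts tE; have /is_derive_reflection := Ad (1 - t) ltac:(lra) (notin_ER tE).
      by move=> D; apply: (is_derive_eq D); rewrite /hR cs; ring.
    + by rewrite !subKr.
have [wlc wl0 wlp wld] := wlP; have [wrc wr0 wrp wrd] := wrP.
pose w t := if t <= s then wl t else wr (1 - t).
have wE1 t : t <= s -> w t = wl t by rewrite /w => ->.
have wE2 t : s <= t -> w t = wr (1 - t).
  by rewrite le_eqVlt => /predU1P[<-|st]; rewrite /w ?lexx // leNgt st.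
exists c, w; split.
- rewrite (itv_cc_split (ltW s0) (ltW s1)).
  apply: withinU_continuous; try exact: interval_closed.
    apply: subspace_eq_continuous wlc => t; rewrite inE /= in_itv /= => /andP[_ ts].
    by apply/esym; exact: wE1.
  have wrc' : {within `[s, 1], continuous (fun t => wr (1 - t))}.
    by apply: within_reflection; rewrite subrr.
  apply: subspace_eq_continuous wrc' => t; rewrite inE /= in_itv /= => /andP[st _].
  by apply/esym; exact: wE2.
- by rewrite wE1 // ltW.
- by rewrite wE2 ?subrr // ltW.
- move=> t t01; have [ts|st|->] := ltgtP t s; last by rewrite wE1.
    by rewrite wE1; [apply: wlp; lra|exact: ltW].
  by rewrite wE2; [apply: wrp; lra|exact: ltW].
- move=> t t01 tE; have [ts|st|te] := ltgtP t s; last by rewrite te sE in tE.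
    have nw : {near t, wl =1 w}.
      have : \forall z \near t, z \in `]0, s[ by apply: near_in_itvoo; rewrite in_itv /= ts; lra.
      by apply: filterS => z; rewrite in_itv /= => /andP[_ zs]; rewrite wE1 // ltW.
    apply: (near_eq_is_derive nw); have := wld t ltac:(lra) tE.
    by rewrite wE1 ?(ltW ts) // /fL mulNr.
  have nw : {near t, (fun t => wr (1 - t)) =1 w}.
    have : \forall z \near t, z \in `]s, 1[ by apply: near_in_itvoo; rewrite in_itv /= st; lra.
    by apply: filterS => z; rewrite in_itv /= => /andP[zs _]; rewrite wE2 // ltW.
  apply: (near_eq_is_derive nw).
  have tER : 1 - t \notin ER.
    by apply: contra tE => /mapP[y yE ty]; rewrite (_ : t = y) //; lra.
  have /is_derive_reflection := wrd (1 - t) ltac:(lra) tER.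
  by move=> D; apply: (is_derive_eq D); rewrite wE2 ?(ltW st) // /hR /fR subKr; ring.
Qed.

End BoundaryValueProblem.

(** * One-sided derivatives, primitives and inverses *)

Section Utilities.
Context {R : realType}.
Notation mu := (@lebesgue_measure R).
Implicit Types (f F Z U : R -> R) (E : seq R) (a b x y z t l e d : R).

Lemma unit_interval_near t : 0 < t < 1 -> \forall u \near t, 0 < u < 1.
Proof.
move=> t01; have : \forall u \near t, u \in `]0, 1[ by apply: near_in_itvoo; rewrite in_itv.
by apply: filterS => u; rewrite in_itv.
Qed.

Lemma locally_bounded_segment f x y :
  (forall t, x <= t <= y -> exists K, \forall u \near t, f u <= K) ->
  exists2 K, 0 < K & forall t, x <= t <= y -> f t <= K.
Proof.
move=> H; have /compact_near_coveringP := @segment_compact R x y.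
move=> /(_ R (pinfty_nbhs R) (fun K t => f t <= K) _).
case=> [|K [_ HK]].
  move=> t; rewrite /= in_itv /= => /H[K HK].
  exists ([set u | f u <= K], [set M | K <= M]) => //=.
    by split=> //; exists K; split; [exact: num_real|move=> M /ltW].
  by move=> [u M] /= [? ?]; lra.
exists (Num.max 1 (K + 1)); first by rewrite lt_max ltr01.
move=> t txy; apply: le_trans (_ : K + 1 <= _); last by rewrite le_max lexx orbT.
by apply: (HK (K + 1)); [lra|rewrite /= in_itv].
Qed.

Lemma boundary_closed (A : set R) z : closed A -> boundary A z -> A z.
Proof. by move=> cA [/cA]. Qed.

Lemma notin_boundary (A : set R) z : ~ boundary A z -> A z -> \forall x \near z, A x.
Proof.
move=> nA Az; apply: contrapT => nI; apply: nA; split; first exact: subset_closure.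
exact: nI.
Qed.

(** A mean value inequality that tolerates exceptional points; it recovers
    derivatives at a point from derivatives nearby. *)
Lemma slope_bound f E a b l e : a <= b -> {within `[a, b], continuous f} ->
  (forall t, a < t < b -> t \notin E -> exists2 l', is_derive t (1 : R) f l' & `|l' - l| <= e) ->
  `|f b - f a - l * (b - a)| <= e * (b - a).
Proof.
move=> ab fc fd; have h1 : f b - (l + e) * b <= f a - (l + e) * a.
  apply: (@le_off_finite _ (fun t => f t - (l + e) * t) E) => //.
    by apply: within_B => //; apply: within_M; [exact: within_cst|exact: within_id].
  move=> t tab tE; have [l' fl'] := fd t tab tE; rewrite ler_norml => le.
  by exists (l' - (l + e) * 1); [apply: is_deriveB; exact: is_deriveZ|lra].
have h2 : (l - e) * b - f b <= (l - e) * a - f a.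
  apply: (@le_off_finite _ (fun t => (l - e) * t - f t) E) => //.
    by apply: within_B => //; apply: within_M; [exact: within_cst|exact: within_id].
  move=> t tab tE; have [l' fl'] := fd t tab tE; rewrite ler_norml => le.
  by exists ((l - e) * 1 - l'); [apply: is_deriveB; exact: is_deriveZ|lra].
by rewrite ler_norml; lra.
Qed.

Lemma is_derive_eps f x l :
  (forall e, 0 < e -> exists2 d, 0 < d &
    forall y, `|y - x| < d -> `|f y - f x - l * (y - x)| <= e * `|y - x|) ->
  is_derive x (1 : R) f l.
Proof.
move=> H.
have C : (fun h => h^-1 *: (f (h *: (1 : R) + x) - f x)) @ 0^' --> l.
  apply/cvgrPdist_le => e /H[d d0 Hd].
  apply/nbhs_ballP; exists d => //= h; rewrite /ball /= sub0r normrN => hd h0.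
  have hx : h *: (1 : R) + x - x = h by rewrite addrK /GRing.scale /= mulr1.
  have := Hd (h *: (1 : R) + x); rewrite hx => /(_ hd).
  set X := f _ - f x => HX.
  have -> : l - h^-1 *: X = - (h^-1 * (X - l * h)).
    by rewrite /GRing.scale /=; field.
  by rewrite normrN normrM normfV ler_pdivrMl ?normr_gt0 // (mulrC `|h|).
apply: DeriveDef; first by apply/cvg_ex; exists l.
exact: cvg_lim C.
Qed.

Lemma is_derive_of_slopes f E x l :
  (exists2 r, 0 < r & forall y, `|y - x| < r -> {for y, continuous f}) ->
  (forall e, 0 < e -> exists2 d, 0 < d & forall t, `|t - x| < d -> t != x -> t \notin E ->
    exists2 l', is_derive t (1 : R) f l' & `|l' - l| <= e) ->
  is_derive x (1 : R) f l.
Proof.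
move=> [r r0 Hr] H; apply: is_derive_eps => e /H[d d0 Hd].
exists (Num.min r d); first by rewrite lt_min r0.
move=> y; rewrite lt_min !ltr_norml => /andP[yr yd].
have [xy|yx] := leP x y.
  rewrite (ger0_norm (x := y - x)); last lra.
  apply: (@slope_bound f E) => //.
    by apply: within_of_for => t txy; apply: Hr; rewrite ltr_norml; lra.
  by move=> t txy tE; apply: Hd => //; [rewrite ltr_norml; lra|apply/negP => /eqP; lra].
rewrite distrC (_ : `|y - x| = x - y); last by rewrite distrC ger0_norm; lra.
have -> : l * (y - x) - (f y - f x) = f x - f y - l * (x - y) by ring.
apply: (@slope_bound f E) => //; first exact: ltW.
  by apply: within_of_for => t txy; apply: Hr; rewrite ltr_norml; lra.
by move=> t txy tE; apply: Hd => //; [rewrite ltr_norml; lra|apply/negP => /eqP; lra].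
Qed.

Lemma left_diff_quot_cvg f z l :
  (exists2 r, 0 < r & forall y, z - r < y <= z -> {for y, continuous f}) ->
  (forall e, 0 < e -> exists2 d, 0 < d & forall t, z - d < t < z ->
    exists2 l', is_derive t (1 : R) f l' & `|l' - l| <= e) ->
  diff_quot f z e @[e --> 0^'-] --> l.
Proof.
move=> [r r0 Hr] H; apply/at_leftP => e e0.
have e2 : 0 < e / 2 by lra.
have [d d0 Hd] := H _ e2.
exists (Num.min r d); first by rewrite lt_min r0.
move=> x /andP[xd x0]; have : - x < Num.min r d by lra.
rewrite lt_min => /andP[xr xd'].
rewrite /diff_quot; set X := f _ - f z.
have : `|- X - l * (z - (x + z))| <= e / 2 * (z - (x + z)).
  rewrite /X opprB; apply: (@slope_bound f [::]); first lra.
    by apply: within_of_for => t txy; apply: Hr; lra.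
  by move=> t txy tE; apply: Hd; lra.
have -> : z - (x + z) = - x by ring.
have -> : x^-1 * X - l = (- x)^-1 * (- X - l * (- x)) by field; rewrite lt_eqF.
move=> h; rewrite normrM normfV (ger0_norm (x := - x)); last lra.
apply: le_lt_trans (_ : e / 2 < _); last lra.
by rewrite ler_pdivrMl; lra.
Qed.

Lemma right_diff_quot_cvg f z l :
  (exists2 r, 0 < r & forall y, z <= y < z + r -> {for y, continuous f}) ->
  (forall e, 0 < e -> exists2 d, 0 < d & forall t, z < t < z + d ->
    exists2 l', is_derive t (1 : R) f l' & `|l' - l| <= e) ->
  diff_quot f z e @[e --> 0^'+] --> l.
Proof.
move=> [r r0 Hr] H; apply/at_rightP => e e0.
have e2 : 0 < e / 2 by lra.
have [d d0 Hd] := H _ e2.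
exists (Num.min r d); first by rewrite lt_min r0.
move=> x; rewrite add0r lt_min => /and3P[x0 xr xd].
rewrite /diff_quot; set X := f _ - f z.
have : `|X - l * (x + z - z)| <= e / 2 * (x + z - z).
  apply: (@slope_bound f [::]); first lra.
    by apply: within_of_for => t txy; apply: Hr; lra.
  by move=> t txy tE; apply: Hd; lra.
rewrite addrK => h.
have -> : x^-1 * X - l = x^-1 * (X - l * x) by field; rewrite gt_eqF.
rewrite normrM normfV (ger0_norm (x := x)); last lra.
apply: le_lt_trans (_ : e / 2 < _); last lra.
by rewrite ler_pdivrMl; lra.
Qed.

(** The primitive is based at an interior point, because the integral may
    diverge at both ends. *)
Lemma open_antiderivative f E a b x0 : a < x0 < b ->
  (forall x y, a < x -> x <= y -> y < b -> mu.-integrable `[x, y] (EFin \o f)) ->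
  (forall t, a < t < b -> t \notin E -> {for t, continuous f}) ->
  forall t, a < t < b -> {for t, continuous (oriented_integral f x0)} /\
  (t \notin E -> is_derive t (1 : R) (oriented_integral f x0) (f t)).
Proof.
move=> /andP[ax0 x0b] fi fc t /andP[at_ tb].
have [x [ax xx0 xt]] : exists x, [/\ a < x, x < x0 & x < t].
  by exists (Num.min ((a + x0) / 2) ((a + t) / 2)); rewrite /Num.min; case: ifP => ?; split; lra.
have [y [yb x0y ty]] : exists y, [/\ y < b, x0 < y & t < y].
  by exists (Num.max ((x0 + b) / 2) ((t + b) / 2)); rewrite /Num.max; case: ifP => ?; split; lra.
have xy : x < y by exact: lt_trans xt ty.
have fi' := fi x y ax (ltW xy) yb.
have fc' u : x < u < y -> u \notin E -> {for u, continuous f}.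
  by move=> /andP[xu uy] uE; apply: fc => //; rewrite (lt_trans ax xu) (lt_trans uy yb).
have [Ic Id] := antiderivative xy fi' fc'.
have FI u : x <= u <= y -> oriented_integral f x0 u =
    oriented_integral f x u - oriented_integral f x x0.
  by move=> uxy; apply: (oriented_integral_diff _ uxy fi' fc' Ic Id); rewrite !ltW.
have nF : {near t, (fun u => oriented_integral f x u - oriented_integral f x x0)
                     =1 oriented_integral f x0}.
  have : \forall u \near t, u \in `]x, y[ by apply: near_in_itvoo; rewrite in_itv /= xt ty.
  by apply: filterS => u; rewrite in_itv /= => /andP[? ?]; rewrite [RHS]FI // !ltW.
split.
  have C : (fun u => oriented_integral f x u - oriented_integral f x x0) u @[u --> t]
      --> oriented_integral f x0 t.
    rewrite FI; last by rewrite !ltW.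
    apply: cvgB; last exact: cvg_cst.
    by apply: (within_itv_interior Ic); rewrite xt ty.
  exact: cvg_trans (near_eq_cvg nF) C.
move=> tE; apply: (near_eq_is_derive nF).
rewrite -[X in is_derive _ _ _ X]subr0; apply: is_deriveB.
by apply: Id => //; rewrite xt ty.
Qed.

(** The inverse of a decreasing function on [(0, 1)], extended by the values
    [1] and [0]; the supremum takes care of the points outside the range. *)
Definition extended_inverse Z (z : R) : R :=
  sup [set t : R | t = 0 \/ (0 < t < 1 /\ z <= Z t)].

Lemma extended_inverse_ext Z Z' : (forall t, 0 < t < 1 -> Z t = Z' t) ->
  extended_inverse Z = extended_inverse Z'.
Proof.
move=> ZZ; apply/funext => z; rewrite /extended_inverse; congr sup.
apply/seteqP; split => t [->|[t01 zt]]; [by left|right|by left|right].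
  by rewrite -ZZ.
by rewrite ZZ.
Qed.

Section ExtendedInverse.
Variable Z : R -> R.
Hypothesis Zdec : forall t t' : R, 0 < t -> t < t' -> t' < 1 -> Z t' < Z t.
Hypothesis Zc : forall t : R, 0 < t < 1 -> {for t, continuous Z}.
Let U := extended_inverse Z.

Let has_sup_inverse z : has_sup [set t : R | t = 0 \/ (0 < t < 1 /\ z <= Z t)].
Proof.
by split; [exists 0; left|exists 1 => t [->|[/andP[_ /ltW]]]].
Qed.

Lemma extended_inverse_ge z t : 0 < t < 1 -> z <= Z t -> t <= U z.
Proof. by move=> t01 zt; apply: ub_le_sup; [exact: (has_sup_inverse z).2|right]. Qed.

Lemma extended_inverse_le z t : 0 < t < 1 -> Z t < z -> U z <= t.
Proof.
move=> /andP[t0 t1] zt; apply: ge_sup; first exact: (has_sup_inverse z).1.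
move=> u [->|[/andP[u0 u1] zu]]; first exact: ltW.
rewrite leNgt; apply/negP => tu.
by have := Zdec t0 tu u1; lra.
Qed.

Lemma extended_inverse01 z : 0 <= U z <= 1.
Proof.
apply/andP; split; first by apply: ub_le_sup; [exact: (has_sup_inverse z).2|left].
by apply: ge_sup; [exact: (has_sup_inverse z).1|move=> t [->|[]]; lra].
Qed.

Lemma extended_inverse_nincr z z' : z <= z' -> U z' <= U z.
Proof.
move=> zz; apply: ge_sup; first exact: (has_sup_inverse z').1.
move=> t [->|[t01 zt]]; first by have /andP[] := extended_inverse01 z.
by apply: extended_inverse_ge => //; exact: le_trans zt.
Qed.

Lemma extended_inverseK t : 0 < t < 1 -> U (Z t) = t.
Proof.
move=> /[dup] t01 /andP[t0 t1]; apply/eqP; rewrite eq_le; apply/andP; split; last exact: extended_inverse_ge.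
apply: ge_sup; first exact: (has_sup_inverse (Z t)).1.
move=> u [->|[/andP[u0 u1] zu]]; first exact: ltW.
rewrite leNgt; apply/negP => tu.
by have := Zdec t0 tu u1; lra.
Qed.

Lemma extended_inverseVK z : 0 < U z < 1 -> Z (U z) = z.
Proof.
move=> /[dup] u01 /andP[u0 u1]; have [lt|gt|//] := ltgtP (Z (U z)) z; exfalso.
  have e0 : 0 < z - Z (U z) by lra.
  have [d d0 Hd] := (for_contP Z (U z)).1 (Zc u01) _ e0.
  pose t := Num.max (U z / 2) (U z - d / 2).
  have [t0 tu td] : [/\ 0 < t, t < U z & U z - t < d].
    by rewrite /t /Num.max; case: ifP => ?; split; lra.
  have t01 : 0 < t < 1 by rewrite t0 (lt_trans tu).
  have := Hd t; rewrite distrC ger0_norm; last lra.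
  move=> /(_ td); rewrite ltr_norml => h.
  have zt : Z t < z by lra.
  by have := extended_inverse_le t01 zt; lra.
have e0 : 0 < Z (U z) - z by lra.
have [d d0 Hd] := (for_contP Z (U z)).1 (Zc u01) _ e0.
pose t := Num.min ((U z + 1) / 2) (U z + d / 2).
have [t1 tu td] : [/\ t < 1, U z < t & t - U z < d].
  by rewrite /t /Num.min; case: ifP => ?; split; lra.
have t01 : 0 < t < 1 by rewrite t1 (lt_trans u0).
have := Hd t; rewrite ger0_norm; last lra.
move=> /(_ td); rewrite ltr_norml => h.
have zt : z <= Z t by lra.
by have := extended_inverse_ge t01 zt; lra.
Qed.

Lemma extended_inverse_continuous : continuous U.
Proof.
move=> z; apply/for_contP => e e0.
have [d1 d10 Hd1] : exists2 d, 0 < d & forall y, y <= z -> z - d < y -> U y < U z + e.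
  have [|h] := ltP (U z) (1 - e / 2); last first.
    by exists 1 => // y _ _; have := extended_inverse01 y; lra.
  move=> h; pose t := U z + e / 2.
  have t01 : 0 < t < 1 by rewrite /t; have := extended_inverse01 z; lra.
  have zt : Z t < z.
    rewrite ltNge; apply/negP => zt; have := extended_inverse_ge t01 zt; rewrite /t; lra.
  exists (z - Z t); first lra.
  move=> y yz yd; have yt : Z t < y by lra.
  by have := extended_inverse_le t01 yt; rewrite /t; lra.
have [d2 d20 Hd2] : exists2 d, 0 < d & forall y, z <= y -> y < z + d -> U z - e < U y.
  have [h|h] := leP (U z) (e / 2).
    by exists 1 => // y _ _; have := extended_inverse01 y; lra.
  pose t := Num.max (U z / 2) (U z - e / 2).
  have [t0 tu te] : [/\ 0 < t, t < U z & U z - e < t].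
    by rewrite /t /Num.max; case: ifP => ?; split; lra.
  have t01 : 0 < t < 1 by have := extended_inverse01 z; lra.
  have zt : z < Z t.
    rewrite ltNge; apply/negP; rewrite le_eqVlt => /predU1P[E|zt].
      by have := extended_inverseK t01; rewrite E; lra.
    by have := extended_inverse_le t01 zt; lra.
  exists (Z t - z); first lra.
  move=> y yz yd; have yt : y <= Z t by lra.
  by have := extended_inverse_ge t01 yt; lra.
exists (Num.min d1 d2); first by rewrite lt_min d10.
move=> y; rewrite lt_min !ltr_norml => /andP[h1 h2].
have [yz|zy] := leP y z.
  have zy' : z - d1 < y by lra.
  by have := extended_inverse_nincr yz; have := Hd1 y yz zy'; lra.
have zy' : y < z + d2 by lra.
by have := extended_inverse_nincr (ltW zy); have := Hd2 y (ltW zy) zy'; lra.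
Qed.

End ExtendedInverse.
End Utilities.

(** * Piecewise continuous coefficients *)

Section Subdivision.
Context {R : realType}.
Implicit Types (x : nat -> R) (f : R -> R) (t l : R).

Definition interior_nodes (n : nat) (x : nat -> R) := [seq x i | i <- iota 1 n].

Lemma interior_nodesP n x t :
  reflect (exists2 i, (1 <= i <= n)%N & t = x i) (t \in interior_nodes n x).
Proof.
apply: (iffP mapP) => [[i + ->]|[i hi ->]].
  by rewrite mem_iota add1n ltnS => hi; exists i.
by exists i => //; rewrite mem_iota add1n ltnS.
Qed.

Lemma subdivision_lt n x i j : subdivision01 n x -> (i < j)%N -> (j <= n.+1)%N -> x i < x j.
Proof.
move=> [_ _ H]; elim: j => // j IH; rewrite ltnS leq_eqVlt => /predU1P[->|ij] jn.
  exact: H.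
by apply: lt_trans (IH ij (ltnW jn)) _; apply: H.
Qed.

Lemma subdivision_in n x i : subdivision01 n x -> (1 <= i <= n)%N -> 0 < x i < 1.
Proof.
move=> xs /andP[i1 i_n]; have [x0 x1 _] := xs.
by rewrite -{1}x0 -x1 !(subdivision_lt xs) // ltnW.
Qed.

Lemma subdivision_piece n x t : subdivision01 n x -> 0 < t < 1 -> t \notin interior_nodes n x ->
  exists2 i, (i <= n)%N & x i < t < x i.+1.
Proof.
move=> [x0 x1 xlt] /andP[t0 t1] tx.
have H j : (j <= n.+1)%N -> t < x j -> exists2 i, (i <= n)%N & x i < t < x i.+1.
  elim: j => [|j IH] jn tj; first by move: tj; rewrite x0; lra.
  have [tj'|] := ltP t (x j); first exact: IH (ltnW jn) tj'.
  rewrite le_eqVlt => /predU1P[jt|jt]; last by exists j; rewrite ?jt.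
  exfalso; case: j IH jn tj jt => [|j] IH jn tj jt; first by move: t0; rewrite -jt x0 ltxx.
  by move/negP: tx; apply; apply/interior_nodesP; exists j.+1.
by apply: (H n.+1) => //; rewrite x1.
Qed.

Lemma piecewise_continuous_at n x f t : piecewise_continuous01 n x f -> 0 < t < 1 ->
  t \notin interior_nodes n x -> {for t, continuous f}.
Proof.
move=> [xs _ fc] t01 /(subdivision_piece xs t01)[i i_n xit].
by apply: (fc i i_n); rewrite in_itv.
Qed.

Lemma piecewise_right_limit n x f t : piecewise_continuous01 n x f -> 0 < t < 1 ->
  exists l, f u @[u --> t^'+] --> l.
Proof.
move=> fp t01; have [/interior_nodesP[i hi ->]|tx] := boolP (t \in interior_nodes n x).
  by have [_ H _] := fp; have [l1 [l2 [_ h _]]] := H i hi; exists l2.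
exists (f t); apply: cvg_at_right_filter; exact: piecewise_continuous_at fp t01 tx.
Qed.

Lemma piecewise_left_limit n x f t : piecewise_continuous01 n x f -> 0 < t < 1 ->
  exists l, f u @[u --> t^'-] --> l.
Proof.
move=> fp t01; have [/interior_nodesP[i hi ->]|tx] := boolP (t \in interior_nodes n x).
  by have [_ H _] := fp; have [l1 [l2 [h _ _]]] := H i hi; exists l1.
exists (f t); apply: cvg_at_left_filter; exact: piecewise_continuous_at fp t01 tx.
Qed.

Lemma near_split f (P : R -> Prop) t :
  (exists2 e, 0 < e & forall u, t - e < u < t -> P u) ->
  (exists2 e, 0 < e & forall u, t < u < t + e -> P u) -> P t ->
  \forall u \near t, P u.
Proof.
move=> [e e0 He] [e' e'0 He'] Pt; apply/nbhs_ballP; exists (Num.min e e').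
  by rewrite /= lt_min e0.
move=> u; rewrite /ball /= lt_min !ltr_norml => /andP[h1 h2].
by have [ut|tu|->//] := ltgtP u t; [apply: He|apply: He']; lra.
Qed.

Lemma piecewise_bounded_near n x f t : piecewise_continuous01 n x f -> 0 < t < 1 ->
  exists K, \forall u \near t, f u <= K.
Proof.
move=> fp t01.
have [l1 /at_leftP /(_ 1 ltr01)[d1 d10 H1]] := piecewise_left_limit fp t01.
have [l2 /at_rightP /(_ 1 ltr01)[d2 d20 H2]] := piecewise_right_limit fp t01.
exists (Num.max (f t) (Num.max (l1 + 1) (l2 + 1))).
apply: near_split => //.
- by exists d1 => // u /H1; rewrite ltr_norml !le_max => h; apply/orP; right; apply/orP; left; lra.
- by exists d2 => // u /H2; rewrite ltr_norml !le_max => h; apply/orP; right; apply/orP; right; lra.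
- by rewrite le_max lexx.
Qed.

End Subdivision.

Section StandingFacts.
Context {R : realType}.
Notation mu := (@lebesgue_measure R).
Variables (p s : R) (g d h : R -> R) (r q : nat) (m k : nat -> R).
Implicit Types t : R.
Hypothesis hp : 1 < p.
Hypothesis hs : 0 < s < 1.
Hypothesis hg : standing_g s g.
Hypothesis hd : standing_d p g d r m.
Hypothesis hh : standing_h s h q k.

Local Notation alpha := ((p - 1)^-1).
Definition weighted_reaction (t : R) := d t `^ alpha * g t.
Local Notation f := weighted_reaction.
Local Notation ms := (interior_nodes r m).
Local Notation ks := (interior_nodes q k).

Lemma alpha_gt0 : 0 < alpha.
Proof. by rewrite invr_gt0 subr_gt0. Qed.

Lemma d_gt0 t : 0 < t < 1 -> 0 < d t.
Proof. by move=> t01; have [[_ H] _ _ _ _] := hd; apply: H; rewrite in_itv. Qed.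

Lemma g_continuous_at t : 0 < t < 1 -> {for t, continuous g}.
Proof. by move=> t01; have [gc _ _ _] := hg; exact: within_itv_interior gc t01. Qed.

Lemma d_continuous_at t : 0 < t < 1 -> t \notin ms -> {for t, continuous d}.
Proof. by move=> t01 tm; have [_ _ H _ _] := hd; exact: piecewise_continuous_at H t01 tm. Qed.

(** Lower semicontinuity keeps [d] away from [0] near its jumps, so that its
    one-sided limits are positive there. *)
Lemma d_near_lower t : 0 < t < 1 -> exists2 l, 0 < l & \forall u \near t, l <= d u.
Proof.
move=> t01; have dt := d_gt0 t01; exists (d t / 2); first lra.
have t_in : (`[0, 1]%classic : set R)^° t.
  by apply: filterS (unit_interval_near t01) => u /=; rewrite in_itv /=; lra.
have [_ lsc _ _ _] := hd.
have dt2 : ((d t / 2)%:E < (EFin \o d) t)%E by rewrite /= lte_fin; lra.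
have [V + HV] := lsc t _ dt2.
rewrite -(nbhs_subspace_interior t_in); apply: filterS => u /HV.
by rewrite /= lte_fin => /ltW.
Qed.

Lemma d_right_limit t : 0 < t < 1 -> exists2 l : R, 0 < l & d u @[u --> t^'+] --> l.
Proof.
move=> t01; have [_ _ dp _ _] := hd.
have [l Hl] := piecewise_right_limit dp t01; exists l => //.
have [c c0 Hc] := d_near_lower t01; apply: lt_le_trans c0 _.
by apply: (cvgr_to_ge Hl); exact: cvg_within Hc.
Qed.

Lemma d_left_limit t : 0 < t < 1 -> exists2 l : R, 0 < l & d u @[u --> t^'-] --> l.
Proof.
move=> t01; have [_ _ dp _ _] := hd.
have [l Hl] := piecewise_left_limit dp t01; exists l => //.
have [c c0 Hc] := d_near_lower t01; apply: lt_le_trans c0 _.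
by apply: (cvgr_to_ge Hl); exact: cvg_within Hc.
Qed.

Lemma d_segment_upper x y : 0 < x -> y < 1 ->
  exists2 K, 0 < K & forall t, x <= t <= y -> d t <= K.
Proof.
move=> x0 y1; have [_ _ dp _ _] := hd.
apply: locally_bounded_segment => t txy; apply: (piecewise_bounded_near dp); lra.
Qed.

Lemma reaction_continuous_at t : 0 < t < 1 -> t \notin ms -> {for t, continuous f}.
Proof.
move=> t01 tm; apply: continuousM; last exact: g_continuous_at.
apply: (@continuous_comp _ _ _ d (fun x => x `^ alpha)); first exact: d_continuous_at.
by apply: powR_continuous_at; exact: d_gt0.
Qed.

Lemma reaction_integrable : mu.-integrable `[0, 1] (EFin \o f).
Proof. by have [_ _ _ H _] := hd; apply: integrable_oo_cc. Qed.

(** Used with [sg = - 1] on the left of [s] and [sg = 1] on its right. *)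
Lemma reaction_lower (sg x y : R) : 0 < x -> y < 1 ->
  (forall t, x <= t <= y -> 0 < sg * g t) ->
  exists2 c : R, 0 < c & forall t, x <= t <= y -> c <= sg * f t.
Proof.
move=> x0 y1 Hg; have a0 := alpha_gt0.
have fE t : sg * f t = d t `^ alpha * (sg * g t) by rewrite /f; ring.
have [|K K0 HK] := @locally_bounded_segment _ (fun t => (sg * f t)^-1) x y.
  move=> t txy; have t01 : 0 < t < 1 by lra.
  have [c c0 Hc] := d_near_lower t01.
  have gt := Hg t txy.
  have : {for t, continuous (fun u => sg * g u)}.
    by apply: continuousM; [exact: cst_continuous|exact: g_continuous_at].
  move=> /for_contP /(_ (sg * g t / 2) ltac:(lra)) [e e0 He].
  exists (c `^ alpha * (sg * g t / 2))^-1.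
  have He' : \forall u \near t, `|u - t| < e.
    by apply/nbhs_ballP; exists e => // u; rewrite /ball /= distrC.
  near=> u.
  have cu : c <= d u by near: u.
  have : `|u - t| < e by near: u.
  move=> /He; rewrite ltr_norml => gu.
  have gu' : sg * g t / 2 <= sg * g u by lra.
  have gt2 : 0 < sg * g t / 2 by lra.
  have ca : 0 < c `^ alpha by exact: powR_gt0.
  have du : c `^ alpha <= d u `^ alpha.
    by apply: ge0_ler_powR; rewrite ?nnegrE ?(ltW a0) // ltW // (lt_le_trans c0).
  rewrite fE lef_pV2 ?posrE.
  - by apply: ler_pM => //; exact: ltW.
  - by apply: mulr_gt0; [exact: lt_le_trans du|exact: lt_le_trans gu'].
  - exact: mulr_gt0.
exists K^-1; first by rewrite invr_gt0.
move=> t txy; have t01 : 0 < t < 1 by lra.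
have ft : 0 < sg * f t by rewrite fE; apply: mulr_gt0; [exact/powR_gt0/d_gt0|exact: Hg].
by rewrite -[X in _ <= X]invrK lef_pV2 ?posrE ?invr_gt0 // HK.
Unshelve. all: by end_near. Qed.

Lemma reaction_neg_lower (x y : R) : 0 < x -> x <= y -> y < s ->
  exists2 c : R, 0 < c & forall t, x <= t <= y -> c <= - f t.
Proof.
move=> x0 xy ys; have [_ _ gn _] := hg; have s1 := hs.
have [||c c0 Hc] := @reaction_lower (- 1) x y x0; first by lra.
  move=> t txy; rewrite mulN1r oppr_gt0; apply: gn; rewrite in_itv /=; lra.
by exists c => // t /Hc; rewrite mulN1r.
Qed.

Lemma reaction_pos_lower (x y : R) : s < x -> x <= y -> y < 1 ->
  exists2 c : R, 0 < c & forall t, x <= t <= y -> c <= f t.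
Proof.
move=> sx xy y1; have [_ _ _ gp] := hg; have s1 := hs.
have [||c c0 Hc] := @reaction_lower 1 x y _ y1; first lra.
  move=> t txy; rewrite mul1r; apply: gp; rewrite in_itv /=; lra.
by exists c => // t /Hc; rewrite mul1r.
Qed.

Lemma reaction_cvg0 : f t @[t --> s] --> (0 : R).
Proof.
have a0 := alpha_gt0; have [_ _ dp _ _] := hd; have [_ [_ gs _] _ _] := hg.
have [K0 HK0] := piecewise_bounded_near dp hs.
pose K := Num.max K0 1; have K1 : 0 < K by rewrite lt_max ltr01 orbT.
have HK : \forall u \near s, d u <= K.
  by apply: filterS HK0 => u uK; rewrite le_max uK.
have [c c0 Hc] := d_near_lower hs.
apply/cvgrPdist_lt => e e0.
have /cvgrPdist_lt/(_ (e / K `^ alpha)) := g_continuous_at hs.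
rewrite gs => /(_ ltac:(by rewrite divr_gt0 ?powR_gt0)) Hg.
near=> u.
rewrite sub0r normrN /f normrM (ger0_norm (powR_ge0 _ _)).
have du : d u `^ alpha <= K `^ alpha.
  apply: ge0_ler_powR; rewrite ?nnegrE ?(ltW a0) ?(ltW K1) //.
    by apply: le_trans (ltW c0) _; near: u.
  by near: u.
have : `|0 - g u| < e / K `^ alpha by near: u.
rewrite sub0r normrN ltr_pdivlMr ?powR_gt0 // mulrC; apply: le_lt_trans.
by rewrite ler_wpM2r.
Unshelve. all: by end_near. Qed.

Lemma h_bounded : exists H, forall t, 0 <= t <= 1 -> `|h t| <= H.
Proof.
have [[M [_ HM]] _ _] := hh; exists (M + 1) => t t01.
by apply: (HM (M + 1)); [lra|rewrite /= in_itv].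
Qed.

Lemma h_continuous_at t : 0 < t < 1 -> t \notin ks -> {for t, continuous h}.
Proof. by move=> t01 tk; have [_ _ H] := hh; exact: piecewise_continuous_at H t01 tk. Qed.

End StandingFacts.

(** * The wave speed *)

Section WaveSpeed.
Context {R : realType}.
Notation mu := (@lebesgue_measure R).
Variables (p s : R) (g d h : R -> R) (r q : nat) (m k : nat -> R).
Implicit Types (c t x y : R) (w v : R -> R).
Hypothesis hp : 1 < p.
Hypothesis hs : 0 < s < 1.
Hypothesis hg : standing_g s g.
Hypothesis hd : standing_d p g d r m.
Hypothesis hh : standing_h s h q k.

Local Notation alpha := ((p - 1)^-1).
Local Notation f := (weighted_reaction p g d).
Local Notation ms := (interior_nodes r m).
Local Notation ks := (interior_nodes q k).

Definition wave_bvp c w := bvp_solution alpha (ms ++ ks) f h c w.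

Let a0 : 0 < alpha := alpha_gt0 hp.
Let s0 : 0 < s. Proof. by case/andP: hs. Qed.
Let s1 : s < 1. Proof. by case/andP: hs. Qed.
Let sE : s \in s :: ms ++ ks. Proof. exact: mem_head. Qed.

Let fc t : 0 < t < 1 -> t \notin s :: ms ++ ks -> {for t, continuous f}.
Proof.
move=> t01; rewrite inE mem_cat !negb_or => /and3P[_ tm _].
exact: (reaction_continuous_at hg hd).
Qed.

Let hc t : 0 < t < 1 -> t \notin s :: ms ++ ks -> {for t, continuous h}.
Proof.
move=> t01; rewrite inE mem_cat !negb_or => /and3P[_ _ tk].
exact: (h_continuous_at hh).
Qed.

Let fi := reaction_integrable hd.
Let f_neg := reaction_neg_lower hp hs hg hd.
Let f_pos := reaction_pos_lower hp hs hg hd.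
Let fs : f t @[t --> s^'-] --> (0 : R).
Proof. by apply: cvg_within_filter; exact: (reaction_cvg0 hp hs hg hd). Qed.

Lemma wave_bvp_weaken c w : wave_bvp c w -> bvp_solution alpha (s :: ms ++ ks) f h c w.
Proof.
move=> [wc w0 w1 wp wd]; split=> // t t01; rewrite inE negb_or => /andP[_ tE].
exact: wd.
Qed.

(** The two half problems are glued at [s], where the equation is recovered
    from its right-hand side being continuous there. *)
Lemma wave_bvp_strengthen c w : bvp_solution alpha (s :: ms ++ ks) f h c w -> wave_bvp c w.
Proof.
move=> [wc w0 w1 wp wd]; split=> // t t01 tE.
have [ts|ts] := eqVneq t s; last by apply: wd => //; rewrite inE negb_or ts.
rewrite {t t01}ts in tE *.
apply: (@is_derive_of_slopes _ w (s :: ms ++ ks)).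
  exists (Num.min s (1 - s)); first by rewrite lt_min s0 subr_gt0 s1.
  move=> y; rewrite lt_min !ltr_norml => /andP[? ?].
  by apply: (within_itv_interior wc); lra.
pose rhs t := c - h t - f t * w t `^ (- alpha).
have : {for s, continuous rhs}.
  apply: continuousB; first by apply: continuousB; [exact: cst_continuous|by have [_ ? _] := hh].
  apply: continuousM.
    by apply: (reaction_continuous_at hg hd hs); move: tE; rewrite mem_cat negb_or => /andP[].
  apply: (@continuous_comp _ _ _ w (fun x => x `^ (- alpha))).
    exact: within_itv_interior wc hs.
  by apply: powR_continuous_at; exact: wp.
move=> /for_contP H e e0; have [e' e'0 He] := H e e0.
exists (Num.min e' (Num.min s (1 - s))); first by rewrite !lt_min e'0 s0 subr_gt0 s1.
move=> t; rewrite !lt_min !ltr_norml => /and3P[te t1 t2] _ tE'.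
exists (rhs t); first by apply: wd => //; lra.
by apply/ltW/He; rewrite ltr_norml.
Qed.

Lemma wave_unique c v w : wave_bvp c v -> wave_bvp c w -> forall t, 0 <= t <= 1 -> v t = w t.
Proof.
move=> /wave_bvp_weaken vs /wave_bvp_weaken ws.
exact: (bvp_unique a0 s0 s1 f_neg f_pos vs ws).
Qed.

Lemma wave_speed_unique c c' v w : wave_bvp c v -> wave_bvp c' w -> c = c'.
Proof.
move=> /wave_bvp_weaken vs /wave_bvp_weaken ws.
exact: (bvp_speed_unique a0 s0 s1 f_neg f_pos fs vs ws).
Qed.

Lemma wave_exists :
  (exists2 t : R, 0 <= t <= 1 /\ t != s & oriented_integral (fun t => h s - h t) s t <= 0) ->
  exists c w, wave_bvp c w.
Proof.
move=> [x [x01 xs] Hx]; have [H HH] := h_bounded hh.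
have hH t : 0 < t < 1 -> `|h t| <= H by move=> t01; apply: HH; lra.
have hs' : {for s, continuous h} by have [_ ? _] := hh.
have [|c [w ws]] := bvp_exists a0 s0 s1 sE fc fi f_neg f_pos hH hc hs'; last first.
  by exists c, w; exact: wave_bvp_strengthen.
pose a t := h s - h t.
have ac t : 0 < t < 1 -> t \notin s :: ms ++ ks -> {for t, continuous a}.
  by move=> t01 tE; apply: continuousB; [exact: cst_continuous|exact: hc].
have ai : mu.-integrable `[0, 1] (EFin \o a).
  apply: (@integrable_bounded_off_finite _ _ (s :: ms ++ ks) _ _ (H + H)) => // t t01.
  by apply: le_trans (ler_normB _ _) _; rewrite lerD ?hH.
have [Ac Ad] := antiderivative ltr01 ai ac.
exists x, (oriented_integral a 0); split=> //.
have s01 : 0 <= s <= 1 by rewrite !ltW.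
by move: Hx; rewrite (oriented_integral_diff s01 x01 ai ac Ac Ad) subr_le0.
Qed.

(** The left-hand side is least for [z ^ p' = y * alpha], and its minimum is
    the right-hand side. *)
Lemma barrier_constant (p' y : R) : p^-1 + p'^-1 = 1 -> 0 < y ->
  exists2 z, 0 < z & z + y * z `^ (- alpha) = p' `^ p'^-1 * p `^ p^-1 * y `^ p'^-1.
Proof.
move=> pp y0.
have p0 : 0 < p by apply: lt_trans hp.
have p'V : p'^-1 = (p - 1) / p by move: pp => /(canRL (addKr _)) ->; field; rewrite gt_eqF.
have p'E : p' = p / (p - 1) by rewrite -[LHS]invrK p'V invf_div.
have p'0 : 0 < p' by rewrite p'E divr_gt0 // subr_gt0.
have aE : alpha = p' / p by rewrite p'E; field; rewrite !gt_eqF // subr_gt0.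
exists ((y * alpha) `^ p'^-1); first by rewrite powR_gt0 // mulr_gt0.
have ya : 0 < y * alpha by rewrite mulr_gt0.
have -> : y * ((y * alpha) `^ p'^-1) `^ (- alpha) = (y * alpha) `^ p'^-1 / alpha.
  rewrite -powRrM.
  have -> : p'^-1 * - alpha = p'^-1 - 1.
    by rewrite p'V; field; rewrite !gt_eqF // subr_gt0.
  rewrite -[in RHS](mulr_powRB1 (ltW ya)) ?invr_gt0 //.
  by field; rewrite gt_eqF ?subr_gt0.
rewrite (powRM _ (ltW y0) (ltW a0)).
have -> : alpha `^ p'^-1 = p' `^ p'^-1 * p `^ p^-1 / p.
  have ip : 0 <= p^-1 by rewrite invr_ge0 ltW.
  rewrite aE (powRM _ (ltW p'0) ip) -mulrA; congr (_ * _).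
  have -> : p^-1 `^ p'^-1 = p `^ (- p'^-1).
    by rewrite -[X in X `^ _ = _](powR_inv1 (ltW p0)) -powRrM mulN1r.
  have -> : - p'^-1 = p^-1 - 1 by rewrite -pp; ring.
  by rewrite powRB ?powRr1 ?(ltW p0) //; apply/implyP => _; rewrite gt_eqF.
by field; rewrite !gt_eqF ?subr_gt0.
Qed.

Lemma wave_speed_lower (p' c y hm : R) w : p^-1 + p'^-1 = 1 -> 0 < y -> wave_bvp c w ->
  (forall t, 0 < t < s -> hm <= h t) ->
  (forall t, 0 < t < s -> - f t <= y * (s - t) `^ alpha) ->
  hm - p' `^ p'^-1 * p `^ p^-1 * y `^ p'^-1 < c.
Proof.
move=> pp y0 /wave_bvp_weaken ws hhm fy; rewrite ltNge; apply/negP => cle.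
have [z z0 zE] := barrier_constant pp y0.
have ws' := bvp_left s1 ws.
have zc : z + y * z `^ (- alpha) <= hm - c by rewrite zE; lra.
have := half_end_eq0 a0 s0 f_neg ws' z0 hhm fy zc.
by have [_ _ _ wp _] := ws; have := wp s hs; lra.
Qed.

Lemma wave_speed_upper (p' c y hM : R) w : p^-1 + p'^-1 = 1 -> 0 < y -> wave_bvp c w ->
  (forall t, s < t < 1 -> h t <= hM) ->
  (forall t, s < t < 1 -> f t <= y * (t - s) `^ alpha) ->
  c < hM + p' `^ p'^-1 * p `^ p^-1 * y `^ p'^-1.
Proof.
move=> pp y0 /wave_bvp_weaken ws hhM fy; rewrite ltNge; apply/negP => cle.
have [z z0 zE] := barrier_constant pp y0.
have ws' := bvp_right s0 ws.
have zc : z + y * z `^ (- alpha) <= - hM - (- c) by rewrite zE; lra.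
have s1' : 0 < 1 - s by rewrite subr_gt0.
have lb x y' : 0 < x -> x <= y' -> y' < 1 - s ->
    exists2 k : R, 0 < k & forall t, x <= t <= y' -> k <= f (1 - t).
  move=> x0 xy ys; have [|||k0 k00 Hk] := @f_pos (1 - y') (1 - x); try lra.
  by exists k0 => // t txy; apply: Hk; lra.
have hhM' t : 0 < t < 1 - s -> - hM <= - h (1 - t) by move=> ts; rewrite lerN2; apply: hhM; lra.
have fy' t : 0 < t < 1 - s -> f (1 - t) <= y * (1 - s - t) `^ alpha.
  by move=> ts; have -> : 1 - s - t = 1 - t - s by [ring]; apply: fy; lra.
have := half_end_eq0 a0 s1' lb ws' z0 hhM' fy' zc.
by rewrite subKr; have [_ _ _ wp _] := ws; have := wp s hs; lra.
Qed.

End WaveSpeed.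

(** * Level sets and fluxes *)

Section SetsOfLevels.
Context {R : realType}.
Implicit Types (U f : R -> R) (z t : R) (E : seq R).

Lemma seq_isolated E t : exists2 e, 0 < e & forall u, u != t -> `|u - t| < e -> u \notin E.
Proof.
elim: E => [|x E [e e0 He]]; first by exists 1.
have [->|xt] := eqVneq x t.
  by exists e => // u ut ue; rewrite inE negb_or ut He.
exists (Num.min e `|x - t|); first by rewrite lt_min e0 normr_gt0 subr_eq0.
move=> u ut; rewrite lt_min => /andP[ue ux]; rewrite inE negb_or He // andbT.
by apply: contraTneq ux => ->; rewrite ltxx.
Qed.

Lemma M_setP r m U z : M_set r m U z <-> U z \in interior_nodes r m.
Proof. by split=> [H|/interior_nodesP]; [apply/interior_nodesP|]. Qed.

Lemma K_setP q k U z : K_set q k U z <-> U z \in interior_nodes q k.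
Proof. by split=> [H|/interior_nodesP]; [apply/interior_nodesP|]. Qed.

Lemma level_near U E z : {for z, continuous U} -> U z \notin E -> \forall y \near z, U y \notin E.
Proof.
move=> Uc zE; have [e e0 He] := seq_isolated E (U z).
have /for_contP/(_ e e0)[d d0 Hd] := Uc.
apply/nbhs_ballP; exists d => // y; rewrite /ball /= distrC => /Hd yz.
by have [->//|ne] := eqVneq (U y) (U z); exact: He.
Qed.

Lemma M_set_closed r m U : continuous U -> closed (M_set r m U).
Proof.
move=> Uc z; apply: contraPP => /M_setP/negP zM; rewrite /closure /=.
move=> /(_ _ (level_near (Uc z) zM))[y []] /M_setP yM /=.
by rewrite yM.
Qed.

Lemma N_setP U z : N_set U z <-> U z \in [:: 0; 1].
Proof.
rewrite !inE; split=> [[] ->|/orP[]/eqP]; rewrite ?eqxx ?orbT //.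
  by left.
by right.
Qed.

Lemma N_set_closed U : continuous U -> closed (N_set U).
Proof.
move=> Uc z; apply: contraPP => /N_setP/negP zM; rewrite /closure /=.
move=> /(_ _ (level_near (Uc z) zM))[y []] /N_setP yM /=.
by rewrite yM.
Qed.

Lemma unit_level_near U z : {for z, continuous U} -> 0 < U z < 1 ->
  \forall y \near z, 0 < U y < 1.
Proof. by move=> Uc /unit_interval_near; exact: Uc. Qed.

(** Levels in [(0, 1)] are single points, so that [M_U] has empty interior. *)
Lemma boundary_M_set r m U z : continuous U ->
  (forall x y : R, 0 < U x < 1 -> 0 < U y < 1 -> x < y -> U y < U x) ->
  0 < U z < 1 -> M_set r m U z -> boundary (M_set r m U) z.
Proof.
move=> Uc Uinj u01 Mz; split; first exact: subset_closure.
rewrite /interior /= => Mn; have [e e0 He] := seq_isolated (interior_nodes r m) (U z).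
have /for_contP/(_ _ e0)[e1 e10 He1] := Uc z.
have Mn' : \forall y \near z, M_set r m U y /\ 0 < U y < 1.
  by apply: filterS2 Mn (unit_level_near (Uc z) u01) => y; split.
have [e2 /= e20 He2] := (nbhs_ballP _ _).1 Mn'.
pose y := z + Num.min e1 e2 / 2.
have [zy ye1 ye2] : [/\ z < y, y - z < e1 & y - z < e2].
  by rewrite /y /Num.min; case: ifP => ?; split; lra.
have yz0 : 0 <= y - z by lra.
have [My uy] : M_set r m U y /\ 0 < U y < 1 by apply: He2; rewrite /ball /= distrC ger0_norm.
have Uy : `|U y - U z| < e by apply: He1; rewrite ger0_norm.
have Uyz : U y < U z by exact: Uinj.
have := He (U y); rewrite (lt_eqF Uyz) => /(_ isT Uy) /negP; apply.
exact/M_setP.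
Qed.

(** A continuous function cannot jump between the values [0] and [1]. *)
Lemma locally_constant U z : {for z, continuous U} -> (\forall y \near z, N_set U y) ->
  \forall y \near z, U y = U z.
Proof.
move=> Uc Nn; have Nz := nbhs_singleton Nn.
have /for_contP/(_ 1 ltr01)[d d0 Hd] := Uc.
have Hn : \forall y \near z, `|y - z| < d.
  by apply/nbhs_ballP; exists d => // y; rewrite /ball /= distrC.
near=> y; have Ny : N_set U y by near: y.
have : `|y - z| < d by near: y.
move=> /Hd; rewrite ltr_norml; case: Ny Nz => -> [] ->; lra.
Unshelve. all: by end_near. Qed.

Lemma locally_constant_derive U z : {for z, continuous U} -> (\forall y \near z, N_set U y) ->
  \forall y \near z, is_derive y (1 : R) U 0.
Proof.
move=> Uc /(locally_constant Uc)/near_join; apply: filterS => y yn.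
apply: (near_eq_is_derive (f := cst (U z))).
by move: yn; apply: filterS => x ->.
Qed.

Lemma is_derive_derive1 U z l : is_derive z (1 : R) U l -> derive1 U z = l.
Proof. by move=> H; rewrite derive1E derive_val. Qed.

Lemma is_derive_derivable U z l : is_derive z (1 : R) U l -> derivable U z 1.
Proof. by case. Qed.

Lemma signed_pow_powR (p x : R) : 1 < p -> 0 < x ->
  signed_pow p (- (x `^ (p - 1)^-1)) = - x.
Proof.
move=> hp x0; rewrite /signed_pow normrN (ger0_norm (powR_ge0 _ _)) mulrN mulrC.
have -> : p - 2 = p - 1 - 1 by ring.
rewrite mulr_powRB1 ?powR_ge0 ?subr_gt0 //.
by rewrite -powRrM mulVf ?powRr1 ?(ltW x0) // gt_eqF // subr_gt0.
Qed.

Lemma signed_pow_lt0 (p x : R) : signed_pow p x < 0 -> x < 0.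
Proof.
rewrite /signed_pow => h; rewrite ltNge; apply/negP => x0.
by have := mulr_ge0 (powR_ge0 `|x| (p - 2)) x0; lra.
Qed.

Lemma signed_pow_inv (p x v : R) : 1 < p -> 0 < v -> signed_pow p x = - v ->
  x = - (v `^ (p - 1)^-1).
Proof.
move=> hp v0 E; have x0 : x < 0 by apply: (@signed_pow_lt0 p); rewrite E; lra.
pose y := - x; have y0 : 0 < y by rewrite /y; lra.
have xE : x = - y by rewrite /y opprK.
move: E; rewrite xE /signed_pow normrN (gtr0_norm y0) mulrN => /oppr_inj <-.
have -> : p - 2 = p - 1 - 1 by ring.
rewrite mulrC mulr_powRB1 ?subr_gt0 // ?(ltW y0) //.
by rewrite -powRrM mulfV ?powRr1 ?(ltW y0) // gt_eqF // subr_gt0.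
Qed.

(** With [b = g], [y = d] and [x = w], this says that [f * w ^ (- alpha)]
    times the speed [(w / d) ^ alpha] is [g]. *)
Lemma reaction_balance (al x y b : R) : 0 < x -> 0 < y ->
  y `^ al * b * x `^ (- al) * (x / y) `^ al = b.
Proof.
move=> x0 y0; rewrite powRM ?invr_ge0 ?ltW // -(powR_inv1 (ltW y0)) -powRrM mulN1r !powRN.
by field; rewrite !gt_eqF // powR_gt0.
Qed.

Lemma derive1_le0 U z : nonincreasing_fun U -> derivable U z 1 -> derive1 U z <= 0.
Proof.
move=> Un Ud; rewrite derive1E; apply: (cvgr_to_le Ud).
near=> e; have e0 : e != 0 by near: e; exact: nbhs_dnbhs_neq.
rewrite /GRing.scale /= mulr1; have [en|ep|ee] := ltgtP e 0; last by rewrite ee eqxx in e0.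
  by apply: mulr_le0_ge0; [rewrite invr_le0 ltW|rewrite subr_ge0; apply: Un; lra].
by apply: mulr_ge0_le0; [rewrite invr_ge0 ltW|rewrite subr_le0; apply: Un; lra].
Unshelve. all: by end_near. Qed.

Lemma left_derivative_le0 U z : nonincreasing_fun U -> left_derivable U z ->
  left_derivative U z <= 0.
Proof.
move=> Un Ud; apply: (cvgr_to_le Ud).
near=> e; have en : e < 0 by near: e; exact: nbhs_left_lt.
by apply: mulr_le0_ge0; [rewrite invr_le0 ltW|rewrite subr_ge0; apply: Un; lra].
Unshelve. all: by end_near. Qed.

(** A description of the limit that does not distinguish finite and infinite
    ends. *)
Lemma cvg_left_endP f (z0 : \bar R) l : z0 != +oo%E ->
  cvg_left_end f z0 l <->
  forall e, 0 < e -> exists2 a : R, (z0 < a%:E)%E & forall z, (z0 < z%:E)%E -> z < a -> `|f z - l| < e.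
Proof.
case: z0 => [z0| |] //= _.
  rewrite at_rightP; split=> H e /H.
    by move=> [d d0 Hd]; exists (z0 + d); [rewrite lte_fin; lra|move=> z; rewrite lte_fin => ? ?; apply: Hd; lra].
  move=> [a]; rewrite lte_fin => az Ha; exists (a - z0); first lra.
  by move=> z h; apply: Ha; rewrite ?lte_fin; lra.
split.
  move=> /cvgrPdist_lt H e /H [a [_ Ha]]; exists a; first exact: ltNyr.
  by move=> z _ za; rewrite distrC; apply: Ha.
move=> H; apply/cvgrPdist_lt => e /H[a _ Ha]; exists a; split; first exact: num_real.
by move=> z za; rewrite distrC; apply: Ha => //; exact: ltNyr.
Qed.

Lemma cvg_right_endP f (z1 : \bar R) l : z1 != -oo%E ->
  cvg_right_end f z1 l <->
  forall e, 0 < e -> exists2 a : R, (a%:E < z1)%E & forall z, a < z -> (z%:E < z1)%E -> `|f z - l| < e.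
Proof.
case: z1 => [z1| |] //= _.
  rewrite at_leftP; split=> H e /H.
    by move=> [d d0 Hd]; exists (z1 - d); [rewrite lte_fin; lra|move=> z ?; rewrite lte_fin => ?; apply: Hd; lra].
  move=> [a]; rewrite lte_fin => az Ha; exists (z1 - a); first lra.
  by move=> z h; apply: Ha; rewrite ?lte_fin; lra.
split.
  move=> /cvgrPdist_lt H e /H [a [_ Ha]]; exists a; first exact: ltry.
  by move=> z za _; rewrite distrC; apply: Ha.
move=> H; apply/cvgrPdist_lt => e /H[a _ Ha]; exists a; split; first exact: num_real.
by move=> z za; rewrite distrC; apply: Ha => //; exact: ltry.
Qed.

End SetsOfLevels.

(** * From the boundary value problem to the profile *)

Section ProfileOfSolution.
Context {R : realType}.
Notation mu := (@lebesgue_measure R).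
Variables (p s : R) (g d h : R -> R) (r q : nat) (m k : nat -> R) (c : R) (w : R -> R).
Implicit Types (t x y z l : R).
Hypothesis hp : 1 < p.
Hypothesis hs : 0 < s < 1.
Hypothesis hg : standing_g s g.
Hypothesis hd : standing_d p g d r m.
Hypothesis hh : standing_h s h q k.
Hypothesis ws : wave_bvp p g d h r q m k c w.

Local Notation alpha := ((p - 1)^-1).
Local Notation f := (weighted_reaction p g d).
Local Notation ms := (interior_nodes r m).
Local Notation ks := (interior_nodes q k).

Let wc : {within `[0, 1], continuous w}. Proof. by have [] := ws. Qed.
Let w0 : w 0 = 0. Proof. by have [] := ws. Qed.
Let w1 : w 1 = 0. Proof. by have [] := ws. Qed.
Let wp t : 0 < t < 1 -> 0 < w t. Proof. by have [_ _ _ H _] := ws; apply: H. Qed.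
Let wd t : 0 < t < 1 -> t \notin ms -> t \notin ks ->
  is_derive t (1 : R) w (c - h t - f t * w t `^ (- alpha)).
Proof.
by have [_ _ _ _ H] := ws => t01 tm tk; apply: H => //; rewrite mem_cat negb_or tm.
Qed.
Let wc_at t : 0 < t < 1 -> {for t, continuous w}.
Proof. exact: within_itv_interior wc. Qed.
Let dpos t : 0 < t < 1 -> 0 < d t := d_gt0 hd (t := t).

(** [- profile_speed (U z)] is the slope [U'(z)]. *)
Definition profile_speed t := (w t / d t) `^ alpha.
Definition profile_time t := - oriented_integral (fun x => (d x / w x) `^ alpha) 2^-1 t.
Definition profile_of := extended_inverse profile_time.

Local Notation v := profile_speed.
Local Notation Z := profile_time.
Local Notation U := profile_of.

Lemma profile_speed_gt0 t : 0 < t < 1 -> 0 < v t.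
Proof. by move=> t01; rewrite powR_gt0 // divr_gt0 ?wp ?dpos. Qed.

Lemma profile_speedV t : 0 < t < 1 -> (d t / w t) `^ alpha = (v t)^-1.
Proof.
move=> t01; have wd0 : 0 <= w t / d t by rewrite ltW // divr_gt0 ?wp ?dpos.
by rewrite /v -powRN -[in LHS]invf_div -[X in X `^ _ = _](powR_inv1 wd0) -powRrM mulN1r.
Qed.

Lemma profile_speed_continuous t : 0 < t < 1 -> t \notin ms -> {for t, continuous v}.
Proof.
move=> t01 tm; apply: (@continuous_comp _ _ _ (fun x => w x / d x) (fun x => x `^ alpha)).
  apply: continuousM; first exact: wc_at.
  by apply: continuousV; [rewrite gt_eqF // dpos|exact: (d_continuous_at hd)].
by apply: powR_continuous_at; rewrite divr_gt0 ?wp ?dpos.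
Qed.

Lemma profile_time_at t : 0 < t < 1 -> {for t, continuous Z} /\
  (t \notin ms -> is_derive t (1 : R) Z (- (v t)^-1)).
Proof.
move=> t01.
have h01 : 0 < (2^-1 : R) < 1 by lra.
have rc x : 0 < x < 1 -> x \notin ms -> {for x, continuous (fun x => (d x / w x) `^ alpha)}.
  move=> x01 xm; apply: (@continuous_comp _ _ _ (fun x => d x / w x) (fun x => x `^ alpha)).
    apply: continuousM; first exact: (d_continuous_at hd).
    by apply: continuousV; [rewrite gt_eqF // wp|exact: wc_at].
  by apply: powR_continuous_at; rewrite divr_gt0 ?wp ?dpos.
have ri x y : 0 < x -> x <= y -> y < 1 ->
    mu.-integrable `[x, y] (EFin \o (fun x => (d x / w x) `^ alpha)).
  move=> x0; rewrite le_eqVlt => /predU1P[<- _|xy y1].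
    rewrite set_itv1; apply/integrableP; split; first exact: measurable_fun_set1.
    by rewrite integral_set1 ltry.
  have [K K0 HK] := d_segment_upper hd x0 y1.
  have wc' : {within `[x, y], continuous w} by apply: within_itv_sub wc; exact: ltW.
  have [x1 x1xy Hx1] := EVT_min (ltW xy) wc'.
  rewrite in_itv /= in x1xy.
  have w1p : 0 < w x1 by apply: wp; lra.
  apply: (@integrable_bounded_off_finite _ _ ms _ _ ((K / w x1) `^ alpha)) => //.
    by move=> u uxy um; apply: rc => //; lra.
  move=> u uxy; have u01 : 0 < u < 1 by lra.
  have uxy' : x <= u <= y by lra.
  rewrite ger0_norm ?powR_ge0 //; apply: ge0_ler_powR.
  - by rewrite ltW // (alpha_gt0 hp).
  - by rewrite nnegrE ltW // divr_gt0 ?wp ?dpos.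
  - by rewrite nnegrE ltW // divr_gt0.
  - apply: ler_pM; first by rewrite ltW // dpos.
    + by rewrite invr_ge0 ltW // wp.
    + exact: HK.
    + by have wu := wp u01; rewrite lef_pV2 ?posrE //; apply: Hx1; rewrite in_itv.
have [Ic Id] := open_antiderivative h01 ri rc t01.
split; first exact: continuousN.
move=> tm; rewrite -(profile_speedV t01).
by have := Id tm => ?; exact: is_deriveN.
Qed.

Lemma profile_time_half : Z 2^-1 = 0.
Proof. by rewrite /Z /oriented_integral lexx set_itv1 Rintegral_set1 oppr0. Qed.

Let Zc t : 0 < t < 1 -> {for t, continuous Z}.
Proof. by move=> /profile_time_at[]. Qed.

Lemma profile_time_decr t t' : 0 < t -> t < t' -> t' < 1 -> Z t' < Z t.
Proof.
move=> t0 tt t1; apply: (@lt_off_finite _ Z ms) => //.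
  by apply: within_of_for => x xt; apply: Zc; lra.
move=> x xt xm; have x01 : 0 < x < 1 by lra.
exists (- (v x)^-1); first by apply: (profile_time_at x01).2.
by rewrite oppr_lt0 invr_gt0 profile_speed_gt0.
Qed.

Let UK t : 0 < t < 1 -> U (Z t) = t := extended_inverseK profile_time_decr (t := t).
Let ZK z : 0 < U z < 1 -> Z (U z) = z := extended_inverseVK profile_time_decr Zc (z := z).
Let Uc : continuous U . Proof. exact: (extended_inverse_continuous profile_time_decr). Qed.
Let Un z z' : z <= z' -> U z' <= U z := extended_inverse_nincr Z (z := z) (z' := z').
Let U01 z : 0 <= U z <= 1 := extended_inverse01 Z z.

Let Ulocal z : 0 < U z < 1 -> \forall y \near z, 0 < U y < 1.
Proof. exact: unit_level_near (@Uc z). Qed.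

Let Uinj z z' : 0 < U z < 1 -> z < z' -> U z' < U z.
Proof.
move=> u01 zz; rewrite lt_neqAle Un ?(ltW zz) // andbT.
by apply: contraTneq zz => E; rewrite -(ZK u01) -E ZK ?E // ltxx.
Qed.

Lemma profile_is_derive z : 0 < U z < 1 -> U z \notin ms -> is_derive z (1 : R) U (- v (U z)).
Proof.
move=> u01 um; rewrite -{1}(ZK u01).
have -> : - v (U z) = (- (v (U z))^-1)^-1 by rewrite invrN invrK.
have near01 := unit_interval_near u01.
apply: is_derive_inverse.
- by apply: filterS near01 => t; exact: UK.
- by apply: filterS near01 => t; exact: Zc.
- by apply: (profile_time_at u01).2.
- by rewrite oppr_eq0 invr_eq0 gt_eqF // profile_speed_gt0.
Qed.

Lemma profile_flux z : 0 < U z < 1 -> U z \notin ms -> flux p d U z = - w (U z).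
Proof.
move=> u01 um; rewrite /flux (is_derive_derive1 (profile_is_derive u01 um)).
rewrite signed_pow_powR // ?divr_gt0 ?wp ?dpos //.
by field; rewrite gt_eqF // dpos.
Qed.

Let near_good z : 0 < U z < 1 -> U z \notin ms ->
  \forall y \near z, 0 < U y < 1 /\ U y \notin ms.
Proof.
move=> u01 um; have := Ulocal u01; have := level_near (@Uc z) um => h1 h2.
by near=> y; split; near: y.
Unshelve. all: by end_near. Qed.

(** On the left of [z] the profile lies above [U z], so the limit of [d] from
    the right is the relevant one. *)
Lemma profile_left z l : 0 < U z < 1 -> 0 < l -> d t @[t --> (U z)^'+] --> l ->
  [/\ d (U y) @[y --> z^'-] --> l,
      diff_quot U z e @[e --> 0^'-] --> - (w (U z) / l) `^ alpha &
      derive1 U y @[y --> z^'-] --> - (w (U z) / l) `^ alpha].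
Proof.
move=> u01 l0 dl; set V := - (w (U z) / l) `^ alpha.
have /for_contP Ucz := @Uc z.
have UtoR (P : R -> Prop) : (exists2 e, 0 < e & forall t, U z < t < U z + e -> P t) ->
    exists2 e, 0 < e & forall y, z - e < y < z -> 0 < U y < 1 /\ P (U y).
  move=> [e e0 He]; have [e' e'0 He'] := Ucz e e0.
  have [e2 e20 He2] := (nbhs_ballP _ _).1 (Ulocal u01).
  exists (Num.min e' e2); first by rewrite lt_min e'0.
  move=> y yz; have : z - y < Num.min e' e2 by lra.
  rewrite lt_min => /andP[y1 y2].
  have uy : 0 < U y < 1 by apply: He2; rewrite /ball /= ger0_norm; lra.
  split=> //; apply: He.
  have -> /= : U z < U y by apply: Uinj => //; lra.
  have := He' y; rewrite distrC ger0_norm; last lra.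
  by move=> /(_ y1); rewrite ltr_norml; lra.
have dl' : d (U y) @[y --> z^'-] --> l.
  apply/at_leftP => e e0; have [e' e'0 He] := UtoR _ ((at_rightP d _ l).1 dl e e0).
  by exists e' => // y /He[].
have vl : v t @[t --> (U z)^'+] --> - V.
  rewrite opprK; apply: (@cvg_comp _ _ _ (fun t => w t / d t) (fun x => x `^ alpha) _ (nbhs (w (U z) / l))).
    apply: cvgM; first by apply: cvg_within_filter; exact: wc_at.
    by apply: cvgV => //; rewrite gt_eqF.
  by apply: powR_continuous_at; rewrite divr_gt0 ?wp.
have key e : 0 < e -> exists2 d0, 0 < d0 & forall y, z - d0 < y < z ->
    exists2 l', is_derive y (1 : R) U l' & `|l' - V| < e.
  move=> e0; have [e1 e10 He1] := seq_isolated ms (U z).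
  have [e2 e20 He2] := (at_rightP v _ (- V)).1 vl e e0.
  have [|d0 d00 Hd0] := UtoR (fun t => t \notin ms /\ `|v t - - V| < e).
    exists (Num.min e1 e2); first by rewrite lt_min e10.
    move=> t /andP[ut]; rewrite -ltrBlDl lt_min => /andP[t1 t2]; split.
      by apply: He1; [rewrite gt_eqF|rewrite ger0_norm; lra].
    by apply: He2; lra.
  exists d0 => // y /Hd0[uy [um vy]]; exists (- v (U y)); first exact: profile_is_derive.
  by rewrite -normrN opprD !opprK; move: vy; rewrite opprK.
split=> //.
  apply: left_diff_quot_cvg; first by exists 1 => // y _; exact: @Uc.
  by move=> e /key[d0 d00 Hd0]; exists d0 => // y /Hd0[l' Hl' /ltW ?]; exists l'.
apply/at_leftP => e /key[d0 d00 Hd0]; exists d0 => // y /Hd0[l' Hl' ?].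
by rewrite (is_derive_derive1 Hl').
Qed.

Lemma profile_right z l : 0 < U z < 1 -> 0 < l -> d t @[t --> (U z)^'-] --> l ->
  [/\ d (U y) @[y --> z^'+] --> l,
      diff_quot U z e @[e --> 0^'+] --> - (w (U z) / l) `^ alpha &
      derive1 U y @[y --> z^'+] --> - (w (U z) / l) `^ alpha].
Proof.
move=> u01 l0 dl; set V := - (w (U z) / l) `^ alpha.
have /for_contP Ucz := @Uc z.
have UtoL (P : R -> Prop) : (exists2 e, 0 < e & forall t, U z - e < t < U z -> P t) ->
    exists2 e, 0 < e & forall y, z < y < z + e -> 0 < U y < 1 /\ P (U y).
  move=> [e e0 He]; have [e' e'0 He'] := Ucz e e0.
  have [e2 e20 He2] := (nbhs_ballP _ _).1 (Ulocal u01).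
  exists (Num.min e' e2); first by rewrite lt_min e'0.
  move=> y yz; have : y - z < Num.min e' e2 by lra.
  rewrite lt_min => /andP[y1 y2].
  have uy : 0 < U y < 1 by apply: He2; rewrite /ball /= distrC ger0_norm; lra.
  split=> //; apply: He.
  have uz : U y < U z by apply: Uinj => //; lra.
  have := He' y; rewrite ger0_norm; last lra.
  by move=> /(_ y1); rewrite ltr_norml; lra.
have dl' : d (U y) @[y --> z^'+] --> l.
  apply/at_rightP => e e0; have [e' e'0 He] := UtoL _ ((at_leftP d _ l).1 dl e e0).
  by exists e' => // y /He[].
have vl : v t @[t --> (U z)^'-] --> - V.
  rewrite opprK; apply: (@cvg_comp _ _ _ (fun t => w t / d t) (fun x => x `^ alpha) _ (nbhs (w (U z) / l))).
    apply: cvgM; first by apply: cvg_within_filter; exact: wc_at.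
    by apply: cvgV => //; rewrite gt_eqF.
  by apply: powR_continuous_at; rewrite divr_gt0 ?wp.
have key e : 0 < e -> exists2 d0, 0 < d0 & forall y, z < y < z + d0 ->
    exists2 l', is_derive y (1 : R) U l' & `|l' - V| < e.
  move=> e0; have [e1 e10 He1] := seq_isolated ms (U z).
  have [e2 e20 He2] := (at_leftP v _ (- V)).1 vl e e0.
  have [|d0 d00 Hd0] := UtoL (fun t => t \notin ms /\ `|v t - - V| < e).
    exists (Num.min e1 e2); first by rewrite lt_min e10.
    move=> t /andP[tu ut]; have : U z - t < Num.min e1 e2 by lra.
    rewrite lt_min => /andP[t1 t2]; split.
      by apply: He1; [rewrite lt_eqF|rewrite distrC ger0_norm; lra].
    by apply: He2; lra.
  exists d0 => // y /Hd0[uy [um vy]]; exists (- v (U y)); first exact: profile_is_derive.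
  by rewrite -normrN opprD !opprK; move: vy; rewrite opprK.
split=> //.
  apply: right_diff_quot_cvg; first by exists 1 => // y _; exact: @Uc.
  by move=> e /key[d0 d00 Hd0]; exists d0 => // y /Hd0[l' Hl' /ltW ?]; exists l'.
apply/at_rightP => e /key[d0 d00 Hd0]; exists d0 => // y /Hd0[l' Hl' ?].
by rewrite (is_derive_derive1 Hl').
Qed.

Lemma profile_one_sided z : 0 < U z < 1 ->
  [/\ left_derivable U z /\ left_derivative U z != 0,
      right_derivable U z /\ right_derivative U z != 0,
      flux_transmission p d U z, left_flux p d U z = - w (U z) &
      derive1 U y @[y --> z^'-] --> left_derivative U z /\
      derive1 U y @[y --> z^'+] --> right_derivative U z].
Proof.
move=> u01.
have [l1 l10 Hl1] := d_right_limit hd u01; have [l2 l20 Hl2] := d_left_limit hd u01.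
have [dl1 ql1 Dl1] := profile_left u01 l10 Hl1.
have [dl2 ql2 Dl2] := profile_right u01 l20 Hl2.
have E1 : left_derivative U z = - (w (U z) / l1) `^ alpha by exact: cvg_lim ql1.
have E2 : right_derivative U z = - (w (U z) / l2) `^ alpha by exact: cvg_lim ql2.
have F1 : left_flux p d U z = - w (U z).
  rewrite /left_flux E1 (cvg_lim _ dl1) // signed_pow_powR // ?divr_gt0 ?wp //.
  by field; rewrite gt_eqF.
have F2 : right_flux p d U z = - w (U z).
  rewrite /right_flux E2 (cvg_lim _ dl2) // signed_pow_powR // ?divr_gt0 ?wp //.
  by field; rewrite gt_eqF.
split.
- by split; [apply/cvg_ex; eexists; exact: ql1|rewrite E1 oppr_eq0 gt_eqF // powR_gt0 // divr_gt0 ?wp].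
- by split; [apply/cvg_ex; eexists; exact: ql2|rewrite E2 oppr_eq0 gt_eqF // powR_gt0 // divr_gt0 ?wp].
- split; [by apply/cvg_ex; eexists; exact: dl1|by apply/cvg_ex; eexists; exact: dl2|].
  by rewrite F1 F2.
- exact: F1.
- by rewrite E1 E2.
Qed.


Lemma profile_M z : M_set r m U z -> 0 < U z < 1.
Proof.
by have [_ _ [sm _ _] _ _] := hd; move=> [i hi ->]; exact: subdivision_in sm hi.
Qed.

Let Uc' : continuous U. Proof. exact: @Uc. Qed.

Lemma profile_boundary_M z : boundary (M_set r m U) z <-> M_set r m U z.
Proof.
split; first exact: boundary_closed (M_set_closed Uc').
move=> Mz; apply: boundary_M_set (profile_M Mz) Mz => // x y ux _; exact: Uinj.
Qed.

Lemma profile_outside z : ~ (0 < U z < 1) -> N_set U z.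
Proof.
move=> nU; have /andP[u0 u1] := U01 z.
move: u0; rewrite le_eqVlt => /predU1P[E|u0]; first by left.
move: u1; rewrite le_eqVlt => /predU1P[E|u1]; first by right.
by exfalso; apply: nU; rewrite u0.
Qed.

Lemma profile_rest z : ~ boundary (N_set U) z -> ~ (0 < U z < 1) ->
  \forall y \near z, N_set U y.
Proof. by move=> nb /profile_outside; exact: notin_boundary. Qed.

Lemma profile_wN z : N_set U z -> w (U z) = 0.
Proof. by case=> ->. Qed.

Lemma flux_rest z : (\forall y \near z, N_set U y) -> flux p d U z = 0.
Proof.
move=> /(locally_constant_derive (@Uc z))/nbhs_singleton/is_derive_derive1 E.
by rewrite /flux E /signed_pow mulr0 mulr0.
Qed.

Lemma profile_extended_flux z : extended_flux p d r m U z = - w (U z).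
Proof.
rewrite /extended_flux; case: ifPn => [/set_mem bN|/negP nbN].
  by rewrite profile_wN ?oppr0 //; exact: (boundary_closed (N_set_closed Uc')).
have {}nbN : ~ boundary (N_set U) z by move=> /mem_set.
case: ifPn => [/set_mem/profile_boundary_M/profile_M u01|/negP nbM].
  by have [_ _ _ -> _] := profile_one_sided u01.
have [u01|nu] := pselect (0 < U z < 1).
  apply: profile_flux => //; apply/negP => zM; apply: nbM; apply/mem_set/profile_boundary_M.
  exact/M_setP.
by rewrite flux_rest ?profile_wN ?oppr0 //; [exact: profile_outside|exact: profile_rest].
Qed.

Lemma profile_comp_continuous (F : R -> R) : {within `[0, 1], continuous F} ->
  continuous (F \o U).
Proof.
move=> /within_itvP Fc z; apply/for_contP => e e0.
have [d1 d10 H1] := Fc (U z) (U01 z) e e0.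
have /for_contP/(_ _ d10)[d2 d20 H2] := @Uc z.
by exists d2 => // y /H2 yz; rewrite distrC; apply: H1 => //; rewrite distrC.
Qed.

(** The ends, possibly infinite, of the interval where [0 < U < 1]. *)
Definition profile_start := ereal_inf [set (Z t)%:E | t in `]0, 1[].
Definition profile_end := ereal_sup [set (Z t)%:E | t in `]0, 1[].

Lemma profile_start_lt t : 0 < t < 1 -> (profile_start < (Z t)%:E)%E.
Proof.
move=> t01; have t' : 0 < (t + 1) / 2 < 1 by lra.
apply: (@le_lt_trans _ _ (Z ((t + 1) / 2))%:E).
  by apply: ereal_inf_lbound; exists ((t + 1) / 2) => //; rewrite /= in_itv.
by rewrite lte_fin; apply: profile_time_decr; lra.
Qed.

Lemma profile_end_gt t : 0 < t < 1 -> ((Z t)%:E < profile_end)%E.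
Proof.
move=> t01; have t' : 0 < t / 2 < 1 by lra.
apply: (@lt_le_trans _ _ (Z (t / 2))%:E); last first.
  by apply: ereal_sup_ubound; exists (t / 2) => //; rewrite /= in_itv.
by rewrite lte_fin; apply: profile_time_decr; lra.
Qed.

Lemma profile_start_ltP z : (profile_start < z%:E)%E -> exists2 t, 0 < t < 1 & Z t < z.
Proof.
by move=> /ereal_inf_lt[_ [t + <-]]; rewrite /= in_itv /= lte_fin => ? ?; exists t.
Qed.

Lemma profile_end_gtP z : (z%:E < profile_end)%E -> exists2 t, 0 < t < 1 & z < Z t.
Proof.
by move=> /ereal_sup_gt[_ [t + <-]]; rewrite /= in_itv /= lte_fin => ? ?; exists t.
Qed.

Lemma profile_insideP z : 0 < U z < 1 <-> (profile_start < z%:E < profile_end)%E.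
Proof.
split=> [u01|/andP[/profile_start_ltP[t t01 tz] /profile_end_gtP[t' t'01 tz']]].
  by rewrite -(ZK u01) profile_start_lt // profile_end_gt.
have := extended_inverse_ge t'01 (ltW tz'); have := extended_inverse_le profile_time_decr t01 tz.
rewrite -/U; lra.
Qed.

Lemma profile_before z : (z%:E <= profile_start)%E -> U z = 1.
Proof.
move=> zs; apply/eqP; rewrite eq_le; have /andP[_ ->] /= := U01 z.
apply/ler_addgt0Pr => e e0; pose t := Num.max (1 / 2) (1 - e / 2).
have [t01 te] : 0 < t < 1 /\ 1 - e < t.
  by rewrite /t /Num.max; case: ifP => ?; split; lra.
have zt : z <= Z t by rewrite -lee_fin; apply: le_trans zs _; exact/ltW/profile_start_lt.
by have := extended_inverse_ge t01 zt; rewrite -/U; lra.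
Qed.

Lemma profile_after z : (profile_end <= z%:E)%E -> U z = 0.
Proof.
move=> zs; apply/eqP; rewrite eq_le; have /andP[-> _] := U01 z; rewrite andbT.
apply/ler_addgt0Pr => e e0; pose t := Num.min (1 / 2) (e / 2).
have [t01 te] : 0 < t < 1 /\ t < e.
  by rewrite /t /Num.min; case: ifP => ?; split; lra.
have zt : Z t < z by rewrite -lte_fin; apply: lt_le_trans zs; exact/profile_end_gt.
by have := extended_inverse_le profile_time_decr t01 zt; rewrite -/U; lra.
Qed.

Lemma profile_cvgNy (F : R -> R) l : {within `[0, 1], continuous F} -> F 1 = l ->
  F (U z) @[z --> -oo] --> l.
Proof.
move=> /within_itvP Fc <-; apply/cvgrPdist_lt => e e0.
have o01 : 0 <= (1 : R) <= 1 by rewrite lexx ler01.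
have [d1 d10 H1] := Fc 1 o01 e e0.
pose t := Num.max (1 / 2) (1 - d1 / 2).
have [t01 te] : 0 < t < 1 /\ 1 - d1 < t.
  by rewrite /t /Num.max; case: ifP => ?; split; lra.
exists (Z t); split; first exact: num_real.
move=> z zt; apply: H1 => //; have /andP[_ u1] := U01 z.
have := extended_inverse_ge t01 (ltW zt); rewrite -/U => hU.
by rewrite ger0_norm ?subr_ge0 //; lra.
Qed.

Lemma profile_cvgy (F : R -> R) l : {within `[0, 1], continuous F} -> F 0 = l ->
  F (U z) @[z --> +oo] --> l.
Proof.
move=> /within_itvP Fc <-; apply/cvgrPdist_lt => e e0.
have o01 : 0 <= (0 : R) <= 1 by rewrite lexx ler01.
have [d1 d10 H1] := Fc 0 o01 e e0.
pose t := Num.min (1 / 2) (d1 / 2).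
have [t01 te] : 0 < t < 1 /\ t < d1.
  by rewrite /t /Num.min; case: ifP => ?; split; lra.
exists (Z t); split; first exact: num_real.
move=> z zt; apply: H1 => //; have /andP[u0 _] := U01 z.
have := extended_inverse_le profile_time_decr t01 zt; rewrite -/U => hU.
by rewrite sub0r normrN ger0_norm //; lra.
Qed.

Lemma profile_reaction_balance t : 0 < t < 1 -> f t * w t `^ (- alpha) * v t = g t.
Proof.
by move=> t01; apply: reaction_balance; [exact: wp|exact: dpos].
Qed.

(** Along the profile, the flux equation is the equation for [w] multiplied
    by [U'], which gives the integrated form. *)
Lemma profile_identity z z' :
  w (U z) - w (U z') + c * (U z' - U z) - (H_prim h (U z') - H_prim h (U z))
    + oriented_integral (g \o U) z z' = 0.
Proof.
have [H HH] := h_bounded hh.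
have hc' t : 0 < t < 1 -> t \notin ks -> {for t, continuous h} by exact: (h_continuous_at hh).
have hi : mu.-integrable `[0, 1] (EFin \o h).
  apply: (@integrable_bounded_off_finite _ h ks _ _ H) => // t /andP[t0 t1].
  by apply: HH; rewrite !ltW.
have [Hc Hd] := antiderivative ltr01 hi hc'.
rewrite -/(H_prim h) in Hc Hd.
have gUc : continuous (g \o U) by apply: profile_comp_continuous; have [] := hg.
pose Psi := fun y => w (U y) - c * U y + H_prim h (U y).
have Psic : continuous Psi.
  move=> y; apply: cvgD; last exact: (profile_comp_continuous Hc).
  apply: cvgB; first exact: (profile_comp_continuous wc).
  by apply: cvgM; [exact: cvg_cst|exact: @Uc].
pose E := map Z (ms ++ ks) ++ [:: fine profile_start; fine profile_end].
(* The last two points of [E] only matter if the ends are finite. *)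
have Psid t : t \notin E -> is_derive t (1 : R) Psi (g (U t)).
  rewrite mem_cat negb_or => /andP[tZ tends].
  have [u01|nu] := pselect (0 < U t < 1).
    have := tZ; rewrite -{1}(ZK u01) => uE.
    have {uE} : U t \notin ms ++ ks by apply: contra uE; exact: map_f.
    rewrite mem_cat negb_or => /andP[um uk].
    have Ud := profile_is_derive u01 um.
    have D1 := @is_derive1_comp _ w U t _ _ (wd u01 um uk) Ud.
    have D2 := @is_derive1_comp _ (H_prim h) U t _ _ (Hd _ u01 uk) Ud.
    have D3 : is_derive t (1 : R) (fun y => c * U y) (c * - v (U t)) by exact: is_deriveZ.
    have D := is_deriveD (is_deriveB D1 D3) D2.
    apply: (is_derive_eq D); rewrite -(profile_reaction_balance u01); ring.
  have Nn : \forall y \near t, N_set U y.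
    apply: (profile_rest _ nu) => bN; move: tends; rewrite !inE negb_or => /andP[ts te].
    case: bN => _; apply.
    have ni : ~ (profile_start < t%:E < profile_end)%E by move=> /profile_insideP; exact: nu.
    have s0' : (profile_start < 0%:E)%E.
      by rewrite -profile_time_half; apply: profile_start_lt; lra.
    have e0' : (0%:E < profile_end)%E.
      by rewrite -profile_time_half; apply: profile_end_gt; lra.
    have [t0|t0] := ltP t 0.
      have tS : (t%:E <= profile_start)%E.
        rewrite leNgt; apply/negP => h0; apply: ni; rewrite h0 /=.
        by apply: lt_trans e0'; rewrite lte_fin.
      case E0 : profile_start tS s0' ts => [a| |] //=.
      rewrite lee_fin => ta _ tne.
      have ta' : t < a by rewrite lt_neqAle tne.
      have : \forall y \near t, y < a by exact: lt_nbhsl.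
      by apply: filterS => y ya; right; apply: profile_before; rewrite E0 lee_fin ltW.
    have tS : (profile_end <= t%:E)%E.
      rewrite leNgt; apply/negP => h0; apply: ni; rewrite h0 andbT.
      by apply: lt_le_trans s0' _; rewrite lee_fin.
    case E0 : profile_end tS e0' te => [a| |] //=.
    rewrite lee_fin => ta _ tne.
    have ta' : a < t by rewrite lt_neqAle eq_sym tne.
    have : \forall y \near t, a < y by exact: lt_nbhsr.
    by apply: filterS => y ya; left; apply: profile_after; rewrite E0 lee_fin ltW.
  have Uk := locally_constant (@Uc t) Nn.
  have g0 : g (U t) = 0.
    by have [_ [g0 _ g1] _ _] := hg; have [] := profile_outside nu => ->.
  rewrite g0; apply: (near_eq_is_derive (f := cst (Psi t))).
  by apply: filterS Uk => y Uy; rewrite /Psi Uy.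
have -> : oriented_integral (g \o U) z z' = Psi z' - Psi z.
  have zz : Num.min z z' - 1 < Num.max z z' + 1.
    by rewrite /Num.min /Num.max; case: ifP => ?; lra.
  apply: (@oriented_integral_diff _ (g \o U) Psi E (Num.min z z' - 1) (Num.max z z' + 1)).
  - by rewrite /Num.min /Num.max; case: ifP => ?; lra.
  - by rewrite /Num.min /Num.max; case: ifP => ?; lra.
  - by apply: continuous_compact_integrable; [exact: segment_compact|exact: continuous_subspaceT].
  - by move=> t _ _; exact: gUc.
  - exact: continuous_subspaceT.
by rewrite /Psi; ring.
Qed.


Lemma profile_C1 z : 0 < U z < 1 -> U z \notin ms ->
  derivable U z 1 /\ {for z, continuous (derive1 U)}.
Proof.
move=> u01 um; split.
  exact: is_derive_derivable (profile_is_derive u01 um).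
have nE : {near z, (fun y => - v (U y)) =1 derive1 U}.
  apply: filterS (near_good u01 um) => y [yu ym].
  by rewrite (is_derive_derive1 (profile_is_derive yu ym)).
rewrite /prop_for /continuous_at (is_derive_derive1 (profile_is_derive u01 um)).
apply: cvg_trans; first exact: near_eq_cvg nE.
apply: cvgN; apply: (@continuous_comp _ _ _ U v); first exact: @Uc.
exact: profile_speed_continuous.
Qed.

Lemma profile_rest_C1 z : (\forall y \near z, N_set U y) ->
  derivable U z 1 /\ {for z, continuous (derive1 U)}.
Proof.
move=> Nn; have Dn := locally_constant_derive (@Uc z) Nn.
have Dz := nbhs_singleton Dn; split; first exact: is_derive_derivable Dz.
have nE : {near z, cst 0 =1 derive1 U}.
  by apply: filterS Dn => y yD; rewrite (is_derive_derive1 yD).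
rewrite /prop_for /continuous_at (is_derive_derive1 Dz).
by apply: cvg_trans; [exact: near_eq_cvg nE|exact: cvg_cst].
Qed.

Lemma profile_monotone_solution : monotone_solution p g d h r m c U.
Proof.
have DM z : ~ D_set r m U z -> 0 < U z < 1 -> U z \notin ms.
  by move=> nD u01; apply/negP => um; apply: nD; left; apply/profile_boundary_M/M_setP.
have fluxE : extended_flux p d r m U = (fun z => - w (U z)).
  by apply/funext => z; exact: profile_extended_flux.
split.
- by split; [right; exact: Un|exact: Uc'|exact: U01].
- split=> [z nD|z nD u01].
    have [u01|nu] := pselect (0 < U z < 1); first exact: profile_C1 (DM z nD u01).
    by apply/profile_rest_C1/(profile_rest _ nu) => bN; apply: nD; right.
  rewrite (is_derive_derive1 (profile_is_derive u01 (DM z nD u01))).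
  by rewrite oppr_eq0 gt_eqF // profile_speed_gt0.
- move=> z /profile_boundary_M/profile_M u01.
  by have [? ? ? _ _] := profile_one_sided u01; split.
- rewrite fluxE; split.
  + by move=> z; apply: continuousN; exact: (profile_comp_continuous wc).
  + by move=> z z'; rewrite opprK [- _ + w _]addrC; exact: profile_identity.
  + by rewrite -[X in _ --> X]oppr0; apply: cvgN; exact: profile_cvgNy.
  + by rewrite -[X in _ --> X]oppr0; apply: cvgN; exact: profile_cvgy.
Qed.

Lemma profile_is_profile : profile p g d h r m c U.
Proof.
split; first exact: profile_monotone_solution.
- by apply: (profile_cvgNy (F := id)) => //; exact: within_id.
- by apply: (profile_cvgy (F := id)) => //; exact: within_id.
Qed.

Lemma profile_half : U 0 = 2^-1.
Proof. by rewrite -profile_time_half; apply: UK; lra. Qed.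

Lemma profile_satisfies_i : satisfies_i U profile_start profile_end.
Proof.
split.
- split.
    by apply/profile_insideP; rewrite profile_half; lra.
  by apply/seteqP; split => z /profile_insideP.
- by move=> x y; rewrite inE /= => x01 _; exact: Uinj.
- exact: profile_half.
- by split; [exact: profile_before|exact: profile_after].
- move=> z /profile_insideP u01.
  by have [[? ?] [? ?] _ _ _] := profile_one_sided u01; split.
Qed.

(** [U] decreases, so the nodes appear in reverse order. *)
Definition profile_node i := Z (m (r.+1 - i)%N).

Let node_in i : (1 <= i <= r)%N -> 0 < m (r.+1 - i)%N < 1.
Proof.
move=> /andP[i1 ir]; have [_ _ [sm _ _] _ _] := hd; apply: (subdivision_in sm).
by rewrite subn_gt0 ltnS ir /= leq_subLR -addn1 addnC leq_add2r.
Qed.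

Let node_lt i j : (1 <= i)%N -> (i < j)%N -> (j <= r)%N -> profile_node i < profile_node j.
Proof.
move=> i1 ij jr; have [_ _ [sm _ _] _ _] := hd.
have /andP[? ?] : 0 < m (r.+1 - j)%N < 1 by apply: node_in; rewrite jr (leq_trans i1 (ltnW ij)).
have /andP[? ?] : 0 < m (r.+1 - i)%N < 1 by apply: node_in; rewrite i1 (leq_trans (ltnW ij) jr).
apply: profile_time_decr => //; apply: (subdivision_lt sm); last exact: leq_subr.
by rewrite ltn_sub2l // ltnS (leq_trans (ltnW ij) jr).
Qed.

Let node_le i j : (1 <= i)%N -> (i <= j)%N -> (j <= r)%N -> profile_node i <= profile_node j.
Proof.
move=> i1; rewrite leq_eqVlt => /predU1P[->//|ij] jr; exact/ltW/node_lt.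
Qed.

Let start_lt_end : (profile_start < profile_end)%E.
Proof.
have /andP[? ?] : (profile_start < 0%:E < profile_end)%E.
  by apply/profile_insideP; rewrite profile_half; lra.
exact: lt_trans (_ : _ < 0%:E)%E _.
Qed.

Let nodesE i : (1 <= i <= r)%N -> nodes r profile_start profile_end profile_node i = (profile_node i)%:E.
Proof.
move=> /andP[i1 ir]; rewrite /nodes gtn_eqF //.
by rewrite ltn_eqF // ltnS.
Qed.

Lemma profile_satisfies_ii : satisfies_ii r m U profile_start profile_end profile_node.
Proof.
have MU i : (1 <= i <= r)%N -> M_set r m U (profile_node i).
  move=> hi; exists (r.+1 - i)%N; last by rewrite /profile_node UK // node_in.
  by case/andP: hi => i1 ir; rewrite subn_gt0 ltnS ir /= leq_subLR -addn1 addnC leq_add2r.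
have n0 : nodes r profile_start profile_end profile_node 0 = profile_start by [].
have nr : nodes r profile_start profile_end profile_node r.+1 = profile_end.
  by rewrite /nodes /= eqxx.
have MN z : M_set r m U z -> exists2 i, (1 <= i <= r)%N & z = profile_node i.
  move=> /[dup] /profile_M u01 [j /andP[j1 jr] uj]; exists (r.+1 - j)%N.
    by rewrite subn_gt0 ltnS jr /= leq_subLR -addn1 addnC leq_add2r.
  by rewrite /profile_node subKn ?(leq_trans jr) // -uj ZK.
split.
- apply/seteqP; split=> z; first by move=> /MN[i hi ->]; exists i.
  by move=> [i hi <-]; exact: MU.
- move=> i ir; have [->|i0] := posnP i.
    rewrite n0; have [r0|r0] := posnP r; first by rewrite r0 in nr *; rewrite nr; exact: start_lt_end.
    by rewrite nodesE //; apply: profile_start_lt; exact: node_in.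
  rewrite nodesE ?i0 //; move: ir; rewrite leq_eqVlt => /predU1P[E|ir].
    rewrite E nr; apply: profile_end_gt; apply: node_in.
    by rewrite leqnn andbT -E.
  by rewrite nodesE ?ir // lte_fin node_lt.
- exact: Uc'.
- move=> i ir z /= /andP[zi zi1].
  have nge : (profile_start <= nodes r profile_start profile_end profile_node i)%E.
    have [->|i0] := posnP i; first by rewrite n0.
    by rewrite nodesE ?i0 //; apply/ltW/profile_start_lt/node_in; rewrite i0.
  have nle : (nodes r profile_start profile_end profile_node i.+1 <= profile_end)%E.
    move: (ir); rewrite leq_eqVlt => /predU1P[->|ir']; first by rewrite nr.
    by rewrite nodesE ?ir' //; apply/ltW/profile_end_gt/node_in; rewrite ir'.
  have u01 : 0 < U z < 1.
    by apply/profile_insideP; rewrite (le_lt_trans nge zi) (lt_le_trans zi1 nle).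
  apply: profile_C1 => //; apply/negP => /M_setP/MN[j /andP[j1 jr] zE].
  have [ji|ij] := leqP j i.
    have i0 : (0 < i)%N by exact: leq_trans ji.
    move: zi; rewrite nodesE ?i0 // lte_fin zE ltNge => /negP; apply.
    exact: node_le.
  have ir' : (i < r)%N by exact: leq_trans ij jr.
  move: zi1; rewrite nodesE ?ir' // lte_fin zE ltNge => /negP; apply.
  exact: node_le.
- move=> i hi; have /profile_M u01 := MU i hi.
  by have [[? _] [? _] _ _ [? ?]] := profile_one_sided u01; split.
Qed.

Lemma profile_satisfies_iii : satisfies_iii p d r U profile_start profile_end profile_node.
Proof.
have /andP[s0' e0'] : (profile_start < 0%:E < profile_end)%E.
  by apply/profile_insideP; rewrite profile_half; lra.
have [e0 e00 He0] := seq_isolated ms 0; have [e1 e10 He1] := seq_isolated ms 1.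
split.
- apply/cvg_left_endP; first by apply: contraTneq s0' => ->; rewrite ltNge leey.
  move=> e e_0; have [d1 d10 Hd1] := (within_itvP w 0 1).1 wc 1 ltac:(lra) e e_0.
  have [t [t01 td te]] : exists t, [/\ 0 < t < 1, 1 - t < d1 & 1 - t < e1].
    have [n0 nd ne] : [/\ 0 < Num.min d1 e1, Num.min d1 e1 <= d1 & Num.min d1 e1 <= e1].
      by rewrite lt_min d10 e10 !ge_min !lexx orbT.
    exists (Num.max (1 / 2) (1 - Num.min d1 e1 / 2)).
    move: n0 nd ne; move: (Num.min d1 e1) => n n0 nd ne.
    by rewrite /Num.max; case: ifP => ?; split; lra.
  exists (Z t); first exact: profile_start_lt.
  move=> z sz zt.
  have u01 : 0 < U z < 1.
    apply/profile_insideP; rewrite sz /=; apply: lt_trans (profile_end_gt t01).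
    by rewrite lte_fin.
  have tu := extended_inverse_ge t01 (ltW zt); rewrite -/U in tu.
  have um : U z \notin ms.
    apply: He1; first by have /andP[_ u1] := u01; rewrite lt_eqF.
    by rewrite distrC ger0_norm; lra.
  rewrite profile_flux // subr0 normrN -[w _]subr0 -w1 distrC; apply: Hd1; first lra.
  by rewrite ger0_norm; lra.
- apply/cvg_right_endP; first by apply: contraTneq e0' => ->; rewrite ltNge leNye.
  move=> e e_0; have [d1 d10 Hd1] := (within_itvP w 0 1).1 wc 0 ltac:(lra) e e_0.
  have [t [t01 td te]] : exists t, [/\ 0 < t < 1, t < d1 & t < e0].
    have [n0 nd ne] : [/\ 0 < Num.min d1 e0, Num.min d1 e0 <= d1 & Num.min d1 e0 <= e0].
      by rewrite lt_min d10 e00 !ge_min !lexx orbT.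
    exists (Num.min (1 / 2) (Num.min d1 e0 / 2)).
    move: n0 nd ne; move: (Num.min d1 e0) => n n0 nd ne.
    by rewrite /Num.min; case: ifP => ?; split; lra.
  exists (Z t); first exact: profile_end_gt.
  move=> z tz ze.
  have u01 : 0 < U z < 1.
    apply/profile_insideP; rewrite ze andbT; apply: lt_trans (profile_start_lt t01) _.
    by rewrite lte_fin.
  have tu := extended_inverse_le profile_time_decr t01 tz; rewrite -/U in tu.
  have um : U z \notin ms.
    apply: He0; first by have /andP[u0 _] := u01; rewrite gt_eqF.
    by rewrite subr0 ger0_norm; lra.
  rewrite profile_flux // subr0 normrN -[w _]subr0 -w0 distrC; apply: Hd1; first lra.
  by rewrite sub0r normrN ger0_norm; lra.
- move=> i hi; have [_ _ H _ _] := @profile_one_sided (profile_node i) ltac:(by rewrite /profile_node UK node_in).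
  exact: H.
Qed.

Lemma profile_satisfies_iv : satisfies_iv p g d h r q m k c U.
Proof.
move=> z nz.
have nM : U z \notin ms.
  by apply/negP => um; apply: nz; left; left; apply/profile_boundary_M/M_setP.
have nK : U z \notin ks by apply/negP => uk; apply: nz; left; right; apply/K_setP.
have [u01|nu] := pselect (0 < U z < 1).
  have Ud := profile_is_derive u01 nM.
  have D1 := @is_derive1_comp _ w U z _ _ (wd u01 nM nK) Ud.
  have nE : {near z, (fun y => - w (U y)) =1 flux p d U}.
    by apply: filterS (near_good u01 nM) => y [yu ym]; rewrite profile_flux.
  have D2 : is_derive z (1 : R) (flux p d U)
      (- ((c - h (U z) - f (U z) * w (U z) `^ (- alpha)) * - v (U z))).
    by apply: (near_eq_is_derive nE); exact: is_deriveN.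
  split; [exact: is_derive_derivable Ud|exact: is_derive_derivable D2|].
  rewrite (is_derive_derive1 Ud) (is_derive_derive1 D2) -[X in _ + X = 0](profile_reaction_balance u01).
  ring.
have Nn : \forall y \near z, N_set U y by apply: (profile_rest _ nu) => bN; apply: nz; right.
have Uz := nbhs_singleton (locally_constant_derive (@Uc z) Nn).
have nE : {near z, cst 0 =1 flux p d U}.
  by apply: filterS (near_join Nn) => y Ny; rewrite flux_rest.
have D2 : is_derive z (1 : R) (flux p d U) 0 by apply: (near_eq_is_derive nE).
have g0 : g (U z) = 0.
  by have [_ [g0 _ g1] _ _] := hg; have [] := profile_outside nu => ->.
split; [exact: is_derive_derivable Uz|exact: is_derive_derivable D2|].
by rewrite (is_derive_derive1 Uz) (is_derive_derive1 D2) g0 mulr0 !addr0.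
Qed.

Theorem profile_exists : profile p g d h r m c U /\ satisfies_i_to_iv p g d h r q m k c U.
Proof.
split; first exact: profile_is_profile.
exists profile_start, profile_end, profile_node; split.
- exact: profile_satisfies_i.
- exact: profile_satisfies_ii.
- exact: profile_satisfies_iii.
- exact: profile_satisfies_iv.
Qed.

End ProfileOfSolution.

(** * From the profile to the boundary value problem *)

Section SolutionOfProfile.
Context {R : realType}.
Variables (p s : R) (g d h : R -> R) (r q : nat) (m k : nat -> R) (c : R) (U : R -> R).
Variables (z0 z1 : \bar R) (zeta : nat -> R).
Implicit Types (t x y z l : R).
Hypothesis hp : 1 < p.
Hypothesis hs : 0 < s < 1.
Hypothesis hg : standing_g s g.
Hypothesis hd : standing_d p g d r m.
Hypothesis hh : standing_h s h q k.
Hypothesis HU : profile p g d h r m c U.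
Hypothesis Hi : satisfies_i U z0 z1.
Hypothesis Hiii : satisfies_iii p d r U z0 z1 zeta.
Hypothesis Hiv : satisfies_iv p g d h r q m k c U.

Local Notation alpha := ((p - 1)^-1).
Local Notation f := (weighted_reaction p g d).
Local Notation ms := (interior_nodes r m).
Local Notation ks := (interior_nodes q k).

Let dpos t : 0 < t < 1 -> 0 < d t := d_gt0 hd (t := t).

Let Uc : continuous U. Proof. by have [[[_ ? _] _ _ _] _ _] := HU. Qed.
Let U01 z : 0 <= U z <= 1. Proof. by have [[[_ _ H] _ _ _] _ _] := HU; exact: H. Qed.

Let Uin z : 0 < U z < 1 <-> (z0 < z%:E < z1)%E.
Proof.
have [[_ E] _ _ _ _] := Hi.
have : [set z | 0 < U z < 1] z <-> [set z | (z0 < z%:E < z1)%E] z by rewrite E.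
by [].
Qed.

Let Uinj z z' : 0 < U z < 1 -> 0 < U z' < 1 -> z < z' -> U z' < U z.
Proof. by have [_ H _ _ _] := Hi => uz uz'; apply: H; rewrite inE. Qed.

Let Ubefore z : (z%:E <= z0)%E -> U z = 1. Proof. by have [_ _ _ [H _] _] := Hi; exact: H. Qed.
Let Uafter z : (z1 <= z%:E)%E -> U z = 0. Proof. by have [_ _ _ [_ H] _] := Hi; exact: H. Qed.

Let Un z z' : z <= z' -> U z' <= U z.
Proof.
rewrite le_eqVlt => /predU1P[->//|zz].
have [u01|nu] := pselect (0 < U z < 1).
  have [u01'|nu'] := pselect (0 < U z' < 1); first exact/ltW/Uinj.
  have [zz0|z0z] := leP z'%:E z0.
    exfalso; have /Uin/andP[h0 _] := u01; have : (z%:E < z'%:E)%E by rewrite lte_fin.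
    by move=> /(lt_le_trans)/(_ zz0) /(lt_trans h0); rewrite ltxx.
  have [zz1|z1z] := ltP z'%:E z1; first by exfalso; apply/nu'/Uin; rewrite z0z.
  by rewrite (Uafter z1z); have /andP[] := U01 z.
have [zz0|z0z] := leP z%:E z0; first by rewrite (Ubefore zz0); have /andP[] := U01 z'.
have [zz1|z1z] := ltP z%:E z1; first by exfalso; apply/nu/Uin; rewrite z0z.
rewrite (Uafter z1z) (Uafter (le_trans z1z _)) //.
by rewrite lee_fin ltW.
Qed.

Let Ulocal z : 0 < U z < 1 -> \forall y \near z, 0 < U y < 1.
Proof. exact: unit_level_near (@Uc z). Qed.

Let Uinj_eq z z' : 0 < U z < 1 -> U z = U z' -> z = z'.
Proof.
move=> u01 E; have u01' : 0 < U z' < 1 by rewrite -E.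
by have [zz|zz|//] := ltgtP z z'; [have := Uinj u01 u01' zz|have := Uinj u01' u01 zz]; rewrite E ltxx.
Qed.

Let Usurj t : 0 < t < 1 -> exists z, U z = t.
Proof.
move=> /andP[t0 t1]; have [_ UN UP] := HU.
have [a Ha] : exists a, t < U a.
  have [a [_ Ha]] := (cvgrPdist_lt _ _).1 UN (1 - t) ltac:(by rewrite subr_gt0).
  exists (a - 1); have := Ha (a - 1) ltac:(by rewrite ltrBlDr ltrDl).
  by rewrite ltr_norml; lra.
have [b Hb] : exists b, U b < t.
  have [b [_ Hb]] := (cvgrPdist_lt _ _).1 UP t t0.
  exists (b + 1); have := Hb (b + 1) ltac:(by rewrite ltrDl).
  by rewrite ltr_norml; lra.
have ab : a <= b by rewrite leNgt; apply/negP => ba; have := Un (ltW ba); lra.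
have [z _ Hz] : exists2 z, z \in `[a, b] & U z = t.
  apply: IVT => //; first exact: continuous_subspaceT.
  by rewrite ge_min le_max (ltW Ha) (ltW Hb) !orbT.
by exists z.
Qed.

Lemma profile_inverse_exists : exists T : R -> R, forall t, 0 < t < 1 -> U (T t) = t.
Proof.
have /choice[T HT] : forall t, exists z, 0 < t < 1 -> U z = t.
  move=> t; have [t01|nt] := pselect (0 < t < 1); last by exists 0.
  by have [z Hz] := Usurj t01; exists z.
by exists T.
Qed.

Variable T : R -> R.
Hypothesis UT : forall t, 0 < t < 1 -> U (T t) = t.

Let UT01 t : 0 < t < 1 -> 0 < U (T t) < 1. Proof. by move=> t01; rewrite UT. Qed.
Let TU z : 0 < U z < 1 -> T (U z) = z. Proof. by move=> u01; apply: Uinj_eq; rewrite UT. Qed.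

Let Tlt t z : 0 < t < 1 -> t < U z -> z < T t.
Proof. by move=> t01 tz; rewrite ltNge; apply/negP => /Un; rewrite UT //; lra. Qed.

Let Tgt t z : 0 < t < 1 -> U z < t -> T t < z.
Proof. by move=> t01 tz; rewrite ltNge; apply/negP => /Un; rewrite UT //; lra. Qed.

Let Tc t : 0 < t < 1 -> {for t, continuous T}.
Proof.
move=> t01; apply/for_contP => e e0.
have [e1 /= e10 He1] := (nbhs_ballP _ _).1 (Ulocal (UT01 t01)).
pose e2 := Num.min e e1 / 2.
have [e20 e2e e2e1] : [/\ 0 < e2, e2 < e & e2 < e1].
  by rewrite /e2 /Num.min; case: ifP => ?; split; lra.
have ua : 0 < U (T t - e2) < 1 by apply: He1; rewrite /ball /= opprB addrC subrK ger0_norm // ltW.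
have ub : 0 < U (T t + e2) < 1.
  by apply: He1; rewrite /ball /= opprD addrA subrr add0r normrN ger0_norm // ltW.
have ha : t < U (T t - e2) by rewrite -{1}(UT t01); apply: Uinj => //; [exact: UT01|lra].
have hb : U (T t + e2) < t by rewrite -{2}(UT t01); apply: Uinj => //; [exact: UT01|lra].
exists (Num.min (U (T t - e2) - t) (t - U (T t + e2))); first by rewrite lt_min !subr_gt0 ha.
move=> u; rewrite lt_min !ltr_norml => /andP[/andP[_ h1] /andP[h2 _]].
have u01 : 0 < u < 1 by lra.
have : T t - e2 < T u by apply: Tlt => //; lra.
have : T u < T t + e2 by apply: Tgt => //; lra.
lra.
Qed.

Let DM z : 0 < U z < 1 -> U z \notin ms -> ~ boundary (M_set r m U) z.
Proof.
by move=> u01 um /(boundary_closed (M_set_closed Uc))/M_setP; exact/negP.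
Qed.

Let DN z : 0 < U z < 1 -> ~ boundary (N_set U) z.
Proof.
by move=> u01 /(boundary_closed (N_set_closed Uc))[] E; rewrite E ltxx ?andbF in u01.
Qed.

Let bM z : M_set r m U z -> boundary (M_set r m U) z.
Proof.
have [_ _ [sm _ _] _ _] := hd => Mz.
have u01 : 0 < U z < 1 by have [i hi ->] := Mz; exact: subdivision_in sm hi.
exact: boundary_M_set Uc Uinj u01 Mz.
Qed.

Local Notation V := (extended_flux p d r m U).

Let Vc : continuous V. Proof. by have [[_ _ _ [? _ _ _]] _ _] := HU. Qed.

Let Vflux z : 0 < U z < 1 -> U z \notin ms -> V z = flux p d U z.
Proof.
move=> u01 um; rewrite /extended_flux.
case: ifPn => [/set_mem/(DN u01)//|_].
by case: ifPn => [/set_mem/(DM u01 um)//|_].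
Qed.

Let Uderivable z : 0 < U z < 1 -> U z \notin ms -> derivable U z 1 /\ derive1 U z < 0.
Proof.
move=> u01 um; have [[_ [HC Hne] _ _] _ _] := HU.
have nD : ~ D_set r m U z by case; [exact: DM|exact: DN].
have [dU _] := HC z nD; split=> //; rewrite lt_neqAle Hne //.
exact: derive1_le0.
Qed.

(** At a jump of [d] the flux is negative because [d (U x)] stays away from
    [0] as [x] tends to [z]. *)
Let Vneg z : 0 < U z < 1 -> V z < 0.
Proof.
move=> u01; have [um|um] := boolP (U z \in ms); last first.
  rewrite Vflux // /flux; have [_ D] := Uderivable u01 um.
  by rewrite pmulr_rlt0 ?dpos // /signed_pow pmulr_rlt0 // powR_gt0 // normr_gt0 lt_eqF.
have bz : boundary (M_set r m U) z by apply/bM/M_setP.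
rewrite /extended_flux.
case: ifPn => [/set_mem/(DN u01)//|_]; rewrite mem_set //.
have [[_ _ Hb _] _ _] := HU; have [[ld l0] _ [cd _ _]] := Hb z bz.
have ln : left_derivative U z < 0 by rewrite lt_neqAle l0 left_derivative_le0.
rewrite /left_flux /signed_pow -mulrA pmulr_rlt0; last first.
  by rewrite powR_gt0 // normr_gt0.
rewrite nmulr_rlt0 //.
have [l lpos Hl] := d_near_lower hd u01.
apply: lt_le_trans lpos _; apply: (cvgr_to_ge cd).
by apply: cvg_within; exact: (@Uc z _ Hl).
Qed.

Definition solution_of_profile := close_ends (fun t => - V (T t)) 0 1 0 0.
Local Notation w := solution_of_profile.

Let wE t : 0 < t < 1 -> w t = - V (T t). Proof. exact: close_endsE. Qed.

Let slope t : 0 < t < 1 -> t \notin ms ->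
  derivable U (T t) 1 /\ derive1 U (T t) = - profile_speed p d w t.
Proof.
move=> t01 tm; have tm' : U (T t) \notin ms by rewrite UT.
have [dU _] := Uderivable (UT01 t01) tm'; split=> //.
have wp : 0 < w t by rewrite wE // oppr_gt0; exact: Vneg (UT01 t01).
apply: signed_pow_inv => //; first by rewrite divr_gt0 // dpos.
rewrite wE // (Vflux (UT01 t01) tm') /flux UT //.
by field; rewrite gt_eqF // dpos.
Qed.

Let Tderive t : 0 < t < 1 -> t \notin ms ->
  is_derive t (1 : R) T (- (profile_speed p d w t)^-1).
Proof.
move=> t01 tm; have [dU E] := slope t01 tm.
have vp : 0 < profile_speed p d w t.
  by rewrite powR_gt0 // divr_gt0 ?dpos // wE // oppr_gt0; exact: Vneg (UT01 t01).
have -> : - (profile_speed p d w t)^-1 = (derive1 U (T t))^-1 by rewrite E invrN.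
rewrite -{1}(UT t01); apply: is_derive_inverse.
- by apply: filterS (Ulocal (UT01 t01)) => y; exact: TU.
- by near=> y; exact: @Uc.
- by rewrite derive1E; exact: derivableP.
- by rewrite E oppr_eq0 gt_eqF.
Unshelve. all: by end_near. Qed.

(** Condition (iii) gives the values of [w] at [0] and [1], condition (iv) its
    derivative off the jumps. *)
Lemma solution_of_profile_bvp : wave_bvp p g d h r q m k c w.
Proof.
have Vpos t : 0 < t < 1 -> 0 < - V (T t) by move=> t01; rewrite oppr_gt0; exact: Vneg (UT01 t01).
have [[/andP[z00 z10] _] _ _ _ _] := Hi.
have [L0 L1 _] := Hiii.
split.
- apply: close_ends_within => //.
  + move=> t t01; apply: continuousN; apply: (@continuous_comp _ _ _ T V); first exact: Tc.
    exact: @Vc.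
  + have z1N : z1 != -oo%E by apply: contraTneq z10 => ->; rewrite ltNge leNye.
    have [n0 n00 Hn0] := seq_isolated ms 0.
    apply/at_rightP => e /((cvg_right_endP (flux p d U) 0 z1N).1 L1)[a az Ha].
    have Ua : 0 < U a.
      have [az0|z0a] := leP a%:E z0; first by rewrite Ubefore.
      by have /andP[] : 0 < U a < 1 by apply/Uin; rewrite z0a.
    exists (Num.min (Num.min (U a) 1) n0); first by rewrite !lt_min Ua ltr01.
    move=> t; rewrite add0r !lt_min => /andP[t0 /andP[/andP[ta t1] tn]].
    have t01 : 0 < t < 1 by rewrite t0.
    have tm : U (T t) \notin ms.
      by rewrite UT //; apply: Hn0; [rewrite gt_eqF|rewrite subr0 ger0_norm // ltW].
    rewrite subr0 normrN (Vflux (UT01 t01) tm) -[flux _ _ _ _]subr0; apply: Ha.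
      exact: Tlt.
    by have /Uin/andP[] := UT01 t01.
  + have z0N : z0 != +oo%E by apply: contraTneq z00 => ->; rewrite ltNge leey.
    have [n0 n00 Hn0] := seq_isolated ms 1.
    apply/at_leftP => e /((cvg_left_endP (flux p d U) 0 z0N).1 L0)[a az Ha].
    have Ua : U a < 1.
      have [z1a|az1] := leP z1 a%:E; first by rewrite Uafter.
      by have /andP[] : 0 < U a < 1 by apply/Uin; rewrite az.
    exists (Num.min (Num.min (1 - U a) 1) n0); first by rewrite !lt_min subr_gt0 Ua ltr01.
    move=> t /andP[td t1]; have : 1 - t < Num.min (Num.min (1 - U a) 1) n0 by lra.
    rewrite !lt_min => /andP[/andP[ta t0] tn].
    have t01 : 0 < t < 1 by lra.
    have tm : U (T t) \notin ms.
      rewrite UT //; apply: Hn0; first by rewrite lt_eqF.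
      by rewrite distrC ger0_norm // subr_ge0 ltW.
    rewrite subr0 normrN (Vflux (UT01 t01) tm) -[flux _ _ _ _]subr0; apply: Ha.
      by have /Uin/andP[] := UT01 t01.
    by apply: Tgt => //; lra.
- exact: close_ends_l.
- exact: close_ends_r.
- by move=> t t01; rewrite wE //; exact: Vpos.
- move=> t t01; rewrite mem_cat negb_or => /andP[tm tk].
  have tm' : U (T t) \notin ms by rewrite UT.
  have [|dU dF ode] := @Hiv (T t).
    case=> [[/(DM (UT01 t01) tm')//|/K_setP]|/(DN (UT01 t01))//].
    by rewrite UT // (negbTE tk).
  have [_ E] := slope t01 tm.
  have D1 : is_derive (T t) (1 : R) (flux p d U) (derive1 (flux p d U) (T t)).
    by rewrite derive1E; exact: derivableP.
  have D2 := @is_derive1_comp _ (flux p d U) T t _ _ D1 (Tderive t01 tm).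
  have nE : {near t, (fun u => - flux p d U (T u)) =1 w}.
    have n01 := unit_interval_near t01.
    have nm : \forall u \near t, u \notin ms by exact: (level_near (U := id)) (@cvg_id _ _) tm.
    near=> u.
    have u01 : 0 < u < 1 by near: u.
    have um : u \notin ms by near: u.
    by rewrite wE // Vflux ?UT.
  apply: (near_eq_is_derive nE).
  have D3 : is_derive t (1 : R) (fun u => - flux p d U (T u))
      (- (derive1 (flux p d U) (T t) * - (profile_speed p d w t)^-1)) by exact: is_deriveN.
  apply: (is_derive_eq D3).
  have wp : 0 < w t by rewrite wE //; exact: Vpos.
  have vp : 0 < profile_speed p d w t by rewrite powR_gt0 // divr_gt0 // dpos.
  have F' : derive1 (flux p d U) (T t) = (c - h t) * profile_speed p d w t - g t.
    by move: ode; rewrite E UT //; lra.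
  have gE := reaction_balance alpha (g t) wp (dpos t01).
  rewrite F' -[in LHS]gE -/(profile_speed p d w t) -/(weighted_reaction p g d t).
  by field; rewrite gt_eqF.
Unshelve. all: by end_near. Qed.

(** The inverse [T] of [U] and the time built from [w] have the same slope off
    the jumps of [d], and both vanish at [1 / 2]. *)
Lemma profile_of_solution_of_profile : U = profile_of p d w.
Proof.
have ws := solution_of_profile_bvp.
have ZT t : 0 < t < 1 -> profile_time p d w t = T t.
  have key a b : 0 < a -> a <= b -> b < 1 ->
      profile_time p d w b - T b = profile_time p d w a - T a.
    move=> a_0 ab b1; apply: (@cst_off_finite _ (fun t => profile_time p d w t - T t) ms) => //.
      apply: within_B; apply: within_of_for => x xab; last by apply: Tc; lra.
      by have [] := profile_time_at hp hd ws (t := x) ltac:(lra).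
    move=> x xab xm; have x01 : 0 < x < 1 by lra.
    have [_ /(_ xm) D1] := profile_time_at hp hd ws x01.
    have D2 := Tderive x01 xm.
    by rewrite -(subrr (- (profile_speed p d w x)^-1)); exact: is_deriveB.
  have h01 : 0 < (2^-1 : R) < 1 by lra.
  have T0 : T 2^-1 = 0.
    by have [_ _ U0 _ _] := Hi; rewrite -U0 TU // U0.
  have Z0 := profile_time_half p d w.
  move=> /andP[t0 t1]; have [th|ht] := leP t 2^-1.
    by have /andP[_ h1] := h01; have := key _ _ t0 th h1; rewrite T0 Z0; lra.
  by have /andP[h0 _] := h01; have := key _ _ h0 (ltW ht) t1; rewrite T0 Z0; lra.
have Zd := profile_time_decr hp hd ws.
apply/funext => z; have [u01|nu] := pselect (0 < U z < 1).
  by rewrite -{2}(TU u01) -(ZT _ u01) /profile_of extended_inverseK.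
have /andP[P0 P1] := extended_inverse01 (profile_time p d w) z.
have [zz0|z0z] := leP z%:E z0.
  rewrite (Ubefore zz0); apply/eqP; rewrite eq_le P1 andbT.
  apply/ler_addgt0Pr => e e0; pose t := Num.max (1 / 2) (1 - e / 2).
  have [t01 te] : 0 < t < 1 /\ 1 - e < t.
    by rewrite /t /Num.max; case: ifP => ?; split; lra.
  have zt : z <= profile_time p d w t.
    rewrite ZT // -lee_fin; apply: le_trans zz0 _.
    by have /Uin/andP[/ltW] := UT01 t01.
  by have := extended_inverse_ge t01 zt; rewrite /profile_of; lra.
have [zz1|z1z] := ltP z%:E z1; first by exfalso; apply/nu/Uin; rewrite z0z.
rewrite (Uafter z1z); apply/eqP; rewrite eq_le P0 /=.
apply/ler_addgt0Pr => e e0; pose t := Num.min (1 / 2) (e / 2).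
have [t01 te] : 0 < t < 1 /\ t < e.
  by rewrite /t /Num.min; case: ifP => ?; split; lra.
have zt : profile_time p d w t < z.
  rewrite ZT // -lte_fin; apply: lt_le_trans z1z.
  by have /Uin/andP[] := UT01 t01.
by have := extended_inverse_le Zd t01 zt; rewrite /profile_of; lra.
Qed.

End SolutionOfProfile.

Section ProfileUniqueness.
Context {R : realType}.
Variables (p s : R) (g d h : R -> R) (r q : nat) (m k : nat -> R).
Hypothesis hp : 1 < p.
Hypothesis hs : 0 < s < 1.
Hypothesis hg : standing_g s g.
Hypothesis hd : standing_d p g d r m.
Hypothesis hh : standing_h s h q k.

Lemma profile_reduction c U :
  profile p g d h r m c U /\ satisfies_i_to_iv p g d h r q m k c U ->
  exists2 w, wave_bvp p g d h r q m k c w & U = profile_of p d w.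
Proof.
move=> [HU [z0 [z1 [zeta [Hi _ Hiii Hiv]]]]].
have [T UT] := profile_inverse_exists HU Hi.
exists (solution_of_profile p d r m U T).
  exact: (solution_of_profile_bvp hp hd HU Hi Hiii Hiv UT).
exact: (profile_of_solution_of_profile hp hd HU Hi Hiii Hiv UT).
Qed.

Lemma profile_of_ext (v w : R -> R) : (forall t, 0 <= t <= 1 -> v t = w t) ->
  profile_of p d v = profile_of p d w.
Proof.
move=> vw; apply: extended_inverse_ext => t t01.
apply: (congr1 -%R); apply: eq_oriented_integral => x.
rewrite /Num.min /Num.max; case: ifP => _ xt; rewrite vw //; lra.
Qed.

End ProfileUniqueness.

(** * Bounds on the speed and the theorem *)

Section SpeedBounds.
Context {R : realType}.
Implicit Types (t x y : R).

(** An infinite supremum makes the bound on the speed void. *)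
Lemma speed_lower_ereal (e C b c : R) (M : \bar R) : e != 0 -> 0 < C -> (0 < M)%E ->
  (forall y, 0 < y -> M = y%:E -> b - C * y `^ e < c) ->
  (b%:E - C%:E * M `^ e < c%:E)%E.
Proof.
move=> e0 C0; case: M => [y| |] // M0 H.
  by rewrite poweR_EFin -EFinM -EFinB lte_fin; apply: H.
by rewrite poweRyr // gt0_muley ?lte_fin // ltNyr.
Qed.

Lemma speed_upper_ereal (e C b c : R) (M : \bar R) : e != 0 -> 0 < C -> (0 < M)%E ->
  (forall y, 0 < y -> M = y%:E -> c < b + C * y `^ e) ->
  (c%:E < b%:E + C%:E * M `^ e)%E.
Proof.
move=> e0 C0; case: M => [y| |] // M0 H.
  by rewrite poweR_EFin -EFinM -EFinD lte_fin; apply: H.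
by rewrite poweRyr // gt0_muley ?lte_fin // ltry.
Qed.

End SpeedBounds.

Unset Implicit Arguments.
Set Strict Implicit.

Theorem theorem2p2 (R : realType) (p p' s : R) (g d h : R -> R)
    (r q : nat) (m k : nat -> R)
    (hp : 1 < p) (hp' : p^-1 + p'^-1 = 1) (hs : 0 < s < 1)
    (hg : standing_g s g) (hd : standing_d p g d r m) (hh : standing_h s h q k) :
  let h_M : R := sup [set h t | t in `[s, 1]] in
  let h_m : R := inf [set h t | t in `[0, s]] in
  let mu1 : \bar R := ereal_sup
    [set (- (d t `^ (p - 1)^-1 * g t) / (s - t) `^ (p' - 1))%:E
      | t in `]0, s[] in
  let mu2 : \bar R := ereal_sup
    [set ((d t `^ (p - 1)^-1 * g t) / (t - s) `^ (p' - 1))%:E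
      | t in `]s, 1[] in
  let C : R := p' `^ p'^-1 * p `^ p^-1 in
  (exists2 t_star : R, 0 <= t_star <= 1 /\ t_star != s &
    oriented_integral (fun t => h s - h t) s t_star <= 0) ->
  [/\ (0 < mu1)%E, (0 < mu2)%E &
    exists c_star : R,
      (h_m%:E - C%:E * mu1 `^ p'^-1 < c_star%:E < h_M%:E + C%:E * mu2 `^ p'^-1)%E
      /\ forall c : R,
        (exists! U : R -> R,
          profile p g d h r m c U /\ satisfies_i_to_iv p g d h r q m k c U)
        <-> c = c_star].
Proof.
move=> h_M h_m mu1 mu2 C Hstar.
have [_ _ gneg gpos] := hg; have /andP[s0 s1] := hs.
have p0 : 0 < p by apply: lt_trans hp.
have p'V : p'^-1 = (p - 1) / p by move: hp' => /(canRL (addKr _)) ->; field; rewrite gt_eqF.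
have p'E : p' = p / (p - 1) by rewrite -[LHS]invrK p'V invf_div.
have p'0 : 0 < p' by rewrite p'E divr_gt0 // subr_gt0.
have pE : p' - 1 = (p - 1)^-1 by rewrite p'E; field; rewrite gt_eqF // subr_gt0.
have C0 : 0 < C by rewrite mulr_gt0 ?powR_gt0.
have p'n : p'^-1 != 0 by rewrite invr_eq0 gt_eqF.
have dp t : 0 < t < 1 -> 0 < d t `^ (p - 1)^-1 by move=> t01; rewrite powR_gt0 // (d_gt0 hd).
have mu1ub t : 0 < t < s ->
    ((- (d t `^ (p - 1)^-1 * g t) / (s - t) `^ (p' - 1))%:E <= mu1)%E.
  by move=> ts; apply: ereal_sup_ubound; exists t => //; rewrite /= in_itv.
have mu2ub t : s < t < 1 ->
    (((d t `^ (p - 1)^-1 * g t) / (t - s) `^ (p' - 1))%:E <= mu2)%E.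
  by move=> ts; apply: ereal_sup_ubound; exists t => //; rewrite /= in_itv.
have mu1_gt0 : (0 < mu1)%E.
  have ts : 0 < s / 2 < s by lra.
  apply: lt_le_trans (mu1ub _ ts); rewrite lte_fin divr_gt0 //; last first.
    by rewrite powR_gt0 //; lra.
  rewrite oppr_gt0 pmulr_rlt0; first by apply: gneg; rewrite in_itv.
  by apply: dp; lra.
have mu2_gt0 : (0 < mu2)%E.
  have ts : s < (s + 1) / 2 < 1 by lra.
  apply: lt_le_trans (mu2ub _ ts); rewrite lte_fin divr_gt0 //; last first.
    by rewrite powR_gt0 //; lra.
  rewrite mulr_gt0 //; last by apply: gpos; rewrite in_itv.
  by apply: dp; lra.
split=> //.
have [c [w ws]] := wave_exists hp hs hg hd hh Hstar.
have [H HH] := h_bounded hh.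
exists c; split.
  apply/andP; split.
    apply: speed_lower_ereal => // y y0 My; apply: (wave_speed_lower hp hs hg hd hp' y0 ws) => t ts.
      apply: ge_inf; last by exists t => //; rewrite /= in_itv /=; lra.
      exists (- H) => _ [x + <-]; rewrite /= in_itv /= => xs.
      by have := HH x ltac:(lra); rewrite ler_norml; lra.
    have := mu1ub t ts; rewrite My lee_fin pE ler_pdivrMr //.
    by rewrite powR_gt0 //; lra.
  apply: speed_upper_ereal => // y y0 My; apply: (wave_speed_upper hp hs hg hd hp' y0 ws) => t ts.
    apply: ub_le_sup; last by exists t => //; rewrite /= in_itv /=; lra.
    exists H => _ [x + <-]; rewrite /= in_itv /= => xs.
    by have := HH x ltac:(lra); rewrite ler_norml; lra.
  have := mu2ub t ts; rewrite My lee_fin pE ler_pdivrMr //.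
  by rewrite powR_gt0 //; lra.
move=> c'; split=> [[U [HU _]]|->].
  have [w' ws' _] := profile_reduction hp hd HU.
  exact: (wave_speed_unique hp hs hg hd ws' ws).
exists (profile_of p d w); split; first exact: (profile_exists hp hg hd hh ws).
move=> U /(profile_reduction hp hd)[w' ws' ->].
apply: profile_of_ext => t t01.
exact: (wave_unique hp hs hg hd ws ws').
Qed.
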